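(* Let $K$ be a complete, algebraically closed nonarchimedean valued field and let $\varphi(z)\in K(z)$ have degree $d\ge1$. Then $$\mathrm{Lip}_{\mathrm{Berk}}(\varphi)\le\max\Big(\frac{1}{\mathrm{GIR}(\varphi)\cdot B_0(\varphi)^d},\ \frac{d}{\mathrm{GIR}(\varphi)^{1/d}\cdot B_0(\varphi)}\Big).$$
   Context: $K$ is a complete, algebraically closed field with a nontrivial nonarchimedean absolute value $|\cdot|$; $\mathcal O=\{z\in K:|z|\le 1\}$. Fix $q>1$ and write $\log=\log_q$. $\mathbf P^1_{\mathrm{Berk}}$ is the Berkovich projective line over $K$: a uniquely path-connected tree containing $\mathbf P^1(K)=K\cup\{\infty\}$; for $a\in K$, $r>0$, $\zeta_{a,r}$ is the point corresponding to the disc $D(a,r)=\{z:|z-a|\le r\}$, $\zeta_{a,0}=a$, $\zeta_G=\zeta_{0,1}$ is the Gauss point; $[x,y]$ is the unique path, $(x,y]$ etc. the half-open paths. On $\mathbf H^1=\mathbf P^1_{\mathrm{Berk}}\setminus\mathbf P^1(K)$ the logarithmic path metric $\rho$ gives the path $\{\zeta_{a,r}:R_1\le r\le R_2\}$ length $\log(R_2/R_1)$. $\mathrm{diam}_G(x)=q^{-\rho(\zeta_G,x)}$ for $x\in\mathbf H^1$, $0$ for $x\in\mathbf P^1(K)$; explicitly $\mathrm{diam}_G(\zeta_{a,r})=r/\max(1,|a|,r)^2$. $x\vee_G y$ is the first point where $[x,\zeta_G]$ and $[y,\zeta_G]$ meet; $d(x,y)=2\,\mathrm{diam}_G(x\vee_G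 y)-\mathrm{diam}_G(x)-\mathrm{diam}_G(y)$. A nonconstant $\varphi\in K(z)$ acts continuously on $\mathbf P^1_{\mathrm{Berk}}$; $\mathrm{Lip}_{\mathrm{Berk}}(\varphi)=\sup_{x\ne y} d(\varphi(x),\varphi(y))/d(x,y)$. Gauss Image radius: $\mathrm{GIR}(\varphi)=\mathrm{diam}_G(\varphi(\zeta_G))$. For $a\in\mathbf P^1(K)$ and $0<r<1$ let $Q_{a,r}$ be the unique point of $[a,\zeta_G]$ with $\mathrm{diam}_G(Q_{a,r})=r$, and $\mathcal B(a,r)^-=\{x\in\mathbf P^1_{\mathrm{Berk}}:Q_{a,r}\in(x,\zeta_G]\}$; $\mathcal B(a,1)^-=\bigcup_{r<1}\mathcal B(a,r)^-$. Ball-Mapping radius: $B_0(\varphi)=\sup\{0<r\le1:\ \varphi(\mathcal B(a,r)^-)\ne\mathbf P^1_{\mathrm{Berk}}\text{ for all }a\in\mathbf P^1(K)\}$. *)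

(* Defs.v *)
From HB Require Import structures.
From mathcomp Require Import all_boot all_order all_algebra.
From Stdlib Require Import Reals ClassicalEpsilon.

Set Implicit Arguments.
Unset Strict Implicit.
Unset Printing Implicit Defensive.

Section Berk.
Variable K : closedFieldType.
Variable abs : K -> R.

Local Open Scope ring_scope.
Definition Kzero : K := 0.
Definition Kmul (x y : K) : K := x * y.
Definition Kadd (x y : K) : K := x + y.
Definition Ksub (x y : K) : K := x - y.
Definition Pmul (h k : {poly K}) : {poly K} := h * k.
Definition Padd (h k : {poly K}) : {poly K} := h + k.
Definition Pconst (c : K) : {poly K} := c%:P.
Definition Plin (a : K) : {poly K} := 'X - a%:P.
Definition Peval (h : {poly K}) (c : K) : K := h.[c].
(* homogenised composition g^(deg h) * h(f/g) *)
Definition comp_poly_rat (f g h : {poly K}) : {poly K} :=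
  \sum_(i < size h) (h`_i *: (f ^+ i * g ^+ ((size h).-1 - i))).
Definition value_at_infinity (f g : {poly K}) : K :=
  if ltn (size f) (size g) then 0 else lead_coef f / lead_coef g.
Local Close Scope ring_scope.

Local Open Scope R_scope.

Definition nonarch_complete_abs : Prop :=
  (forall x, 0 <= abs x) /\
  (forall x, abs x = 0 <-> x = Kzero) /\
  (forall x y, abs (Kmul x y) = abs x * abs y) /\
  (forall x y, abs (Kadd x y) <= Rmax (abs x) (abs y)) /\
  (exists x, abs x <> 0 /\ abs x <> 1) /\
  (forall u : nat -> K,
     (forall eps, 0 < eps -> exists N, forall m n, (N <= m)%nat -> (N <= n)%nat ->
        abs (Ksub (u m) (u n)) < eps) ->
     exists l, forall eps, 0 < eps -> exists N, forall n, (N <= n)%nat ->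
        abs (Ksub (u n) l) < eps).

(* Points of A^1_Berk: multiplicative seminorms on K[T] extending |.| *)
Definition is_seminorm (x : {poly K} -> R) : Prop :=
  (forall h, 0 <= x h) /\
  (forall h k, x (Pmul h k) = x h * x k) /\
  (forall h k, x (Padd h k) <= Rmax (x h) (x k)) /\
  (forall c, x (Pconst c) = abs c).

(* P^1_Berk = A^1_Berk plus the point infinity (None) *)
Definition bpoint := option ({poly K} -> R).

Definition is_berk (P : bpoint) : Prop :=
  match P with None => True | Some x => is_seminorm x end.

(* Domination order = tree order of P^1_Berk rooted at infinity *)
Definition le_b (P Q : bpoint) : Prop :=
  match P, Q with
  | _, None => True
  | None, Some _ => False
  | Some x, Some y => forall h, x h <= y h
  end.

Definition is_join (P Q J : bpoint) : Prop :=
  is_berk J /\ le_b P J /\ le_b Q J /\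
  (forall J', is_berk J' -> le_b P J' -> le_b Q J' -> le_b J J').

Definition bjoin (P Q : bpoint) : bpoint :=
  epsilon (inhabits None) (is_join P Q).

Definition median (P Q S : bpoint) : bpoint :=
  epsilon (inhabits None) (fun M =>
    (M = bjoin P Q \/ M = bjoin Q S \/ M = bjoin P S) /\
    le_b M (bjoin P Q) /\ le_b M (bjoin Q S) /\ le_b M (bjoin P S)).

Definition on_path (P Q M : bpoint) : Prop := median P Q M = M.

Definition gauss_norm (h : {poly K}) : R := foldr Rmax 0 (map abs h).
Definition zetaG : bpoint := Some gauss_norm.
Definition typeI (c : K) : bpoint := Some (fun h => abs (Peval h c)).

Definition radius (x : {poly K} -> R) : R :=
  epsilon (inhabits 0) (fun m =>
    (forall a, m <= x (Plin a)) /\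
    (forall m', (forall a, m' <= x (Plin a)) -> m' <= m)).

(* diam_G ; for zeta_{a,r} this is r / max(1,|a|,r)^2 *)
Definition diamG (P : bpoint) : R :=
  match P with
  | None => 0
  | Some x => radius x / (Rmax 1 (x (Plin Kzero))) ^ 2
  end.

Definition joinG (P Q : bpoint) : bpoint := median P Q zetaG.

Definition berk_dist (P Q : bpoint) : R :=
  2 * diamG (joinG P Q) - diamG P - diamG Q.

Definition push (f g : {poly K}) (x : {poly K} -> R) : {poly K} -> R :=
  fun h => x (comp_poly_rat f g h) / (x g) ^ ((size h).-1).

Definition phi_act (f g : {poly K}) (P : bpoint) : bpoint :=
  match P with
  | None =>
      if ltn (size g) (size f) then None
      else typeI (value_at_infinity f g)
  | Some x =>
      if Req_EM_T (x g) 0 then None else Some (push f g x)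
  end.

Definition GIR (f g : {poly K}) : R := diamG (phi_act f g zetaG).

Definition Qpt (a : bpoint) (r : R) : bpoint :=
  epsilon (inhabits None) (fun M => is_berk M /\ on_path a zetaG M /\ diamG M = r).

Definition ball_lt (a : bpoint) (r : R) (P : bpoint) : Prop :=
  on_path P zetaG (Qpt a r) /\ Qpt a r <> P.

Definition ballm (a : bpoint) (r : R) (P : bpoint) : Prop :=
  (r < 1 /\ ball_lt a r P) \/
  (1 <= r /\ exists r', 0 < r' < 1 /\ ball_lt a r' P).

Definition classical_point (a : bpoint) : Prop :=
  a = None \/ exists c, a = typeI c.

(* the set whose sup is B_0(phi) *)
Definition B0set (f g : {poly K}) (r : R) : Prop :=
  0 < r <= 1 /\
  forall a, classical_point a ->
    exists Y, is_berk Y /\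
      forall X, is_berk X -> ballm a r X -> phi_act f g X <> Y.

End Berk.

(* Main.v *)
(** A point [P] of the Berkovich line is encoded by the ultrametric norm [ell P] that
it induces on linear forms [u X + v Z], scaled so that [max(|X|, |Z|) = 1].  In these
terms [diam_G (P v_G Q)] is the infimum over unit forms of [max (ell P, ell Q)]; this
kernel is ultrametric, so the distance satisfies the triangle inequality and it
suffices to bound [phi] along the segments [Q_{a,t}], [0 < t <= 1].  In a coordinate
centred at [a], [Q_{a,t}] is the Gauss norm [N_t], and where [N_t(g) = |g_i| t^i]
dominates [N_t(f)], subtracting a multiple of [g] from [f] gives [p] with [p_i = 0]
and [diam_G (phi Q_{a,t}) = max_j |p_j| t^(j-i) / |g_i|].  A dominant index [j] makes
this function have slope [n diam_G(phi Q_{a,t}) / t] with [n = |j - i| <= d].  For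
[t >= B_0] this is at most [d / B_0].  For [t < r < B_0] some combination [h] of [f] and
[g] has no zero in the disc of radius [r], hence [|h_0| >= |h_j| r^j], which gives
[GIR r^d max(N_1 f, N_1 g) <= |h_0|] and then the slope bound [n (GIR r^d)^(-1/n)];
this is largest at [n = 1] or [n = d]. *)

Require Import Defs.
From HB Require Import structures.
From mathcomp Require Import all_boot all_order all_algebra.
From mathcomp Require filter.
From mathcomp Require Import ring.
Ltac kring := ring.
Ltac kfield := field.
From Stdlib Require Import Reals ClassicalEpsilon FunctionalExtensionality Lra.

Set Implicit Arguments.
Unset Strict Implicit.
Unset Printing Implicit Defensive.

Import GRing.Theory.
Delimit Scope ring_scope with ring.
Delimit Scope nat_scope with N.
Local Open Scope R_scope.

(** Linear forms suffice because over an algebraically closed field a multiplicative seminorm is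
    determined by its values on linear polynomials, and because [phi] acts on them by substitution:
    the image of [x] has the value [x (u f + v g)], normalised, at the form [u X + v Z]. Metric
    statements about images thus become inequalities between values of [x]. At the Gauss point this
    makes GIR the infimum of [N_1 (u f + v g) / max (N_1 f, N_1 g)] over unit forms, which bounds
    [N_1 h] from below; the factor [r^d] is the loss in passing from [N_1 h] to [|h_0|]. Several
    obstacles shape the rest. The dominant index changes along a segment, so the slope bound holds
    only on each of finitely many closed pieces. The point missed by a ball need not be classical,
    whereas [h] comes from a missed point of [P^1(K)]: compactness, in the form of ultrafilter
    limits, provides one. Points that are not Gauss norms are reached as limits of Gauss points, and
    points near infinity through [1/T], which fixes the Gauss point and hence GIR. The supremum
    [B_0] is not assumed to be attained, so the estimates are made at smaller radii. *)

(** * Elementary estimates for powers and roots of reals *)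

Lemma le_nat_INR (m n : nat) : leq m n -> INR m <= INR n.
Proof. by move=> /leP; exact: le_INR. Qed.

Lemma INR_ge1 (n : nat) : leq 1 n -> 1 <= INR n.
Proof. exact: le_nat_INR. Qed.

Lemma Rmax_eq1_mul_le (a b x : R) :
  Rmax a b = 1 -> 0 <= x <= 1 -> x <= Rmax (a * x) b.
Proof.
move=> ab x01; case: (Rle_dec a b) => h.
- by rewrite Rmax_right in ab => //; have := Rmax_r (a * x) b; lra.
- rewrite Rmax_left in ab; last lra.
  by have := Rmax_l (a * x) b; rewrite ab; lra.
Qed.

(** Writing the derivative as [n] times the value over [t] avoids the exponent [n - 1]; in this
    shape a slope is bounded by bounding [value / t]. *)
Lemma pow_sub_le (s t : R) (n : nat) :
  0 < s <= t -> t ^ n - s ^ n <= INR n * (t ^ n / t) * (t - s).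
Proof.
move=> st; elim: n => [|n IH]; first by rewrite /=; lra.
have -> : t ^ n.+1 / t = t ^ n by rewrite /=; field; lra.
have h1 : s * (t ^ n - s ^ n) <= t * (INR n * (t ^ n / t) * (t - s)).
  apply: (Rle_trans _ (s * (INR n * (t ^ n / t) * (t - s)))).
    by apply: Rmult_le_compat_l; lra.
  apply: Rmult_le_compat_r; last lra.
  apply: Rmult_le_pos; last lra; apply: Rmult_le_pos; first exact: pos_INR.
  apply: Rmult_le_pos; first by apply: pow_le; lra.
  by apply/Rlt_le/Rinv_0_lt_compat; lra.
have h2 : t * (INR n * (t ^ n / t) * (t - s)) = INR n * t ^ n * (t - s).
  by field; lra.
by rewrite S_INR /=; lra.
Qed.

(** This is [pow_sub_le] for [/ t <= / s], where the resulting factor [(t - s) / t] is enlarged to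
    [(t - s) / s]. *)
Lemma inv_pow_sub_le (s t : R) (n : nat) :
  0 < s <= t -> / s ^ n - / t ^ n <= INR n * (/ s ^ n / s) * (t - s).
Proof.
move=> st.
have hs : 0 < / t <= / s.
  split; first by apply: Rinv_0_lt_compat; lra.
  by apply: Rinv_le_contravar; lra.
have := pow_sub_le n hs; rewrite !pow_inv => h; apply: Rle_trans h _.
have -> : INR n * (/ s ^ n / / s) * (/ s - / t) = (INR n * / s ^ n) * ((t - s) * / t).
  have p : s ^ n <> 0 by apply: pow_nonzero; lra.
  by field; split => //; lra.
have -> : INR n * (/ s ^ n / s) * (t - s) = (INR n * / s ^ n) * ((t - s) * / s).
  have p : s ^ n <> 0 by apply: pow_nonzero; lra.
  by field; split => //; lra.
apply: Rmult_le_compat_l.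
  apply: Rmult_le_pos; first exact: pos_INR.
  by apply/Rlt_le/Rinv_0_lt_compat/pow_lt; lra.
by apply: Rmult_le_compat_l; lra.
Qed.

Lemma pow_root (A : R) (n : nat) :
  0 < A -> leq 1 n -> Rpower A (/ INR n) ^ n = A.
Proof.
move=> A0 n1; have nn := INR_ge1 n1.
rewrite -Rpower_pow; last exact: exp_pos.
rewrite Rpower_mult Rinv_l; last lra.
exact: Rpower_1.
Qed.

Lemma pow_le_inv (a t : R) (n : nat) : 0 <= t -> leq 1 n -> a ^ n <= t ^ n -> a <= t.
Proof.
move=> t0 n1 h; apply: Rnot_lt_le => ta.
have : t ^ n < a ^ n; last lra.
case: n n1 {h} => // n _; elim: n => [|n IH]; first by rewrite /=; lra.
have h1 : t * t ^ n.+1 <= a * t ^ n.+1.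
  by apply: Rmult_le_compat_r; [apply: pow_le | lra].
have h2 : a * t ^ n.+1 < a * a ^ n.+1 by apply: Rmult_lt_compat_l; lra.
by rewrite -!tech_pow_Rmult; simpl in *; lra.
Qed.

(* [theta -> - ln theta - theta * ln A] is convex on [1/d, 1], so its values at
   [theta = 1/n] are bounded by those at the end points. *)
Lemma scaled_root_le (A : R) (n d : nat) :
  0 < A <= 1 -> leq 1 n -> leq n d ->
  INR n / Rpower A (/ INR n) <= Rmax (1 / A) (INR d / Rpower A (/ INR d)).
Proof.
move=> A01 n1 nd.
have hn := INR_ge1 n1; have hnd := le_nat_INR nd.
pose x := - ln A.
have x0 : 0 <= x by rewrite /x; case: (Req_dec A 1) => [->|?];
  [rewrite ln_1; lra | have := ln_increasing A 1; rewrite ln_1; lra].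
have rt k : 1 <= k -> / Rpower A (/ k) = exp (x / k).
  by move=> k1; rewrite -Rpower_Ropp /Rpower /x; congr exp; field; lra.
have rA : / A = exp x by rewrite /x exp_Ropp exp_ln; lra.
rewrite /Rdiv !rt; try lra.
rewrite rA Rmult_1_l.
(* With [x = - ln A] the left side is [n * exp (x / n)]. The tangent inequality [1 + y <= exp y]
   compares it with the value at [d] when [x <= n], and with the value at [1] otherwise. *)
case: (Rle_dec x (INR n)) => xn.
- apply: Rle_trans (Rmax_r _ _).
  have h1 := exp_ineq1_le (INR n / INR d - 1).
  have h2 : exp (INR n / INR d - 1) <= exp (x / INR d - x / INR n).
    case: (Req_dec (INR n / INR d - 1) (x / INR d - x / INR n)) => [->|ne]; first lra.
    apply/Rlt_le/exp_increasing.
    have : 0 <= (INR d - INR n) * (INR n - x) / (INR n * INR d).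
      apply: Rmult_le_pos; first by apply: Rmult_le_pos; lra.
      by apply/Rlt_le/Rinv_0_lt_compat/Rmult_lt_0_compat; lra.
    have -> : (INR d - INR n) * (INR n - x) / (INR n * INR d) =
       (x / INR d - x / INR n) - (INR n / INR d - 1) by field; lra.
    lra.
  have h3 : exp (x / INR d) = exp (x / INR d - x / INR n) * exp (x / INR n).
    by rewrite -exp_plus; congr exp; ring.
  rewrite h3.
  have h4 : INR n / INR d <= exp (x / INR d - x / INR n) by lra.
  have h5 : INR n <= INR d * exp (x / INR d - x / INR n).
    have e : INR d * (INR n / INR d) = INR n by field; lra.
    by rewrite -{1}e; apply: Rmult_le_compat_l; lra.
  rewrite -Rmult_assoc; apply: Rmult_le_compat_r => //.
  exact/Rlt_le/exp_pos.
- apply: Rle_trans (Rmax_l _ _).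
  have h1 := exp_ineq1_le (INR n - 1).
  have h2 : exp (INR n - 1) <= exp (x - x / INR n).
    have h : INR n - 1 <= x - x / INR n.
      have : 0 <= (INR n - 1) * (x - INR n) / INR n.
        apply: Rmult_le_pos; first by apply: Rmult_le_pos; lra.
        by apply/Rlt_le/Rinv_0_lt_compat; lra.
      have -> : (INR n - 1) * (x - INR n) / INR n = (x - x / INR n) - (INR n - 1).
        by field; lra.
      lra.
    case: (Req_dec (INR n - 1) (x - x / INR n)) => [->|ne]; first lra.
    by apply/Rlt_le/exp_increasing; lra.
  have h3 : exp x = exp (x - x / INR n) * exp (x / INR n).
    by rewrite -exp_plus; congr exp; ring.
  rewrite h3; apply: Rmult_le_compat_r; last lra.
  exact/Rlt_le/exp_pos.
Qed.

(** * Global Lipschitz bounds from a finite closed cover *)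

Definition closed_set (C : R -> Prop) : Prop :=
  forall t, ~ C t -> exists eta, 0 < eta /\ forall s, Rabs (s - t) < eta -> ~ C s.

Lemma avoid_closed_sets (I : eqType) (C : I -> R -> Prop) (ks : seq I) (t : R) :
  (forall k, closed_set (C k)) -> (forall k, k \in ks -> ~ C k t) ->
  exists eta, 0 < eta /\ forall s, Rabs (s - t) < eta -> forall k, k \in ks -> ~ C k s.
Proof.
move=> clC; elim: ks => [|k ks IH] nC; first by exists 1; split; [lra|].
have [|e1 [e10 h1]] := IH; first by move=> j jks; apply: nC; rewrite inE jks orbT.
have [|e2 [e20 h2]] := clC k t; first by apply: nC; rewrite inE eqxx.
exists (Rmin e1 e2); split; first exact: Rmin_pos.
move=> s hs j; rewrite inE => /orP[/eqP ->|jks].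
- by apply: h2; have := Rmin_r e1 e2; lra.
- by apply: h1 => //; have := Rmin_l e1 e2; lra.
Qed.

(* Walk from [a] to the last point of one closed set containing [a]; from there
   on the remaining sets cover. *)
Lemma lipschitz_of_closed_cover (I : eqType) (C : I -> R -> Prop) (D : R -> R -> R)
    (L : R) (ks : seq I) (a b : R) :
  (forall k, closed_set (C k)) ->
  (forall s t u, D s u <= D s t + D t u) ->
  (forall k s t, C k s -> C k t -> a <= s <= t -> t <= b -> D s t <= L * (t - s)) ->
  (forall t, a <= t <= b -> exists k, k \in ks /\ C k t) ->
  a <= b -> D a b <= L * (b - a).
Proof.
move=> clC tri; move En : (size ks) => n.
elim: n ks En a b => [|n IH] ks En a b lip cov ab.
  have [|k []] := cov a; first lra.
  by case: ks En {cov}.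
have [|k [kks Cka]] := cov a; first lra.
pose S t := C k t /\ a <= t <= b.
have [m [ubm lubm]] : {m | is_lub S m}.
  apply: completeness; first by exists b => t [_ ?]; lra.
  by exists a; split => //; lra.
have am : a <= m by apply: ubm; split => //; lra.
have mb : m <= b by apply: lubm => t [_ ?]; lra.
have Ckm : C k m.
  case: (classic (C k m)) => // nC.
  have [e [e0 he]] := clC k m nC.
  have : m <= m - e / 2; last lra.
  apply: lubm => t [Ct tab]; apply: Rnot_lt_le => ht.
  have tm : t <= m by apply: ubm.
  by apply: (he t _ Ct); rewrite Rabs_left1; lra.
have dam : D a m <= L * (m - a) by apply: (lip k); rewrite //; lra.
case: (Req_dec m b) => [mbE|mnb]; first by rewrite -mbE.
have covr t : m < t <= b -> exists j, j \in rem k ks /\ C j t.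
  move=> tmb; have [|j [jks Cj]] := cov t; first lra.
  exists j; split=> //.
  case: (eqVneq j k) => [jk|jk].
    have : t <= m; last lra.
    by apply: ubm; split; [rewrite -jk | lra].
  have := perm_to_rem kks => /perm_mem /(_ j).
  by rewrite jks inE (negPf jk) /= => /esym.
(* The remaining sets are known to cover only the points beyond [m]. If none contained [m],
   closedness would keep all of them away from points just to the right of [m]. *)
have covm : exists j, j \in rem k ks /\ C j m.
  case: (classic (exists j, j \in rem k ks /\ C j m)) => // nex.
  have [|e [e0 he]] := @avoid_closed_sets I C (rem k ks) m clC.
    by move=> j jr Cj; apply: nex; exists j.
  pose t := Rmin b (m + e / 2).
  have tb : t <= b by apply: Rmin_l.
  have te : t <= m + e / 2 by apply: Rmin_r.
  have mt : m < t by apply: Rmin_glb_lt; lra.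
  have [|j [jr Cj]] := covr t; first lra.
  by case: (he t _ j jr Cj); rewrite Rabs_right; lra.
have dmb : D m b <= L * (b - m).
  apply: (IH (rem k ks)).
  - by rewrite size_rem // En.
  - by move=> j s t Cs Ct ? ?; apply: (lip j) => //; lra.
  - move=> t tmb; case: (Req_dec t m) => [->|tm] //.
    by apply: covr; lra.
  - by [].
by have := tri a m b; lra.
Qed.
Lemma Rmax_cases (a b : R) : (a <= b /\ Rmax a b = b) \/ (b <= a /\ Rmax a b = a).
Proof.
case: (Rle_dec a b) => h; [left | right]; (split; first lra).
- exact: Rmax_right.
- by apply: Rmax_left; lra.
Qed.

(* Innermost maxima first, so that no case hypothesis mentions another maximum. *)
Ltac rmax_lra :=
  repeat match goal with
  | |- context [Rmax ?a ?b] =>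
    lazymatch a with context [Rmax _ _] => fail | _ =>
    lazymatch b with context [Rmax _ _] => fail | _ =>
    case: (Rmax_cases a b) => [[? ->]|[? ->]] end end
  end; try (intros; lra).

(** * The nonarchimedean absolute value *)

Section Abs.
Variables (K : closedFieldType) (abs : K -> R).
Hypothesis Habs : nonarch_complete_abs abs.
Implicit Types a b c u v x y : K.

Lemma abs_ge0 x : 0 <= abs x.
Proof. by case: Habs. Qed.

Lemma abs_eq0 x : abs x = 0 <-> x = 0%ring.
Proof. by case: Habs => _ []. Qed.

Lemma absM x y : abs (x * y)%ring = abs x * abs y.
Proof. by case: Habs => _ [_ [h _]]; exact: h. Qed.

Lemma absD x y : abs (x + y)%ring <= Rmax (abs x) (abs y).
Proof. by case: Habs => _ [_ [_ [h _]]]; exact: h. Qed.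

Lemma abs_nontrivial : exists x, abs x <> 0 /\ abs x <> 1.
Proof. by case: Habs => _ [_ [_ [_ []]]]. Qed.

Lemma abs0 : abs 0%ring = 0.
Proof. exact/abs_eq0. Qed.

Lemma abs_gt0 x : x != 0%ring -> 0 < abs x.
Proof.
move=> /eqP x0; have := abs_ge0 x => h.
by case: (Req_dec (abs x) 0) => [/abs_eq0 //|]; lra.
Qed.

Lemma abs1 : abs 1%ring = 1.
Proof.
have h := absM 1 1; rewrite mulr1 in h.
have : 0 < abs 1%ring by apply: abs_gt0; exact: oner_neq0.
by nra.
Qed.

Lemma absN x : abs (- x)%ring = abs x.
Proof.
have h : abs (-1)%ring = 1.
  have := absM (-1) (-1); rewrite mulrNN mulr1 abs1 => e.
  by have := abs_ge0 (-1)%ring; nra.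
by rewrite -mulN1r absM h; lra.
Qed.

Lemma absB x y : abs (x - y)%ring <= Rmax (abs x) (abs y).
Proof. by rewrite -[abs y]absN; exact: absD. Qed.

Lemma absBC x y : abs (x - y)%ring = abs (y - x)%ring.
Proof. by rewrite -absN opprB. Qed.

Lemma abs_sub_trans a b c : abs (a - c)%ring <= Rmax (abs (a - b)%ring) (abs (b - c)%ring).
Proof. by have -> : (a - c = (a - b) + (b - c))%ring; [kring | exact: absD]. Qed.

Lemma absV x : x != 0%ring -> abs (x^-1)%ring = / abs x.
Proof.
move=> x0; have := abs_gt0 x0 => ax.
have : abs (x^-1)%ring * abs x = 1 by rewrite -absM mulVf // abs1.
by move=> e; apply: (Rmult_eq_reg_r (abs x)); rewrite ?e ?Rinv_l; lra.
Qed.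

Lemma absX x n : abs (x ^+ n)%ring = abs x ^ n.
Proof. by elim: n => [|n IH]; rewrite ?expr0 ?abs1 // exprS absM IH. Qed.

Lemma absD_eq x y : abs y < abs x -> abs (x + y)%ring = abs x.
Proof.
move=> h; have := absD x y; rewrite Rmax_left; last lra.
have : abs x <= Rmax (abs (x + y)%ring) (abs y).
  by rewrite -{1}(addrK y x); exact: absB.
by rmax_lra.
Qed.

Lemma abs_sum_le (I : Type) (s : seq I) (P : pred I) (F : I -> K) (m : R) :
  0 <= m -> (forall i, P i -> abs (F i) <= m) ->
  abs (\sum_(i <- s | P i) F i)%ring <= m.
Proof.
move=> m0 h; elim/big_rec: _ => [|i x Pi hx]; first by rewrite abs0.
by apply: Rle_trans (absD _ _) _; apply: Rmax_lub => //; exact: h.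
Qed.

Lemma abs_sum_lt (I : Type) (s : seq I) (P : pred I) (F : I -> K) (m : R) :
  0 < m -> (forall i, P i -> abs (F i) < m) ->
  abs (\sum_(i <- s | P i) F i)%ring < m.
Proof.
move=> m0 h; elim/big_rec: _ => [|i x Pi hx]; first by rewrite abs0.
by apply: Rle_lt_trans (absD _ _) _; apply: Rmax_lub_lt => //; exact: h.
Qed.

(** * Normalised ultrametric norms on linear forms *)

Definition unit_form (u v : K) : Prop := Rmax (abs u) (abs v) = 1.

Lemma unit_form10 : unit_form 1%ring 0%ring.
Proof. by rewrite /unit_form abs1 abs0; rmax_lra. Qed.

Lemma unit_form01 : unit_form 0%ring 1%ring.
Proof. by rewrite /unit_form abs1 abs0; rmax_lra. Qed.

Lemma unit_formC u v : unit_form u v -> unit_form v u.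
Proof. by rewrite /unit_form Rmax_comm. Qed.

Lemma unit_form_le u v : unit_form u v -> abs u <= 1 /\ abs v <= 1.
Proof. by move=> <-; split; [exact: Rmax_l | exact: Rmax_r]. Qed.

Lemma unit_form1 c : abs c <= 1 -> unit_form 1%ring c.
Proof. by move=> h; rewrite /unit_form abs1; rmax_lra. Qed.

Lemma unit_form_scale u v : (u != 0%ring) || (v != 0%ring) ->
  exists c, c != 0%ring /\ abs c = Rmax (abs u) (abs v) /\ unit_form (u / c)%ring (v / c)%ring.
Proof.
move=> uv0; pose c := if Rle_dec (abs u) (abs v) then v else u.
have ac : abs c = Rmax (abs u) (abs v) by rewrite /c /Rmax; case: Rle_dec.
have c0 : c != 0%ring.
  apply/eqP => /abs_eq0; rewrite ac; case/orP: uv0 => /abs_gt0.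
  - by have := Rmax_l (abs u) (abs v); lra.
  - by have := Rmax_r (abs u) (abs v); lra.
exists c; split=> //; split=> //.
have := abs_gt0 c0 => hc.
rewrite /unit_form !absM absV // !(Rmult_comm _ (/ abs c)) RmaxRmult -?ac; last first.
  by apply/Rlt_le/Rinv_0_lt_compat.
by rewrite Rinv_l; lra.
Qed.

Definition is_form_inf (F : K -> K -> R) (m : R) : Prop :=
  (forall u v, unit_form u v -> m <= F u v) /\
  (forall m', (forall u v, unit_form u v -> m' <= F u v) -> m' <= m).

Definition form_inf (F : K -> K -> R) : R := epsilon (inhabits 0) (is_form_inf F).

Lemma form_infP (F : K -> K -> R) : (forall u v, 0 <= F u v) ->
  is_form_inf F (form_inf F).
Proof.
move=> F0; apply: (epsilon_spec (inhabits 0) (is_form_inf F)).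
pose S m := forall u v, unit_form u v -> m <= F u v.
have [m [ubm lubm]] : {m | is_lub S m}.
  apply: completeness; last by exists 0 => u v _; exact: F0.
  by exists (F 1%ring 0%ring) => m; apply; exact: unit_form10.
exists m; split => [u v uv|m' hm']; last exact: ubm.
by apply: lubm => m'; exact.
Qed.

(* On the norms [ell P], [ell Q] below this is the paper's [diam_G (P v_G Q)]. *)
Definition ker (l1 l2 : K -> K -> R) : R :=
  form_inf (fun u v => Rmax (l1 u v) (l2 u v)).

(** A point determines a norm on forms only up to a factor, which the last clause fixes. Nonzero
    forms may have norm [0], as happens at classical points. *)
Definition form_norm (l : K -> K -> R) : Prop :=
  (forall u v, 0 <= l u v) /\
  (forall c u v, l (c * u)%ring (c * v)%ring = abs c * l u v) /\
  (forall u v u' v', l (u + u')%ring (v + v')%ring <= Rmax (l u v) (l u' v')) /\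
  Rmax (l 1%ring 0%ring) (l 0%ring 1%ring) = 1.

Lemma form_norm_ge0 l u v : form_norm l -> 0 <= l u v.
Proof. by case=> h _; exact: h. Qed.

Lemma ker_le l1 l2 u v : form_norm l1 -> unit_form u v ->
  ker l1 l2 <= Rmax (l1 u v) (l2 u v).
Proof.
move=> n1; case: (@form_infP (fun u v => Rmax (l1 u v) (l2 u v))) => [a b|h _].
  by apply: Rle_trans (Rmax_l _ _); exact: form_norm_ge0.
exact: h.
Qed.

Lemma ker_ge l1 l2 m : form_norm l1 ->
  (forall u v, unit_form u v -> m <= Rmax (l1 u v) (l2 u v)) -> m <= ker l1 l2.
Proof.
move=> n1; case: (@form_infP (fun u v => Rmax (l1 u v) (l2 u v))) => [a b|_ h].
  by apply: Rle_trans (Rmax_l _ _); exact: form_norm_ge0.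
exact: h.
Qed.

Lemma ker_ge0 l1 l2 : form_norm l1 -> 0 <= ker l1 l2.
Proof.
move=> n1; apply: ker_ge => // u v _.
by apply: Rle_trans (Rmax_l _ _); exact: form_norm_ge0.
Qed.

Lemma ker_diag_le l u v : form_norm l -> unit_form u v -> ker l l <= l u v.
Proof. by move=> n uv; have := ker_le l n uv; rewrite Rmax_left; lra. Qed.

Lemma ker_diag_ge l m : form_norm l ->
  (forall u v, unit_form u v -> m <= l u v) -> m <= ker l l.
Proof.
move=> n h; apply: ker_ge => // u v uv.
by apply: Rle_trans (h _ _ uv) (Rmax_l _ _).
Qed.

Lemma ker_lt l1 l2 (c : R) : form_norm l1 -> ker l1 l2 < c ->
  exists u v, unit_form u v /\ l1 u v < c /\ l2 u v < c.
Proof.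
move=> n1 kc; apply: NNPP => nex.
have : c <= ker l1 l2; last lra.
apply: ker_ge => // u v uv; apply: Rnot_lt_le => h; apply: nex.
exists u, v; split => //.
by have := Rmax_l (l1 u v) (l2 u v); have := Rmax_r (l1 u v) (l2 u v); lra.
Qed.

Lemma kerC l1 l2 : ker l1 l2 = ker l2 l1.
Proof.
rewrite /ker; congr form_inf.
by apply: functional_extensionality => u; apply: functional_extensionality => v;
  exact: Rmax_comm.
Qed.

Lemma ker_diag_le_ker l1 l2 : form_norm l1 -> ker l1 l1 <= ker l1 l2.
Proof.
move=> n1; apply: ker_ge => // u v uv.
by apply: Rle_trans (ker_diag_le n1 uv) (Rmax_l _ _).
Qed.

Lemma ker_le1 l1 l2 : form_norm l1 -> form_norm l2 -> ker l1 l2 <= 1.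
Proof.
move=> n1 n2; apply: Rle_trans (ker_le _ n1 unit_form10) _.
case: n1 => _ [_ [_ h1]]; case: n2 => _ [_ [_ h2]].
apply: Rmax_lub; first by rewrite -h1; exact: Rmax_l.
by rewrite -h2; exact: Rmax_l.
Qed.

(** The effect of the coordinate change [1/T] on linear forms. *)
Definition swap (l : K -> K -> R) : K -> K -> R := fun u v => l v u.

Lemma form_norm_swap l : form_norm l -> form_norm (swap l).
Proof.
move=> [h1 [h2 [h3 h4]]]; rewrite /swap; split; first by move=> *; exact: h1.
split; first by move=> *; exact: h2.
split; first by move=> *; exact: h3.
by rewrite Rmax_comm.
Qed.

Lemma ker_swap l1 l2 : form_norm l1 -> ker (swap l1) (swap l2) = ker l1 l2.
Proof.
move=> n1; apply: Rle_antisym.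
- apply: ker_ge => // u v uv.
  exact: ker_le (form_norm_swap n1) (unit_formC uv).
- apply: ker_ge; first exact: form_norm_swap.
  by move=> u v uv; apply: ker_le n1 (unit_formC uv).
Qed.

(** Eliminating one variable from the two forms leaves the determinant times a coordinate form. The
    coordinate form of norm [1] is kept, and the multipliers have absolute value at most [1]. *)
Lemma abs_det_le l u v u' v' : form_norm l -> unit_form u v -> unit_form u' v' ->
  abs (u * v' - u' * v)%ring <= Rmax (l u v) (l u' v').
Proof.
move=> n [] uv u'v'.
have [au av] := unit_form_le uv; have [au' av'] := unit_form_le u'v'.
have [h1 [h2 [h3 h4]]] := n.
have bnd c c' : abs c <= 1 -> abs c' <= 1 ->
    Rmax (l (c * u)%ring (c * v)%ring) (l (c' * u')%ring (c' * v')%ring)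
    <= Rmax (l u v) (l u' v').
  move=> ac ac'; rewrite !h2; apply: Rmax_lub.
  - apply: Rle_trans (Rmax_l _ _).
    by have := h1 u v; have := abs_ge0 c; nra.
  - apply: Rle_trans (Rmax_r _ _).
    by have := h1 u' v'; have := abs_ge0 c'; nra.
move: h4; rewrite {1}/Rmax; case: Rle_dec => _ e.
- have := h3 (- u' * u)%ring (- u' * v)%ring (u * u')%ring (u * v')%ring.
  have -> : (- u' * u + u * u')%ring = ((u * v' - u' * v) * 0)%ring.
    by rewrite mulNr mulrC addNr mulr0.
  have -> : (- u' * v + u * v')%ring = ((u * v' - u' * v) * 1)%ring.
    by rewrite mulNr mulr1 addrC.
  rewrite h2 e Rmult_1_r => h; apply: Rle_trans h _.
  by apply: bnd; rewrite ?absN.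
- have := h3 (v' * u)%ring (v' * v)%ring (- v * u')%ring (- v * v')%ring.
  have -> : (v' * u + - v * u')%ring = ((u * v' - u' * v) * 1)%ring.
    by rewrite mulNr mulr1 mulrC (mulrC v).
  have -> : (v' * v + - v * v')%ring = ((u * v' - u' * v) * 0)%ring.
    by rewrite mulNr mulrC mulr0 subrr.
  rewrite h2 e Rmult_1_r => h; apply: Rle_trans h _.
  by apply: bnd; rewrite ?absN.
Qed.

(** Divide by the coefficient of [(u', v')] of absolute value [1]: then [(u, v)] is a multiple of
    [(u', v')] by a scalar of absolute value at most [1], plus a coordinate form scaled by the
    determinant. *)
Lemma form_norm_le_det l u v u' v' : form_norm l -> unit_form u v -> unit_form u' v' ->
  l u v <= Rmax (abs (u * v' - u' * v)%ring) (l u' v').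
Proof.
move=> [h1 [h2 [h3 h4]]] uv u'v'.
have [au av] := unit_form_le uv.
have l10 : l 1%ring 0%ring <= 1 by rewrite -h4; exact: Rmax_l.
have l01 : l 0%ring 1%ring <= 1 by rewrite -h4; exact: Rmax_r.
set dt := (u * v' - u' * v)%ring.
have fin c e (x : R) : abs c <= 1 -> abs e = abs dt -> 0 <= x -> x <= 1 ->
    Rmax (abs c * l u' v') (abs e * x) <= Rmax (abs dt) (l u' v').
  move=> c1 -> x0 x1; apply: Rmax_lub.
  - by apply: Rle_trans (Rmax_r _ _); have := h1 u' v'; have := abs_ge0 c; nra.
  - by apply: Rle_trans (Rmax_l _ _); have := abs_ge0 dt; nra.
move: u'v'; rewrite /unit_form /Rmax; case: Rle_dec => _ e1.
- have v0 : v' != 0%ring by apply/eqP => v0; move: e1; rewrite v0 abs0; lra.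
  have := h3 (v / v' * u')%ring (v / v' * v')%ring (dt / v' * 1)%ring (dt / v' * 0)%ring.
  have -> : (v / v' * u' + dt / v' * 1)%ring = u.
    by rewrite /dt; kfield.
  have -> : (v / v' * v' + dt / v' * 0)%ring = v by kfield.
  rewrite !h2 => h; apply: Rle_trans h _.
  apply: fin; try exact: h1; try exact: l10.
  + by rewrite absM absV // e1; lra.
  + by rewrite absM absV // e1; lra.
- have u0 : u' != 0%ring by apply/eqP => u0; move: e1; rewrite u0 abs0; lra.
  have := h3 (u / u' * u')%ring (u / u' * v')%ring (- dt / u' * 0)%ring (- dt / u' * 1)%ring.
  have -> : (u / u' * v' + - dt / u' * 1)%ring = v.
    by rewrite /dt; kfield.
  have -> : (u / u' * u' + - dt / u' * 0)%ring = u by kfield.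
  rewrite !h2 => h; apply: Rle_trans h _.
  apply: fin; try exact: h1; try exact: l01.
  + by rewrite absM absV // e1; lra.
  + by rewrite absM absN absV // e1; lra.
Qed.

(** A form small for [l1] and [l2] and a form small for [l2] and [l3] are both small for [l2], so
    their determinant is small. Hence the second form is small for [l1] too, and it witnesses the
    bound for [l1] and [l3]. *)
Lemma ker_ultrametric l1 l2 l3 : form_norm l1 -> form_norm l2 -> form_norm l3 ->
  ker l1 l3 <= Rmax (ker l1 l2) (ker l2 l3).
Proof.
move=> n1 n2 n3; apply: Rnot_lt_le => lt.
have lt1 : ker l1 l2 < ker l1 l3 by have := Rmax_l (ker l1 l2) (ker l2 l3); lra.
have lt2 : ker l2 l3 < ker l1 l3 by have := Rmax_r (ker l1 l2) (ker l2 l3); lra.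
have [u [v [uv [a1 a2]]]] := ker_lt n1 lt1.
have [u' [v' [uv' [b2 b3]]]] := ker_lt n2 lt2.
have := abs_det_le n2 uv' uv => hd.
have := form_norm_le_det n1 uv' uv => h1.
have : ker l1 l3 <= Rmax (l1 u' v') (l3 u' v') by exact: ker_le.
by move: hd h1; rmax_lra.
Qed.

Definition form_dist (l1 l2 : K -> K -> R) : R :=
  2 * ker l1 l2 - ker l1 l1 - ker l2 l2.

(** The diagonal term of [l2] is at most the smaller of the two mixed kernels, and the ultrametric
    inequality bounds the third kernel by the larger. *)
Lemma form_dist_triangle l1 l2 l3 : form_norm l1 -> form_norm l2 -> form_norm l3 ->
  form_dist l1 l3 <= form_dist l1 l2 + form_dist l2 l3.
Proof.
move=> n1 n2 n3; rewrite /form_dist.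
have := ker_ultrametric n1 n2 n3.
have := ker_diag_le_ker l1 n2; have := ker_diag_le_ker l3 n2.
by rewrite (kerC l2 l1); rmax_lra.
Qed.

Lemma form_distC l1 l2 : form_dist l1 l2 = form_dist l2 l1.
Proof. by rewrite /form_dist kerC; lra. Qed.

Lemma form_dist_ge0 l1 l2 : form_norm l1 -> form_norm l2 -> 0 <= form_dist l1 l2.
Proof.
move=> n1 n2; rewrite /form_dist.
have := ker_diag_le_ker l2 n1; have := ker_diag_le_ker l1 n2.
by rewrite (kerC l2 l1); lra.
Qed.

Lemma form_dist_swap l1 l2 : form_norm l1 -> form_norm l2 ->
  form_dist (swap l1) (swap l2) = form_dist l1 l2.
Proof.
move=> n1 n2; rewrite /form_dist.
by rewrite (ker_swap l2 n1) (ker_swap l1 n1) (ker_swap l2 n2).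
Qed.

Lemma form_norm_ext l l' : form_norm l -> form_norm l' ->
  (forall u v, unit_form u v -> l u v = l' u v) -> l = l'.
Proof.
move=> [h1 [h2 _]] [h1' [h2' _]] e.
apply: functional_extensionality => u; apply: functional_extensionality => v.
case: (boolP ((u != 0%ring) || (v != 0%ring))) => [/unit_form_scale[c [c0 [_ uv]]]|].
- have -> : u = (c * (u / c))%ring by rewrite mulrC divfK.
  have -> : v = (c * (v / c))%ring by rewrite mulrC divfK.
  by rewrite h2 h2' e.
- rewrite negb_or !negbK => /andP[/eqP -> /eqP ->].
  by have := h2 0%ring 0%ring 0%ring; have := h2' 0%ring 0%ring 0%ring;
    rewrite !mulr0 !abs0 !Rmult_0_l => -> ->.
Qed.

(** If [l' u v] were larger than [l u v], a near-minimiser of [l'] would be small for [l] as well.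
    Its determinant with [(u, v)] is then small by [l], which makes [l' u v] smaller than itself. In
    the tree: nested points of the same diameter coincide. *)
Lemma form_norm_eq_of_ker_le l l' : form_norm l -> form_norm l' ->
  (forall u v, unit_form u v -> l u v <= l' u v) -> ker l' l' <= ker l l -> l = l'.
Proof.
move=> n n' le kle; apply: form_norm_ext => // u v uv.
apply: Rle_antisym; first exact: le.
apply: Rnot_lt_le => lt.
have kl := ker_diag_le n uv.
have [|a [b [ab [la _]]]] := @ker_lt l' l' (l' u v) n'; first lra.
have := form_norm_le_det n' uv ab.
have := abs_det_le n uv ab; have := le _ _ ab.
by rmax_lra.
Qed.

End Abs.

(** * Multiplicative seminorms on polynomials *)

Section Seminorm.
Variables (K : closedFieldType) (abs : K -> R).
Hypothesis Habs : nonarch_complete_abs abs.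
Implicit Types (x y : {poly K} -> R) (h k : {poly K}) (a b c z : K).

Section Basic.
Variable x : {poly K} -> R.
Hypothesis sx : is_seminorm abs x.

Lemma sn_ge0 h : 0 <= x h.
Proof. by case: sx. Qed.

Lemma snM h k : x (h * k)%ring = x h * x k.
Proof. by case: sx => _ [e _]; exact: e. Qed.

Lemma snD h k : x (h + k)%ring <= Rmax (x h) (x k).
Proof. by case: sx => _ [_ [e _]]; exact: e. Qed.

Lemma snC c : x (c%:P)%ring = abs c.
Proof. by case: sx => _ [_ [_ e]]; exact: e. Qed.

Lemma sn0 : x 0%ring = 0.
Proof. by rewrite -polyC0 snC abs0. Qed.

Lemma sn1 : x 1%ring = 1.
Proof. by rewrite -polyC1 snC abs1. Qed.

Lemma snZ c h : x (c *: h)%ring = abs c * x h.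
Proof. by rewrite -mul_polyC snM snC. Qed.

Lemma snN h : x (- h)%ring = x h.
Proof. by rewrite -scaleN1r snZ absN // abs1 // Rmult_1_l. Qed.

Lemma snB h k : x (h - k)%ring <= Rmax (x h) (x k).
Proof. by rewrite -[x k]snN; exact: snD. Qed.

Lemma snX h n : x (h ^+ n)%ring = x h ^ n.
Proof. by elim: n => [|n IH]; rewrite ?expr0 ?sn1 // exprS snM IH. Qed.

Lemma snD_eq h k : x k < x h -> x (h + k)%ring = x h.
Proof.
move=> lt; have := snD h k; rewrite Rmax_left; last lra.
have : x h <= Rmax (x (h + k)%ring) (x k) by rewrite -{1}(addrK k h); exact: snB.
by rmax_lra.
Qed.

Lemma sn_sum_le (I : Type) (s : seq I) (P : pred I) (F : I -> {poly K}) (m : R) :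
  0 <= m -> (forall i, P i -> x (F i) <= m) -> x (\sum_(i <- s | P i) F i)%ring <= m.
Proof.
move=> m0 le; elim/big_rec: _ => [|i k Pi hk]; first by rewrite sn0.
by apply: Rle_trans (snD _ _) _; apply: Rmax_lub => //; exact: le.
Qed.

Lemma sn_prod (I : Type) (s : seq I) (F : I -> {poly K}) :
  x (\prod_(i <- s) F i)%ring = \big[Rmult/1]_(i <- s) x (F i).
Proof. by elim: s => [|i s IH]; rewrite ?big_nil ?sn1 // !big_cons snM IH. Qed.

Lemma sn_XsubC_le a b :
  x ('X - a%:P)%ring <= Rmax (x ('X - b%:P)%ring) (abs (a - b)%ring).
Proof.
have -> : ('X - a%:P)%ring = (('X - b%:P) - (a - b)%:P)%ring :> {poly K}.
  by rewrite polyCB opprB addrA subrK.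
by rewrite -[abs _]snC; exact: snB.
Qed.

Lemma abs_sub_le_sn a b :
  abs (a - b)%ring <= Rmax (x ('X - a%:P)%ring) (x ('X - b%:P)%ring).
Proof.
rewrite -[abs _]snC.
have -> : ((a - b)%:P)%ring = (('X - b%:P) - ('X - a%:P))%ring :> {poly K}.
  by rewrite polyCB; kring.
by rewrite Rmax_comm; exact: snB.
Qed.

Lemma sn_X_le a : x ('X)%ring <= Rmax (x ('X - a%:P)%ring) (abs a).
Proof. by have := sn_XsubC_le 0 a; rewrite subr0 sub0r absN. Qed.

Lemma abs_le_sn a : abs a <= Rmax (x ('X - a%:P)%ring) (x ('X)%ring).
Proof. by have := abs_sub_le_sn a 0; rewrite !subr0. Qed.

Lemma sn_XsubC_leX a : x ('X - a%:P)%ring <= Rmax (x ('X)%ring) (abs a).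
Proof. by have := sn_XsubC_le a 0; rewrite !subr0. Qed.

Lemma sn_comb_le (u v : K) h k m : abs u <= 1 -> abs v <= 1 -> x h <= m -> x k <= m ->
  x (u *: h + v *: k)%ring <= m.
Proof.
move=> u1 v1 hm km; apply: Rle_trans (snD _ _) _; rewrite !snZ.
have := sn_ge0 h; have := sn_ge0 k; have := abs_ge0 Habs u; have := abs_ge0 Habs v.
by move=> *; apply: Rmax_lub; nra.
Qed.

(** A Bezout relation would otherwise give [1] the value [0]. This is what makes the image of every
    seminorm well defined. *)
Lemma sn_coprime_gt0 f g : coprimep f g -> 0 < Rmax (x f) (x g).
Proof.
move=> /Bezout_eq1_coprimepP [[a b] /= e].
have : x (a * f + b * g)%ring = 1 by rewrite e sn1.
have := snD (a * f)%ring (b * g)%ring; rewrite !snM.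
have := sn_ge0 f; have := sn_ge0 g => g0 f0 le e1; rewrite e1 in le.
apply: Rnot_le_lt => h.
have f00 : x f = 0 by have := Rmax_l (x f) (x g); lra.
have g00 : x g = 0 by have := Rmax_r (x f) (x g); lra.
by move: le; rewrite f00 g00 !Rmult_0_r; rmax_lra.
Qed.

End Basic.

(** The list of roots is chosen before the seminorm, so that one factorisation serves to compare
    several seminorms. *)
Lemma sn_factor h : exists s : seq K, forall x, is_seminorm abs x ->
  x h = abs (lead_coef h) * \big[Rmult/1]_(z <- s) x ('X - z%:P)%ring.
Proof.
have [s e] := closed_field_poly_normal h; exists s => x sx.
by rewrite {1}e snZ // sn_prod.
Qed.

Lemma big_Rmult_le (s : seq K) (F G : K -> R) :
  (forall z, 0 <= F z <= G z) ->
  0 <= \big[Rmult/1]_(z <- s) F z <= \big[Rmult/1]_(z <- s) G z.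
Proof.
move=> le; elim: s => [|z s IH]; rewrite ?big_nil ?big_cons; first lra.
have := le z; split; first by apply: Rmult_le_pos; lra.
by apply: Rmult_le_compat; lra.
Qed.

Lemma sn_le_of_linear x y : is_seminorm abs x -> is_seminorm abs y ->
  (forall c, x ('X - c%:P)%ring <= y ('X - c%:P)%ring) -> forall h, x h <= y h.
Proof.
move=> sx sy le h; have [s e] := sn_factor h; rewrite !e //.
apply: Rmult_le_compat_l; first exact: abs_ge0.
apply: (proj2 (@big_Rmult_le s (fun z => x ('X - z%:P)%ring) (fun z => y ('X - z%:P)%ring) _)).
by move=> z; split; [apply: (sn_ge0 sx) | exact: le].
Qed.

Lemma sn_ext_linear x y : is_seminorm abs x -> is_seminorm abs y ->
  (forall c, x ('X - c%:P)%ring = y ('X - c%:P)%ring) -> x = y.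
Proof.
move=> sx sy e; apply: functional_extensionality => h.
by apply: Rle_antisym; apply: sn_le_of_linear => // c; rewrite e; lra.
Qed.

Lemma sn_eval c : is_seminorm abs (fun h => abs h.[c]%ring).
Proof.
split; first by move=> h; exact: abs_ge0.
split; first by move=> h k; rewrite /Pmul hornerM absM.
split; first by move=> h k; rewrite /Padd hornerD; exact: absD.
by move=> a; rewrite /Pconst hornerC.
Qed.

(** * Gauss norms *)

Definition gauss (t : R) h : R := \big[Rmax/0]_(i < size h) (abs h`_i%ring * t ^ i).

(** The point [zeta_{a,t}]: the Gauss norm of radius [t] in the coordinate [T - a]. *)
Definition gauss_at (a : K) (t : R) h : R := gauss t (h \Po ('X + a%:P))%ring.

Lemma big_Rmax_ge0 (I : Type) (s : seq I) (F : I -> R) : 0 <= \big[Rmax/0]_(i <- s) F i.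
Proof.
elim: s => [|i s IH]; rewrite ?big_nil ?big_cons; first lra.
by apply: Rle_trans IH (Rmax_r _ _).
Qed.

Lemma big_Rmax_ge (I : eqType) (s : seq I) (F : I -> R) i : i \in s ->
  F i <= \big[Rmax/0]_(i <- s) F i.
Proof.
elim: s => // j s IH; rewrite inE big_cons => /orP[/eqP ->|/IH le].
  exact: Rmax_l.
exact: Rle_trans le (Rmax_r _ _).
Qed.

Lemma gauss_ge0 t h : 0 <= gauss t h.
Proof. exact: big_Rmax_ge0. Qed.

Lemma gauss_ge t h i : abs h`_i%ring * t ^ i <= gauss t h.
Proof.
case: (ltnP i (size h)) => hi; last first.
  by rewrite nth_default // abs0 // Rmult_0_l; exact: gauss_ge0.
by apply: (@big_Rmax_ge _ _ (fun i : 'I_(size h) => abs h`_i%ring * t ^ i)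
  (Ordinal hi)); rewrite mem_index_enum.
Qed.

Lemma gauss_le t h m : 0 <= m -> (forall i, abs h`_i%ring * t ^ i <= m) -> gauss t h <= m.
Proof. by move=> m0 le; apply: (big_ind (fun r => r <= m)) => // *; exact: Rmax_lub. Qed.

Lemma gauss_attained t h : 0 <= t ->
  exists2 i, gauss t h = abs h`_i%ring * t ^ i & leq i (size h).-1.
Proof.
move=> t0; case: (classic (exists i, gauss t h = abs h`_i%ring * t ^ i)) => [[i e]|nex].
  case: (leqP i (size h).-1) => hi; first by exists i.
  (* Beyond the degree the coefficient is [0], so the norm is [0] and the index [O] attains it as
     well. *)
  exists O => //; apply: Rle_antisym; last exact: gauss_ge.
  rewrite e nth_default ?abs0 // ?Rmult_0_l; last by case: (size h) hi.
  by apply: Rmult_le_pos; [exact: abs_ge0 | exact: pow_le].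
case: nex; rewrite /gauss.
suff [[i ->]| -> ] : (exists i, \big[Rmax/0]_(i < size h) (abs h`_i%ring * t ^ i) =
     abs h`_i%ring * t ^ i) \/ \big[Rmax/0]_(i < size h) (abs h`_i%ring * t ^ i) = 0.
- by exists i.
- by exists (size h); rewrite nth_default // abs0 // Rmult_0_l.
apply: (big_ind (fun r => (exists i, r = abs h`_i%ring * t ^ i) \/ r = 0)).
- by right.
- by move=> r r' hr hr'; rewrite /Rmax; case: Rle_dec.
- by move=> i _; left; exists i.
Qed.

Lemma gaussD t h k : 0 <= t -> gauss t (h + k)%ring <= Rmax (gauss t h) (gauss t k).
Proof.
move=> t0; apply: gauss_le => [|i].
  by apply: Rle_trans (Rmax_l _ _); exact: gauss_ge0.
rewrite coefD; have ti := pow_le _ i t0.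
apply: (Rle_trans _ (Rmax (abs h`_i%ring * t ^ i) (abs k`_i%ring * t ^ i))).
  rewrite !(Rmult_comm _ (t ^ i)) RmaxRmult //.
  by apply: Rmult_le_compat_l => //; exact: absD.
by apply: Rmax_lub; [apply: Rle_trans (Rmax_l _ _) | apply: Rle_trans (Rmax_r _ _)];
  exact: gauss_ge.
Qed.

(** Choosing the least attaining index excludes ties, which singles out one term of a product
    coefficient in [gaussM]. *)
Lemma gauss_first t h : 0 <= t -> exists i, gauss t h = abs h`_i%ring * t ^ i /\
  forall j, (j < i)%N -> abs h`_j%ring * t ^ j < gauss t h.
Proof.
move=> t0.
pose P i := if excluded_middle_informative (gauss t h = abs h`_i%ring * t ^ i)
            then true else false.
have exP : exists i, P i.
  by have [i e _] := gauss_attained h t0; exists i; rewrite /P; case: excluded_middle_informative.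
exists (ex_minn exP); case: ex_minnP => i Pi mini; split.
  by move: Pi; rewrite /P; case: excluded_middle_informative.
move=> j ji; have := gauss_ge t h j => le.
case: (Req_dec (gauss t h) (abs h`_j%ring * t ^ j)) => [e|]; last lra.
have : P j by rewrite /P; case: excluded_middle_informative.
by move/mini; rewrite leqNgt ji.
Qed.

Lemma gaussM t h k : 0 <= t -> gauss t (h * k)%ring = gauss t h * gauss t k.
Proof.
move=> t0; apply: Rle_antisym.
  have hk0 : 0 <= gauss t h * gauss t k by apply: Rmult_le_pos; exact: gauss_ge0.
  apply: gauss_le => // n; rewrite coefM.
  have tn := pow_le _ n t0.
  have [tz|tnz] := Req_dec (t ^ n) 0; first by rewrite tz Rmult_0_r.
  have tn' : 0 < t ^ n by lra.
  suff le : abs (\sum_(j < n.+1) h`_j * k`_(n - j)%N)%ring <= gauss t h * gauss t k / t ^ n.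
    apply: Rle_trans (Rmult_le_compat_r _ _ _ tn le) _.
    by apply: Req_le; field.
  apply: abs_sum_le => //.
    by apply: Rmult_le_pos => //; apply/Rlt_le/Rinv_0_lt_compat.
  move=> j _; rewrite absM //.
  apply: (Rmult_le_reg_r (t ^ n)) => //.
  have -> : gauss t h * gauss t k / t ^ n * t ^ n = gauss t h * gauss t k by field.
  have -> : abs h`_j%ring * abs (k`_(n - j)%N)%ring * t ^ n =
     (abs h`_j%ring * t ^ j) * (abs (k`_(n - j)%N)%ring * t ^ (n - j)%N).
    have -> : t ^ n = t ^ j * t ^ (n - j)%N.
      by rewrite -pow_add -[(j + (n - j))%coq_nat]/(addn j (n - j)) subnKC // -ltnS.
    by ring.
  apply: Rmult_le_compat; try exact: gauss_ge.
  - by apply: Rmult_le_pos; [exact: abs_ge0 | exact: pow_le].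
  - by apply: Rmult_le_pos; [exact: abs_ge0 | exact: pow_le].
(* In the coefficient of index [i + j] of the product, each other term has its index in [h] below
   [i] or its index in [k] below [j]. It is therefore strictly smaller than the term of [i] and [j],
   and no cancellation can occur. *)
have [i [ei mini]] := gauss_first h t0; have [j [ej minj]] := gauss_first k t0.
have [z|nz] := Req_dec (gauss t h * gauss t k) 0; first by rewrite z; exact: gauss_ge0.
have h0 : 0 < gauss t h.
  case: (Req_dec (gauss t h) 0) => [e|]; last by have := gauss_ge0 t h; lra.
  by case: nz; rewrite e Rmult_0_l.
have k0 : 0 < gauss t k.
  case: (Req_dec (gauss t k) 0) => [e|]; last by have := gauss_ge0 t k; lra.
  by case: nz; rewrite e Rmult_0_r.
apply: Rle_trans (gauss_ge t (h * k)%ring (i + j)%N).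
have tij : t ^ (i + j)%N = t ^ i * t ^ j by rewrite -pow_add.
have main : gauss t h * gauss t k = abs (h`_i * k`_j)%ring * t ^ (i + j)%N.
  by rewrite ei ej absM // tij; ring.
rewrite main; apply: Req_le; congr (_ * _).
have ij : (i < (i + j).+1)%N by rewrite ltnS leq_addr.
rewrite coefM (bigD1 (Ordinal ij)) //= addKn; apply: esym; apply: absD_eq => //.
have p0 : 0 < t ^ (i + j)%N.
  case: (Req_dec (t ^ (i + j)%N) 0) => [e|]; last by have := pow_le _ (i + j)%N t0; lra.
  by case: nz; rewrite main e Rmult_0_r.
have hk0 : 0 < gauss t h * gauss t k by apply: Rmult_lt_0_compat.
apply: abs_sum_lt => //.
  by apply: (Rmult_lt_reg_r (t ^ (i + j)%N)) => //; rewrite Rmult_0_l -main.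
move=> l; rewrite -val_eqE /= => li.
apply: (Rmult_lt_reg_r (t ^ (i + j)%N)) => //; rewrite -main absM //.
have lij : leq l (i + j) by rewrite -ltnS.
have -> : abs h`_l%ring * abs (k`_(i + j - l)%N)%ring * t ^ (i + j)%N =
     (abs h`_l%ring * t ^ l) * (abs (k`_(i + j - l)%N)%ring * t ^ (i + j - l)%N).
  have -> : t ^ (i + j)%N = t ^ l * t ^ (i + j - l)%N.
    by rewrite -pow_add -[(l + (i + j - l))%coq_nat]/(addn l (i + j - l)) subnKC.
  by ring.
have nn c m : 0 <= abs c * t ^ m by apply: Rmult_le_pos; [exact: abs_ge0 | exact: pow_le].
have ghl := gauss_ge t h l; have gkl := gauss_ge t k (i + j - l)%N.
have n1 := nn (h`_l)%ring l; have n2 := nn (k`_(i + j - l)%N)%ring (i + j - l)%N.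
move: li; rewrite neq_ltn => /orP[/mini lt|gt].
  by nra.
have /minj lt : (i + j - l < j)%N by rewrite ltn_subLR // ltn_add2r.
by nra.
Qed.

Lemma gaussC t c : gauss t (c%:P)%ring = abs c.
Proof.
apply: Rle_antisym.
  apply: gauss_le => [|i]; first exact: abs_ge0.
  rewrite coefC; case: i => [|i] /=; first lra.
  by rewrite abs0 // Rmult_0_l; exact: abs_ge0.
by have := gauss_ge t (c%:P)%ring 0; rewrite coefC /= Rmult_1_r.
Qed.

Lemma gauss_at_seminorm a t : 0 <= t -> is_seminorm abs (gauss_at a t).
Proof.
move=> t0; split; first by move=> h; exact: gauss_ge0.
split; first by move=> h k; rewrite /Pmul /gauss_at comp_polyM gaussM.
split; first by move=> h k; rewrite /Padd /gauss_at comp_polyD; exact: gaussD.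
by move=> c; rewrite /Pconst /gauss_at comp_polyC gaussC.
Qed.

Lemma gauss_lin t (u v : K) : 0 <= t ->
  gauss t (u *: 'X + v%:P)%ring = Rmax (abs u * t) (abs v).
Proof.
move=> t0; apply: Rle_antisym.
  apply: gauss_le => [|i]; first by apply: Rle_trans (Rmax_r _ _); exact: abs_ge0.
  rewrite coefD coefZ coefX coefC; case: i => [|[|i]] /=.
  - by rewrite mulr0 add0r; have := Rmax_r (abs u * t) (abs v); lra.
  - by rewrite mulr1 addr0; have := Rmax_l (abs u * t) (abs v); lra.
  - rewrite mulr0 addr0 abs0 // Rmult_0_l.
    by apply: Rle_trans (Rmax_r _ _); exact: abs_ge0.
apply: Rmax_lub.
- have := gauss_ge t (u *: 'X + v%:P)%ring 1.
  by rewrite coefD coefZ coefX coefC /= mulr1 addr0; lra.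
- have := gauss_ge t (u *: 'X + v%:P)%ring 0.
  by rewrite coefD coefZ coefX coefC /= mulr0 add0r; lra.
Qed.

Lemma gauss_at_lin a t (u v : K) : 0 <= t ->
  gauss_at a t (u *: 'X + v%:P)%ring = Rmax (abs u * t) (abs (u * a + v)%ring).
Proof.
move=> t0; rewrite /gauss_at -gauss_lin //; congr gauss.
by rewrite comp_polyD comp_polyZ comp_polyX comp_polyC scalerDr polyCD polyCM
  mul_polyC addrA.
Qed.

Lemma gauss_at_XsubC a t c : 0 <= t ->
  gauss_at a t ('X - c%:P)%ring = Rmax t (abs (a - c)%ring).
Proof.
move=> t0; have := gauss_at_lin a 1 (- c) t0.
by rewrite scale1r polyCN mul1r abs1 // Rmult_1_l.
Qed.

Lemma gauss_at_X a t : 0 <= t -> gauss_at a t 'X%ring = Rmax t (abs a).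
Proof. by move=> t0; have := gauss_at_XsubC a 0 t0; rewrite !subr0. Qed.

(** Expand [h] in powers of [T - a]: the Gauss norm of a disc is the largest seminorm with the given
    bound on [T - a]. *)
Lemma sn_le_gauss_at x a t h : is_seminorm abs x -> x ('X - a%:P)%ring <= t ->
  x h <= gauss_at a t h.
Proof.
move=> sx xa; have t0 : 0 <= t by apply: Rle_trans xa; apply: (sn_ge0 sx).
have e : (h = (h \Po ('X + a%:P)) \Po ('X - a%:P))%ring.
  by rewrite -comp_polyA comp_polyD comp_polyX comp_polyC subrK comp_polyXr.
rewrite {1}e comp_polyE; apply: (sn_sum_le sx); first exact: gauss_ge0.
move=> i _; rewrite (snZ sx) (snX sx); apply: Rle_trans (gauss_ge _ _ i).
apply: Rmult_le_compat_l; first exact: abs_ge0.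
by apply: pow_incr; split => //; apply: (sn_ge0 sx).
Qed.

Lemma gauss_norm_eq : gauss_norm abs = gauss_at 0 1.
Proof.
apply: functional_extensionality => h.
rewrite /gauss_at polyC0 addr0 comp_polyXr /gauss_norm.
have ge i : abs h`_i%ring <= foldr Rmax 0 (map abs h).
  elim: (polyseq h) i => [|c s IH] [|i] /=; rewrite ?nth_nil ?abs0 //; try lra.
  - exact: Rmax_l.
  - by apply: Rle_trans (IH i) (Rmax_r _ _).
have le m : 0 <= m -> (forall i, abs h`_i%ring <= m) -> foldr Rmax 0 (map abs h) <= m.
  move=> m0; elim: (polyseq h) => [|c s IH] le //=.
  by apply: Rmax_lub; [exact: (le 0%N) | apply: IH => i; exact: (le i.+1)].
apply: Rle_antisym.
- apply: le => [|i]; first exact: gauss_ge0.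
  by have := gauss_ge 1 h i; rewrite pow1 Rmult_1_r.
- apply: gauss_le => [|i]; last by rewrite pow1 Rmult_1_r.
  by apply: Rle_trans (ge 0%N); exact: abs_ge0.
Qed.

Lemma gauss_seminorm : is_seminorm abs (gauss_norm abs).
Proof. by rewrite gauss_norm_eq; apply: gauss_at_seminorm; lra. Qed.

(** The seminorm [x] witnesses that the two centres are within [t] of each other, and every point of
    a nonarchimedean disc is a centre of it. *)
Lemma gauss_at_eq x a b t : is_seminorm abs x ->
  x ('X - a%:P)%ring <= t -> x ('X - b%:P)%ring <= t -> gauss_at a t = gauss_at b t.
Proof.
move=> sx xa xb; have t0 : 0 <= t by apply: Rle_trans xa; apply: (sn_ge0 sx).
apply: sn_ext_linear; try exact: gauss_at_seminorm.
move=> c; rewrite !gauss_at_XsubC //.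
have := abs_sub_le_sn sx a b => h.
have := abs_sub_trans Habs a b c; have := abs_sub_trans Habs b a c.
have := absBC Habs a b.
by move: h; rmax_lra.
Qed.

End Seminorm.
(** * The tree structure in terms of linear forms *)

Section Tree.
Variables (K : closedFieldType) (abs : K -> R).
Hypothesis Habs : nonarch_complete_abs abs.
Implicit Types (x y : {poly K} -> R) (h k : {poly K}) (a b c u v z : K) (P Q J M : bpoint K).

Definition ell P : K -> K -> R :=
  match P with
  | None => fun u _ => abs u
  | Some x => fun u v => x (u *: 'X + v%:P)%ring / Rmax 1 (x 'X%ring)
  end.

Lemma Rmax1_ge1 (r : R) : 1 <= Rmax 1 r.
Proof. exact: Rmax_l. Qed.

Lemma sn_lin x u v c : is_seminorm abs x -> (u * c = - v)%ring ->
  x (u *: 'X + v%:P)%ring = abs u * x ('X - c%:P)%ring.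
Proof.
move=> sx uc; rewrite -(snZ sx); congr x.
by rewrite scalerBr -[(u *: _%:P)%ring]mul_polyC -polyCM uc polyCN opprK.
Qed.

Lemma lin_root u v : u != 0%ring -> exists c, (u * c = - v)%ring.
Proof. by move=> u0; exists (- v / u)%ring; rewrite mulrC divfK. Qed.

Lemma lin0 v : (0 *: 'X + v%:P)%ring = (v%:P)%ring :> {poly K}.
Proof. by rewrite scale0r add0r. Qed.

Lemma lin1 c : (1 *: 'X + (- c)%:P)%ring = ('X - c%:P)%ring :> {poly K}.
Proof. by rewrite scale1r polyCN. Qed.

Lemma ell01 x : is_seminorm abs x -> ell (Some x) 0%ring 1%ring = / Rmax 1 (x 'X%ring).
Proof. by move=> sx; rewrite /ell lin0 (snC sx) abs1 //; apply: Rmult_1_l. Qed.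

Lemma ell_sub x c : ell (Some x) 1%ring (- c)%ring = x ('X - c%:P)%ring / Rmax 1 (x 'X%ring).
Proof. by rewrite /ell lin1. Qed.

Lemma ell_norm P : is_berk abs P -> form_norm abs (ell P).
Proof.
case: P => [x|] /= sx; last first.
  split; first by move=> u v; exact: abs_ge0.
  split; first by move=> c u v; rewrite absM.
  split; first by move=> u v u' v'; exact: absD.
  by rewrite abs1 // abs0 //; rmax_lra.
have m1 := Rmax1_ge1 (x 'X%ring).
have im : 0 <= / Rmax 1 (x 'X%ring) by apply/Rlt_le/Rinv_0_lt_compat; lra.
split; first by move=> u v; apply: Rmult_le_pos => //; apply: (sn_ge0 sx).
split.
  move=> c u v; rewrite -Rmult_assoc -(snZ sx).
  by rewrite scalerDr scalerA -[(c *: v%:P)%ring]mul_polyC -polyCM.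
split.
  move=> u v u' v'.
  have -> : ((u + u') *: 'X + (v + v')%:P)%ring =
            ((u *: 'X + v%:P) + (u' *: 'X + v'%:P))%ring :> {poly K}.
    by rewrite scalerDl polyCD addrACA.
  rewrite /Rdiv !(Rmult_comm _ (/ Rmax 1 (x 'X%ring))) RmaxRmult //.
  by apply: Rmult_le_compat_l => //; apply: (snD sx).
rewrite lin0 (snC sx) scale1r polyC0 addr0 abs1 //.
rewrite /Rdiv !(Rmult_comm _ (/ Rmax 1 (x 'X%ring))) RmaxRmult // (Rmax_comm (x _)).
by rewrite Rinv_l; lra.
Qed.

(** The form [Z] separates infinity, where its value is [0], from the affine points. There it gives
    back the scaling factor, hence the values on all linear polynomials. *)
Lemma ell_inj P Q : is_berk abs P -> is_berk abs Q -> ell P = ell Q -> P = Q.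
Proof.
have nn x : is_seminorm abs x -> ell (Some x) 0%ring 1%ring <> ell None 0%ring 1%ring.
  move=> sx; rewrite ell01 //= abs0 //.
  by have := Rmax1_ge1 (x 'X%ring) => ?; apply: Rinv_neq_0_compat; lra.
case: P => [x|]; case: Q => [y|] // sx sy e.
- have e1 : / Rmax 1 (x 'X%ring) = / Rmax 1 (y 'X%ring) by rewrite -(ell01 sx) -(ell01 sy) e.
  congr Some; apply: (sn_ext_linear Habs) => // c.
  have : ell (Some x) 1%ring (- c)%ring = ell (Some y) 1%ring (- c)%ring by rewrite e.
  rewrite !ell_sub /Rdiv e1 => e2; apply: Rmult_eq_reg_r e2 _.
  by have := Rmax1_ge1 (y 'X%ring) => ?; apply: Rinv_neq_0_compat; lra.
- by case: (nn x sx); rewrite e.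
- by case: (nn y sy); rewrite e.
Qed.

Lemma radiusP x : is_seminorm abs x ->
  (forall c, radius x <= x ('X - c%:P)%ring) /\
  (forall m, (forall c, m <= x ('X - c%:P)%ring) -> m <= radius x).
Proof.
move=> sx; pose S (m : R) := forall c, m <= x (Plin c).
apply: (epsilon_spec (inhabits 0) (fun m => (forall c, m <= x (Plin c)) /\
  (forall m', (forall c, m' <= x (Plin c)) -> m' <= m))).
have [m [ubm lubm]] : {m | is_lub S m}.
  apply: completeness; last by exists 0 => c; apply: (sn_ge0 sx).
  by exists (x (Plin 0%ring)) => m; apply.
by exists m; split => [c|m' /ubm //]; apply: lubm => m'; apply.
Qed.

Lemma radius_ge0 x : is_seminorm abs x -> 0 <= radius x.
Proof. by move=> sx; apply: (proj2 (radiusP sx)) => c; apply: (sn_ge0 sx). Qed.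

Lemma sn_X_of_Plin x : x (Plin (Kzero K)) = x 'X%ring.
Proof. by rewrite /Plin /Kzero subr0. Qed.

Lemma radius_le_X x : is_seminorm abs x -> radius x <= x 'X%ring.
Proof. by move=> sx; have := proj1 (radiusP sx) 0%ring; rewrite subr0. Qed.

(** Let [m] be the maximum of [1] and [x 'X]. One factor [m] of the denominator is the scaling of
    [ell]. The other comes from unit forms: if the root is at most [m] in absolute value, the
    leading coefficient is at least [/ m], and if the root is larger, the norm of the form is [/ m],
    which is no smaller than the diameter. *)
Lemma diamG_ker P : is_berk abs P -> diamG P = ker abs (ell P) (ell P).
Proof.
move=> bP; have nP := ell_norm bP; case: P bP nP => [x|] /= sx nP; last first.
  apply: Rle_antisym; first exact: ker_ge0.
  have := ker_diag_le Habs nP (unit_form01 Habs).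
  by rewrite abs0.
rewrite sn_X_of_Plin; have m1 := Rmax1_ge1 (x 'X%ring).
have [radle radge] := radiusP sx.
have radX := radius_le_X sx; have rad0 := radius_ge0 sx.
have xX := Rmax_r 1 (x 'X%ring).
set m := Rmax 1 _ in m1 xX nP *.
have mi : 0 < / m by apply: Rinv_0_lt_compat; lra.
apply: Rle_antisym.
- apply: ker_diag_ge => // u v uv.
  have [au av] := unit_form_le uv.
  have -> : radius x / m ^ 2 = (radius x / m) * / m by field; lra.
  apply: Rmult_le_compat_r; first lra.
  have [u0|u0] := eqVneq u 0%ring.
    move: uv; rewrite /unit_form u0 abs0 // lin0 (snC sx) => uv.
    have -> : abs v = 1 by move: uv; have := abs_ge0 Habs v; rmax_lra.
    have -> : 1 = m / m by field; lra.
    by apply: Rmult_le_compat_r; lra.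
  have [c uc] := lin_root v u0; rewrite (sn_lin sx uc).
  have au0 := abs_gt0 Habs u0.
  have ac : abs u * abs c = abs v by rewrite -absM // uc absN.
  have rc := radle c; have lec := abs_le_sn Habs sx c.
  case: (Rle_dec (abs c) m) => cm.
  + have um : 1 <= abs u * m.
      move: uv; rewrite /unit_form -ac {1}/Rmax; case: Rle_dec => _ e.
      - by rewrite -e; apply: Rmult_le_compat_l; lra.
      - by rewrite e; lra.
    apply: (Rmult_le_reg_r m); first lra.
    have -> : radius x / m * m = radius x by field; lra.
    by nra.
  + have xc : x ('X - c%:P)%ring = abs c.
      have := sn_XsubC_leX Habs sx c; move: lec; rmax_lra.
    rewrite xc ac.
    have -> : abs v = 1.
      move: uv; rewrite /unit_form -ac /Rmax; case: Rle_dec => //.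
      have := Rmult_lt_compat_l (abs u) 1 (abs c) au0; lra.
    have -> : 1 = m / m by field; lra.
    by apply: Rmult_le_compat_r; lra.
- set k := ker _ _ _.
  have k01 : k <= / m.
    have := ker_diag_le Habs nP (unit_form01 Habs); rewrite -/k lin0 (snC sx) abs1 //.
    by rewrite /Rdiv Rmult_1_l.
  suff le : k * m ^ 2 <= radius x.
    apply: (Rmult_le_reg_r (m ^ 2)); first by apply: pow_lt; lra.
    by have -> : radius x / m ^ 2 * m ^ 2 = radius x by field; lra.
  apply: radge => c.
  have k2 : k * m ^ 2 <= m.
    have e : / m * m ^ 2 = m by field; lra.
    by rewrite -[X in _ <= X]e; apply: Rmult_le_compat_r; [apply: pow_le; lra | lra].
  have xc0 := sn_ge0 sx ('X - c%:P)%ring.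
  (* For a large root, the form [X - c Z] scaled to a unit form gives the bound. For a root smaller
     than [m > 1], the value at [T - c] is at least [m], and [k <= / m] suffices. *)
  case: (Rle_dec m (Rmax 1 (abs c))) => mc.
  + have [|e [e0 [ae uv]]] := @unit_form_scale K abs Habs 1%ring (- c)%ring.
      by rewrite oner_neq0.
    rewrite abs1 // absN // in ae.
    have := ker_diag_le Habs nP uv; rewrite -/k.
    have -> : (1 / e *: 'X + (- c / e)%:P)%ring = (e^-1 *: ('X - c%:P))%ring :> {poly K}.
      by rewrite scalerBr mul1r -[(e^-1 *: _%:P)%ring]mul_polyC -polyCM -polyCN mulNr (mulrC c).
    rewrite (snZ sx) absV // ae => kle.
    have cm : / Rmax 1 (abs c) <= / m by apply: Rinv_le_contravar; lra.
    have : k <= x ('X - c%:P)%ring / m ^ 2.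
      have -> : x ('X - c%:P)%ring / m ^ 2 = (/ m * x ('X - c%:P)%ring) / m by field; lra.
      apply: Rle_trans kle _; apply: Rmult_le_compat_r; first lra.
      exact: Rmult_le_compat_r.
    have e2 : x ('X - c%:P)%ring / m ^ 2 * m ^ 2 = x ('X - c%:P)%ring by field; lra.
    move=> kx; rewrite -[X in _ <= X]e2.
    by apply: Rmult_le_compat_r => //; apply: pow_le; lra.
  + have c1 : 1 < m by have := Rmax_l 1 (abs c); lra.
    have cm : abs c < m by have := Rmax_r 1 (abs c); lra.
    have mX : m = x 'X%ring by move: c1; rewrite /m; rmax_lra.
    have := sn_X_le Habs sx c; rewrite -mX.
    by move: k2; rmax_lra.
Qed.

Lemma le_b_refl P : le_b P P.
Proof. by case: P => //= x h; lra. Qed.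

Lemma le_b_anti P Q : le_b P Q -> le_b Q P -> P = Q.
Proof.
case: P => [x|]; case: Q => [y|] //= xy yx.
by congr Some; apply: functional_extensionality => h; apply: Rle_antisym.
Qed.

Lemma is_joinC P Q J : is_join abs P Q J -> is_join abs Q P J.
Proof. by case=> bJ [pJ [qJ min]]; do !split=> //; move=> *; exact: min. Qed.

Lemma bjoinE P Q J : is_join abs P Q J -> bjoin abs P Q = J.
Proof.
move=> jJ; have jE : is_join abs P Q (bjoin abs P Q).
  by apply: (epsilon_spec (inhabits None) (is_join abs P Q)); exists J.
case: jJ => bJ [pJ [qJ minJ]]; case: jE => bE [pE [qE minE]].
by apply: le_b_anti; [exact: minE | exact: minJ].
Qed.

Lemma is_join_None P : is_join abs P None None.
Proof.
split=> //; split; first by case: P.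
by split=> // -[].
Qed.

Lemma is_join_linear x y j : is_seminorm abs x -> is_seminorm abs y -> is_seminorm abs j ->
  (forall c, j ('X - c%:P)%ring = Rmax (x ('X - c%:P)%ring) (y ('X - c%:P)%ring)) ->
  is_join abs (Some x) (Some y) (Some j).
Proof.
move=> sx sy sj e; split=> //=.
split; first by apply: (sn_le_of_linear Habs) => // c; rewrite e; exact: Rmax_l.
split; first by apply: (sn_le_of_linear Habs) => // c; rewrite e; exact: Rmax_r.
case=> [j'|] //= sj' xj yj; apply: (sn_le_of_linear Habs) => // c.
by rewrite e; apply: Rmax_lub.
Qed.

Lemma join_linear_exists x y : is_seminorm abs x -> is_seminorm abs y ->
  exists j, is_seminorm abs j /\
    forall c, j ('X - c%:P)%ring = Rmax (x ('X - c%:P)%ring) (y ('X - c%:P)%ring).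
Proof.
move=> sx sy.
case: (classic (forall c, x ('X - c%:P)%ring <= y ('X - c%:P)%ring)) => [le|nle].
  by exists y; split=> // c; rewrite Rmax_right.
case: (classic (forall c, y ('X - c%:P)%ring <= x ('X - c%:P)%ring)) => [le|nle'].
  by exists x; split=> // c; rewrite Rmax_left.
have [a /Rnot_le_lt ya] := not_all_ex_not _ _ nle.
have [b /Rnot_le_lt xb] := not_all_ex_not _ _ nle'.
have hab := absBC Habs a b.
have r0 : 0 <= abs (a - b)%ring by exact: abs_ge0.
(* For incomparable points, [a] is strictly closer to [y] and [b] strictly closer to [x], so the
   join is the smallest disc containing both [a] and [b]. *)
exists (gauss_at abs a (abs (a - b)%ring)); split; first exact: gauss_at_seminorm.
move=> c; rewrite gauss_at_XsubC //.
have := sn_XsubC_le Habs sx a b; have := sn_XsubC_le Habs sx b a.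
have := sn_XsubC_le Habs sy a b; have := sn_XsubC_le Habs sy b a.
have := abs_sub_le_sn Habs sx a b; have := abs_sub_le_sn Habs sy a b => h1 h2 h3 h4 h5 h6.
have xa : x ('X - a%:P)%ring = abs (a - b)%ring by move: h1 h2 h3 h4 h5 h6; rmax_lra.
have xb' : x ('X - b%:P)%ring < abs (a - b)%ring by move: h1 h2 h3 h4 h5 h6; rmax_lra.
have yb : y ('X - b%:P)%ring = abs (a - b)%ring by move: h1 h2 h3 h4 h5 h6; rmax_lra.
have ya' : y ('X - a%:P)%ring < abs (a - b)%ring by move: h1 h2 h3 h4 h5 h6; rmax_lra.
clear h1 h2 h3 h4 h5 h6.
have ca := absBC Habs c a; have cb := absBC Habs c b.
apply: Rle_antisym.
- apply: Rmax_lub.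
  + have := abs_sub_trans Habs a c b; have := abs_sub_le_sn Habs sx c b.
    have := abs_sub_le_sn Habs sy a c.
    by rmax_lra.
  + have := abs_sub_trans Habs a c b; have := abs_sub_le_sn Habs sx c b.
    have := abs_sub_le_sn Habs sy a c.
    by rmax_lra.
- apply: Rmax_lub.
  + by have := sn_XsubC_le Habs sx c a; rmax_lra.
  + by have := sn_XsubC_le Habs sy c a; rmax_lra.
Qed.

Lemma zetaG_berk : is_berk abs (zetaG abs).
Proof. exact: gauss_seminorm. Qed.

Lemma is_join_zetaG x : is_seminorm abs x ->
  is_join abs (Some x) (zetaG abs) (Some (gauss_at abs 0%ring (Rmax 1 (x 'X%ring)))).
Proof.
move=> sx; have m1 := Rmax1_ge1 (x 'X%ring).
rewrite /zetaG gauss_norm_eq //; apply: is_join_linear => //.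
- by apply: gauss_at_seminorm => //; lra.
- by apply: gauss_at_seminorm => //; lra.
move=> c; rewrite !gauss_at_XsubC //; try lra.
rewrite sub0r absN //.
have := sn_X_le Habs sx c; have := sn_XsubC_leX Habs sx c; have := abs_le_sn Habs sx c.
by rmax_lra.
Qed.

Lemma medianE P Q S M :
  M = bjoin abs P Q \/ M = bjoin abs Q S \/ M = bjoin abs P S ->
  le_b M (bjoin abs P Q) -> le_b M (bjoin abs Q S) -> le_b M (bjoin abs P S) ->
  median abs P Q S = M.
Proof.
move=> M1 M2 M3 M4.
pose is_median M := (M = bjoin abs P Q \/ M = bjoin abs Q S \/ M = bjoin abs P S) /\
    le_b M (bjoin abs P Q) /\ le_b M (bjoin abs Q S) /\ le_b M (bjoin abs P S).
have [E1 [E2 [E3 E4]]] : is_median (median abs P Q S).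
  by apply: (epsilon_spec (inhabits None) is_median); exists M.
apply: le_b_anti.
- by case: M1 => [|[]] ->.
- by case: E1 => [|[]] ->.
Qed.

(** [A], [B], [C] are meant as the joins of [P] with [Q], of [Q] with the Gauss point and of [P]
    with the Gauss point; their least element [J] is [P v_G Q]. The last four clauses only concern
    bounds over unit forms, enough to identify the diagonal kernel of [J] with the mixed kernel of
    [P] and [Q]. *)
Definition meet_of_joins P Q A B C J : Prop :=
  (J = A \/ J = B \/ J = C) /\ le_b J A /\ le_b J B /\ le_b J C /\ is_berk abs J /\
  (forall u v, unit_form abs u v -> ell P u v <= ell J u v) /\
  (forall u v, unit_form abs u v -> ell Q u v <= ell J u v) /\
  (forall m : R, (forall u v, unit_form abs u v -> m <= Rmax (ell P u v) (ell Q u v)) ->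
     forall u v, unit_form abs u v -> m <= ell J u v) /\
  (forall u v, unit_form abs u v -> ker abs (ell J) (ell J) <= Rmax (ell P u v) (ell Q u v)).

Lemma ell_gauss0 (r : R) u v : 1 <= r ->
  ell (Some (gauss_at abs 0%ring r)) u v = Rmax (abs u) (abs v / r).
Proof.
move=> r1; rewrite /ell gauss_at_lin //; last lra.
rewrite gauss_at_X //; last lra.
rewrite mulr0 add0r abs0 //.
have -> : Rmax 1 (Rmax r 0) = r by rmax_lra.
have ri : 0 <= / r by apply/Rlt_le/Rinv_0_lt_compat; lra.
rewrite /Rdiv !(Rmult_comm _ (/ r)) -RmaxRmult //; congr Rmax.
by field; lra.
Qed.

Lemma ell_gauss0_ge (r : R) u v : 1 <= r -> unit_form abs u v ->
  / r <= ell (Some (gauss_at abs 0%ring r)) u v.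
Proof.
move=> r1 uv; rewrite ell_gauss0 //.
have ri : / r <= 1 by rewrite -Rinv_1; apply: Rinv_le_contravar; lra.
have ri0 : 0 < / r by apply: Rinv_0_lt_compat; lra.
move: uv; rewrite /unit_form {1}/Rmax; case: Rle_dec => _ e.
- by rewrite e /Rdiv Rmult_1_l; exact: Rmax_r.
- by rewrite e; apply: Rle_trans (Rmax_l _ _).
Qed.

Lemma ell_le_gauss0 x (r : R) u v : is_seminorm abs x -> 1 <= r <= Rmax 1 (x 'X%ring) ->
  ell (Some x) u v <= ell (Some (gauss_at abs 0%ring r)) u v.
Proof.
move=> sx [r1 rx]; rewrite ell_gauss0 // /ell.
set m := Rmax 1 _ in rx *.
have xX : x 'X%ring <= m by exact: Rmax_r.
have le : x (u *: 'X + v%:P)%ring <= Rmax (abs u * m) (abs v).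
  apply: Rle_trans (snD sx _ _) _; rewrite (snZ sx) (snC sx).
  apply: Rmax_lub; last exact: Rmax_r.
  apply: Rle_trans (Rmax_l _ _); apply: Rmult_le_compat_l => //; exact: abs_ge0.
have mi : 0 < / m by apply: Rinv_0_lt_compat; lra.
apply: Rle_trans (Rmult_le_compat_r _ _ _ (Rlt_le _ _ mi) le) _.
rewrite Rmult_comm -RmaxRmult; last lra.
apply: Rmax_lub.
- apply: Rle_trans (Rmax_l _ _); apply: Req_le; field; lra.
- apply: Rle_trans (Rmax_r _ _); rewrite Rmult_comm; apply: Rmult_le_compat_l; first exact: abs_ge0.
  by apply: Rinv_le_contravar; lra.
Qed.

Lemma ell_None_le_gauss0 (r : R) u v : 1 <= r ->
  ell None u v <= ell (Some (gauss_at abs 0%ring r)) u v.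
Proof. by move=> r1; rewrite ell_gauss0 //=; exact: Rmax_l. Qed.

Lemma ker_gauss0_le (r : R) : 1 <= r ->
  let l := ell (Some (gauss_at abs 0%ring r)) in ker abs l l <= / r.
Proof.
move=> r1 l; have nl : form_norm abs l by apply: ell_norm; apply: gauss_at_seminorm => //; lra.
apply: Rle_trans (ker_diag_le Habs nl (unit_form01 Habs)) _.
rewrite /l ell_gauss0 // abs0 // abs1 // Rmax_right; first by rewrite /Rdiv; lra.
by apply: Rmult_le_pos; [lra | apply/Rlt_le/Rinv_0_lt_compat; lra].
Qed.

(** The root of the form is either at most [Rmax 1 (x 'X)] in absolute value, which forces a large
    leading coefficient, or larger, and then [x] sees only the constant term. *)
Lemma ell_dichotomy x u v : is_seminorm abs x -> unit_form abs u v ->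
  (abs v <= abs u * Rmax 1 (x 'X%ring) /\ / Rmax 1 (x 'X%ring) <= abs u) \/
  / Rmax 1 (x 'X%ring) <= ell (Some x) u v.
Proof.
move=> sx uv; rewrite /ell; have xX := Rmax_r 1 (x 'X%ring).
have m1 := Rmax1_ge1 (x 'X%ring); set m := Rmax 1 _ in m1 xX *.
have mi : 0 < / m by apply: Rinv_0_lt_compat; lra.
have u0 := abs_ge0 Habs u.
case: (Rle_dec (abs v) (abs u * m)) => le.
- left; split=> //; apply: (Rmult_le_reg_r m); first lra.
  by rewrite Rinv_l; [move: uv; rewrite /unit_form; rmax_lra; nra | lra].
- right; rewrite addrC (snD_eq Habs sx) (snC sx) ?(snZ sx); last by nra.
  have -> : abs v = 1 by move: uv; rewrite /unit_form; rmax_lra; nra.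
  by rewrite /Rdiv Rmult_1_l; lra.
Qed.

Lemma meet_of_joins_sym P Q A B C J :
  meet_of_joins P Q A B C J -> meet_of_joins Q P A C B J.
Proof.
case=> h1 [h2 [h3 [h4 [h5 [h6 [h7 [h8 h9]]]]]]].
split; first by case: h1 => [|[]]; tauto.
do !split=> //; last by move=> u v uv; rewrite Rmax_comm; exact: h9.
move=> m hm; apply: h8 => u v uv.
by rewrite Rmax_comm; exact: hm.
Qed.

Lemma meet_None_Some y A : is_seminorm abs y -> is_join abs None (Some y) A ->
  exists J, meet_of_joins None (Some y) A
    (Some (gauss_at abs 0%ring (Rmax 1 (y 'X%ring)))) None J.
Proof.
move=> sy [_ [hA _]]; have m1 := Rmax1_ge1 (y 'X%ring).
case: A hA => // _.
exists (Some (gauss_at abs 0%ring (Rmax 1 (y 'X%ring)))).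
split; first by right; left.
do 3![split; [by move=> *; first [exact: Rle_refl | done] |]].
split; first by apply: gauss_at_seminorm => //; lra.
split; first by move=> u v _; exact: ell_None_le_gauss0.
split; first by move=> u v _; apply: ell_le_gauss0 => //; lra.
split.
  move=> m hm u v uv; apply: Rle_trans (ell_gauss0_ge m1 uv).
  have := hm _ _ (unit_form01 Habs); rewrite ell01 //= abs0 //.
  rewrite Rmax_right //.
  by apply/Rlt_le/Rinv_0_lt_compat; lra.
move=> u v uv; apply: Rle_trans (ker_gauss0_le m1) _.
by case: (ell_dichotomy sy uv) => [[_ le]|le]; apply: Rle_trans le _;
  [exact: Rmax_l | exact: Rmax_r].
Qed.

(** The joins with the Gauss point are nested discs around [0]. The smaller one, that of [x], also
    lies below the join of [x] and [y], so it is the meet. *)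
Lemma meet_Some_lt x y A : is_seminorm abs x -> is_seminorm abs y ->
  Rmax 1 (x 'X%ring) < Rmax 1 (y 'X%ring) -> is_join abs (Some x) (Some y) A ->
  exists J, meet_of_joins (Some x) (Some y) A
    (Some (gauss_at abs 0%ring (Rmax 1 (y 'X%ring))))
    (Some (gauss_at abs 0%ring (Rmax 1 (x 'X%ring)))) J.
Proof.
move=> sx sy lt jA; have m1 := Rmax1_ge1 (x 'X%ring).
have [j [sj ej]] := join_linear_exists sx sy.
have -> : A = Some j by rewrite -(bjoinE jA) (bjoinE (is_join_linear sx sy sj ej)).
exists (Some (gauss_at abs 0%ring (Rmax 1 (x 'X%ring)))).
have sg (r : R) : 1 <= r -> is_seminorm abs (gauss_at abs 0%ring r).
  by move=> r1; apply: gauss_at_seminorm => //; lra.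
split; first by right; right.
split.
  apply: (sn_le_of_linear Habs) => //; first exact: sg.
  move=> c; rewrite ej gauss_at_XsubC //; last lra.
  rewrite sub0r absN //.
  have := abs_le_sn Habs sx c; have := sn_X_le Habs sy c.
  by move: lt; rmax_lra.
split.
  apply: (sn_le_of_linear Habs); try (apply: sg; lra).
  move=> c; rewrite !gauss_at_XsubC //; try lra.
  by move: lt; rmax_lra.
split; first exact: le_b_refl.
split; first by apply: sg; lra.
split; first by move=> u v _; apply: ell_le_gauss0 => //; lra.
split; first by move=> u v _; apply: ell_le_gauss0 => //; lra.
split.
  move=> m hm u v uv; apply: Rle_trans (ell_gauss0_ge m1 uv).
  have := hm _ _ (unit_form01 Habs); rewrite !ell01 //.
  rewrite Rmax_left //.
  by apply: Rinv_le_contravar; lra.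
move=> u v uv; apply: Rle_trans (ker_gauss0_le m1) _.
case: (ell_dichotomy sx uv) => [[vu le]|le]; last by apply: Rle_trans le (Rmax_l _ _).
apply: Rle_trans (Rmax_r _ _); apply: Rle_trans (le) _.
have yX : Rmax 1 (y 'X%ring) = y 'X%ring by move: lt; rmax_lra.
have u0 : 0 < abs u.
  by apply: (Rlt_le_trans _ _ _ _ le); apply: Rinv_0_lt_compat; lra.
have e : y (u *: 'X + v%:P)%ring = abs u * y 'X%ring.
  by rewrite (snD_eq Habs sy) ?(snC sy) (snZ sy) // -yX; nra.
rewrite /ell yX e; apply: Req_le; field.
by rewrite -yX; lra.
Qed.

(** Here [x] and [y] meet no later than they meet the Gauss point, so the meet is their join. All
    three share the same scaling factor, which makes [ell] of the join the pointwise maximum. *)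
Lemma meet_Some_eq x y A : is_seminorm abs x -> is_seminorm abs y ->
  Rmax 1 (x 'X%ring) = Rmax 1 (y 'X%ring) -> is_join abs (Some x) (Some y) A ->
  exists J, meet_of_joins (Some x) (Some y) A
    (Some (gauss_at abs 0%ring (Rmax 1 (y 'X%ring))))
    (Some (gauss_at abs 0%ring (Rmax 1 (x 'X%ring)))) J.
Proof.
move=> sx sy exy jA; have m1 := Rmax1_ge1 (x 'X%ring).
have [j [sj ej]] := join_linear_exists sx sy.
have -> : A = Some j by rewrite -(bjoinE jA) (bjoinE (is_join_linear sx sy sj ej)).
rewrite -exy; exists (Some j).
have lej : le_b (Some j) (Some (gauss_at abs 0%ring (Rmax 1 (x 'X%ring)))).
  apply: (sn_le_of_linear Habs) => //; first by apply: gauss_at_seminorm => //; lra.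
  move=> c; rewrite ej gauss_at_XsubC //; last lra.
  rewrite sub0r absN //.
  have := sn_XsubC_leX Habs sx c; have := sn_XsubC_leX Habs sy c.
  by move: exy; rmax_lra.
have jX : Rmax 1 (j 'X%ring) = Rmax 1 (x 'X%ring).
  have -> : j 'X%ring = Rmax (x 'X%ring) (y 'X%ring) by have := ej 0%ring; rewrite !subr0.
  by move: exy; rmax_lra.
have ellj u v : ell (Some j) u v = Rmax (ell (Some x) u v) (ell (Some y) u v).
  rewrite /ell jX -exy /Rdiv !(Rmult_comm _ (/ Rmax 1 _)) RmaxRmult; last first.
    by apply/Rlt_le/Rinv_0_lt_compat; lra.
  congr (_ * _).
  have [->|u0] := eqVneq u 0%ring.
    by rewrite lin0 (snC sj) (snC sx) (snC sy) Rmax_left //; lra.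
  have [c uc] := lin_root v u0.
  by rewrite (sn_lin sx uc) (sn_lin sy uc) (sn_lin sj uc) ej RmaxRmult //; exact: abs_ge0.
split; first by left.
split; first exact: le_b_refl.
split=> //; split=> //; split=> //.
split; first by move=> u v _; rewrite ellj; exact: Rmax_l.
split; first by move=> u v _; rewrite ellj; exact: Rmax_r.
split; first by move=> m hm u v uv; rewrite ellj; exact: hm.
move=> u v uv; rewrite -ellj; apply: ker_diag_le => //; exact: (@ell_norm (Some j)).
Qed.

Lemma join_exists P Q : is_berk abs P -> is_berk abs Q -> exists J, is_join abs P Q J.
Proof.
case: P => [x|] bP; last by exists None; apply/is_joinC/is_join_None.
case: Q => [y|] bQ; last by exists None; exact: is_join_None.
have [j [sj ej]] := join_linear_exists bP bQ.
by exists (Some j); exact: is_join_linear.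
Qed.

Lemma meet_of_joins_exists P Q A B C : is_berk abs P -> is_berk abs Q ->
  is_join abs P Q A -> is_join abs Q (zetaG abs) B -> is_join abs P (zetaG abs) C ->
  exists J, meet_of_joins P Q A B C J.
Proof.
have jz Z D : is_berk abs Z -> is_join abs Z (zetaG abs) D ->
    D = match Z with None => None
        | Some x => Some (gauss_at abs 0%ring (Rmax 1 (x 'X%ring))) end.
  case: Z => [x|] bZ jD; rewrite -(bjoinE jD); apply: bjoinE.
  - exact: is_join_zetaG.
  - exact/is_joinC/is_join_None.
move=> bP bQ jA jB jC; rewrite (jz _ _ bQ jB) (jz _ _ bP jC) => {jB jC B C}.
case: P Q bP bQ jA => [x|] [y|] bP bQ jA.
- have [lt|[e|gt]] := Rtotal_order (Rmax 1 (x 'X%ring)) (Rmax 1 (y 'X%ring)).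
  + exact: meet_Some_lt.
  + exact: meet_Some_eq.
  + have [J hJ] := meet_Some_lt bQ bP gt (is_joinC jA).
    by exists J; exact: meet_of_joins_sym.
- have [J hJ] := meet_None_Some bP (is_joinC jA).
  by exists J; exact: meet_of_joins_sym.
- exact: meet_None_Some.
- exists None; case: jA => _ [hA _]; case: A hA => // _.
  do !split=> //; try by move=> *; exact: Rle_refl.
    by left.
    by move=> m hm u v uv; have := hm u v uv; rewrite Rmax_left //; lra.
  move=> u v uv; rewrite Rmax_left; last lra.
  by apply: ker_diag_le => //; exact: (@ell_norm None).
Qed.

(** The bridge from the tree to the kernel. The two medians are the argument orders of [joinG] and
    of [on_path] towards the Gauss point. *)
Lemma joinG_median_spec P Q : is_berk abs P -> is_berk abs Q ->
  exists J, [/\ joinG abs P Q = J, median abs P (zetaG abs) Q = J, is_berk abs J,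
    (forall u v, unit_form abs u v -> ell Q u v <= ell J u v) &
    ker abs (ell J) (ell J) = ker abs (ell P) (ell Q)].
Proof.
move=> bP bQ; have bz := zetaG_berk.
have [A jA] := join_exists bP bQ; have [B jB] := join_exists bQ bz.
have [C jC] := join_exists bP bz.
have [J [h1 [h2 [h3 [h4 [h5 [h6 [h7 [h8 h9]]]]]]]]] := meet_of_joins_exists bP bQ jA jB jC.
have nJ := ell_norm h5; have nP := ell_norm bP.
exists J; split=> //.
- apply: medianE; rewrite ?(bjoinE jA) ?(bjoinE jB) ?(bjoinE jC) //.
- apply: medianE; rewrite ?(bjoinE jA) ?(bjoinE (is_joinC jB)) ?(bjoinE jC) //.
  by case: h1 => [|[]]; tauto.
- apply: Rle_antisym.
  + by apply: ker_ge.
  + apply: ker_diag_ge => // u v uv; apply: h8 => // u' v' uv'.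
    exact: ker_le.
Qed.

Lemma berk_dist_form P Q : is_berk abs P -> is_berk abs Q ->
  berk_dist abs P Q = form_dist abs (ell P) (ell Q).
Proof.
move=> bP bQ; rewrite /berk_dist /form_dist.
have [J [-> _ bJ _ <-]] := joinG_median_spec bP bQ.
by rewrite !diamG_ker.
Qed.

End Tree.
(** * Rational maps and inversion *)

Section Push.
Variables (K : closedFieldType) (abs : K -> R).
Hypothesis Habs : nonarch_complete_abs abs.
Implicit Types (x y : {poly K} -> R) (f g h k : {poly K}) (a b c u v z : K).
Implicit Types (P Q J M : bpoint K) (n m d : nat).

(** [g ^ n * h (f / g)] with the homogenising degree [n] kept free, so that polynomials of different
    sizes can be added over one power of [g]. *)
Definition hom_comp n f g h : {poly K} :=
  (\sum_(i < n.+1) h`_i *: (f ^+ i * g ^+ (n - i)%N))%ring.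

Lemma comp_poly_ratE f g h : comp_poly_rat f g h = hom_comp (size h).-1 f g h.
Proof.
rewrite /comp_poly_rat /hom_comp; case E: (size h) => [|n] //.
have -> : h = 0%ring by apply/eqP; rewrite -size_poly_eq0 E.
by rewrite big_ord0 big_ord1 coef0 scale0r.
Qed.

(** In the field of fractions homogenised composition is evaluation at [f / g] times a power of [g],
    which makes its multiplicativity immediate. *)
Definition frac_eval f g : {poly K} -> {fraction {poly K}} :=
  fun h => ((map_poly (@tofrac {poly K} \o polyC) h).[tofrac f / tofrac g])%ring.

Lemma tofrac_hom_comp n f g h : g != 0%ring -> (size h <= n.+1)%N ->
  tofrac (hom_comp n f g h) = (tofrac g ^+ n * frac_eval f g h)%ring.
Proof.
move=> g0 sh; have g0' : tofrac g != 0%ring by rewrite tofrac_eq0.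
rewrite /frac_eval (horner_coef_wide _ (n := n.+1)); last first.
  by rewrite size_map_inj_poly ?raddf0 // => p q; move/eqP; rewrite /= tofrac_eq => /eqP/polyC_inj.
rewrite /hom_comp rmorph_sum mulr_sumr; apply: eq_bigr => i _.
rewrite coef_map /= -mul_polyC !rmorphM !rmorphXn /= expr_div_n.
have -> : (tofrac g ^+ n = tofrac g ^+ (n - i)%N * tofrac g ^+ i)%ring.
  by rewrite -exprD subnK // -ltnS.
have gi : (tofrac g ^+ i != 0)%ring by rewrite expf_neq0.
move: (tofrac _) (tofrac f ^+ i)%ring (tofrac g ^+ i)%ring gi (tofrac g ^+ _)%ring => C F G G0 D.
by rewrite mulrACA (mulrC D C) -(mulrA C) [(G * _)%ring]mulrC divfK // (mulrC F).
Qed.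

Lemma frac_evalM f g h k : (frac_eval f g (h * k) = frac_eval f g h * frac_eval f g k)%ring.
Proof. by rewrite /frac_eval rmorphM hornerM. Qed.

Lemma hom_compM n m f g h k : g != 0%ring -> (size h <= n.+1)%N -> (size k <= m.+1)%N ->
  (hom_comp (n + m)%N f g (h * k) = hom_comp n f g h * hom_comp m f g k)%ring.
Proof.
move=> g0 sh sk; apply/eqP; rewrite -tofrac_eq rmorphM /= !tofrac_hom_comp //.
  by rewrite frac_evalM exprD [X in X == _]mulrACA.
apply: leq_trans (size_polyMleq _ _) _.
by have := leq_add sh sk; rewrite addSn addnS; case: (size h + size k)%N.
Qed.

Lemma hom_comp_pad n m f g h : g != 0%ring -> (size h <= n.+1)%N ->
  (hom_comp (n + m)%N f g h = hom_comp n f g h * g ^+ m)%ring.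
Proof.
move=> g0 sh; rewrite -{1}[h]mulr1 hom_compM // ?size_poly1 //; congr (_ * _)%ring.
rewrite /hom_comp big_ord_recl big1 => [|i _].
  by rewrite coef1 /= expr0 mul1r scale1r addr0 subn0.
by rewrite coef1 /= scale0r.
Qed.

Lemma hom_compD n f g h k : (hom_comp n f g (h + k) = hom_comp n f g h + hom_comp n f g k)%ring.
Proof. by rewrite /hom_comp -big_split; apply: eq_bigr => i _; rewrite coefD scalerDl. Qed.

Lemma hom_compZ n f g c h : (hom_comp n f g (c *: h) = c *: hom_comp n f g h)%ring.
Proof. by rewrite /hom_comp scaler_sumr; apply: eq_bigr => i _; rewrite coefZ scalerA. Qed.

Lemma pushE n f g x h : is_seminorm abs x -> x g <> 0 -> (size h <= n.+1)%N ->
  push f g x h = x (hom_comp n f g h) / x g ^ n.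
Proof.
move=> sx xg sh; rewrite /push comp_poly_ratE.
have g0 : g != 0%ring by apply/eqP => g0; apply: xg; rewrite g0 (sn0 Habs sx).
have le : ((size h).-1 <= n)%N by case: (size h) sh.
rewrite -(subnKC le) hom_comp_pad ?leqSpred // (snM sx) (snX Habs sx) pow_add.
by field; split; apply: pow_nonzero.
Qed.

Lemma push_seminorm f g x : is_seminorm abs x -> x g <> 0 -> is_seminorm abs (push f g x).
Proof.
move=> sx xg.
have g0 : g != 0%ring by apply/eqP => g0; apply: xg; rewrite g0 (sn0 Habs sx).
have xg0 : 0 < x g by have := sn_ge0 sx g; lra.
have pg n : 0 < / x g ^ n by apply/Rinv_0_lt_compat/pow_lt.
split; first by move=> h; apply: Rmult_le_pos; [apply: (sn_ge0 sx) | exact: Rlt_le].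
split.
  move=> h k; rewrite /Pmul (pushE (n := (size h).-1 + (size k).-1)) //.
    rewrite hom_compM ?leqSpred // (snM sx) !(pushE _ sx xg (leqSpred _)) pow_add.
    by field; split; apply: pow_nonzero.
  apply: leq_trans (size_polyMleq _ _) _.
  have := leq_add (leqSpred (size h)) (leqSpred (size k)); rewrite addSn addnS.
  by case: (size h + size k)%N.
split.
  move=> h k; rewrite /Padd; pose n := maxn (size h) (size k).
  have sh : (size h <= n.+1)%N by rewrite leqW // leq_maxl.
  have sk : (size k <= n.+1)%N by rewrite leqW // leq_maxr.
  have shk : (size (h + k)%ring <= n.+1)%N by rewrite leqW // size_polyD.
  rewrite (pushE _ sx xg sh) (pushE _ sx xg sk) (pushE _ sx xg shk) hom_compD.
  rewrite /Rdiv !(Rmult_comm _ (/ x g ^ n)) RmaxRmult; last exact: Rlt_le.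
  by apply: Rmult_le_compat_l; [exact: Rlt_le | apply: (snD sx)].
move=> c; rewrite /Pconst (pushE (n := 0%N)) //; last by rewrite size_polyC; case: (c != 0%ring).
rewrite /hom_comp big_ord1 coefC /= !expr0 mulr1 (snZ sx) (sn1 Habs sx) /=.
by field.
Qed.

Definition hnorm f g x : K -> K -> R :=
  fun u v => x (u *: f + v *: g)%ring / Rmax (x f) (x g).

(** The form [u X + v Z] pulls back to [u f + v g]. After normalisation a pole, where [x g = 0],
    obeys the same formula as every other point. *)
Lemma phi_act_Some f g x : is_seminorm abs x -> 0 < Rmax (x f) (x g) ->
  is_berk abs (phi_act abs f g (Some x)) /\ ell abs (phi_act abs f g (Some x)) = hnorm f g x.
Proof.
move=> sx pos; rewrite /phi_act; case: Req_EM_T => xg.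
  split=> //; apply: functional_extensionality => u; apply: functional_extensionality => v.
  rewrite /hnorm /=; rewrite xg Rmax_left in pos *; try exact: (sn_ge0 sx).
  suff -> : x (u *: f + v *: g)%ring = abs u * x f by field; lra.
  have z : x (v *: g)%ring = 0 by rewrite (snZ sx) xg Rmult_0_r.
  rewrite -(snZ sx).
  have le1 : x (u *: f)%ring <= Rmax (x (u *: f + v *: g)%ring) 0.
    by rewrite -{1}(addrK (v *: g)%ring (u *: f)%ring) -z; exact: (snB Habs sx).
  have le2 : x (u *: f + v *: g)%ring <= Rmax (x (u *: f)%ring) 0.
    by rewrite -z; exact: (snD sx).
  rewrite !Rmax_left in le1 le2; try exact: (sn_ge0 sx).
  exact: Rle_antisym.
split; first exact: push_seminorm.
have xg0 : 0 < x g by have := sn_ge0 sx g; lra.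
have plin u v : push f g x (u *: 'X + v%:P)%ring = x (u *: f + v *: g)%ring / x g.
  rewrite (pushE (n := 1%N)) //.
    rewrite /hom_comp big_ord_recl big_ord1 /= !coefD !coefZ !coefX !coefC /=.
    rewrite mulr0 add0r mulr1 addr0 expr0 mul1r expr1 mulr1 addrC.
    by rewrite Rmult_1_r.
  apply: leq_trans (size_polyD _ _) _; rewrite geq_max.
  rewrite (leq_trans (size_scale_leq _ _)) ?size_polyX //=.
  by rewrite size_polyC; case: (v != 0%ring).
apply: functional_extensionality => u; apply: functional_extensionality => v.
rewrite /hnorm /ell /= plin.
have -> : push f g x 'X%ring = x f / x g.
  by have := plin 1%ring 0%ring; rewrite polyC0 addr0 !scale1r scale0r addr0.
have -> : Rmax (x f) (x g) = x g * Rmax 1 (x f / x g).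
  rewrite -RmaxRmult; last lra.
  rewrite Rmax_comm Rmult_1_r; congr Rmax; field; lra.
have := Rmax1_ge1 (x f / x g) => ?.
by field; lra.
Qed.

Lemma typeI_berk c : is_berk abs (typeI abs c).
Proof. exact: sn_eval. Qed.

Lemma ell_typeI c u v : ell abs (typeI abs c) u v = abs (u * c + v)%ring / Rmax 1 (abs c).
Proof. by rewrite /typeI /= /Peval !hornerE. Qed.

Lemma abs_homogenise (p q u v : K) : q != 0%ring ->
  abs (u * (p / q) + v)%ring / Rmax 1 (abs (p / q)%ring) =
  abs (u * p + v * q)%ring / Rmax (abs p) (abs q).
Proof.
move=> q0; have aq := abs_gt0 Habs q0.
have -> : (u * p + v * q = q * (u * (p / q) + v))%ring by kfield.
have -> : Rmax (abs p) (abs q) = abs q * Rmax 1 (abs (p / q)%ring).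
  rewrite -RmaxRmult; last lra.
  rewrite Rmax_comm Rmult_1_r; congr Rmax.
  by rewrite absM // absV //; field; lra.
rewrite [abs (q * _)%ring]absM //; have := Rmax1_ge1 (abs (p / q)%ring) => ?.
by field; lra.
Qed.

(** The image of infinity is the ratio of the coefficients of [f] and [g] in degree [d]; the choice
    of [d] makes one of them nonzero. *)
Lemma phi_act_None f g d : g != 0%ring -> d = (maxn (size f) (size g)).-1 ->
  is_berk abs (phi_act abs f g None) /\
  0 < Rmax (abs (f`_d)%ring) (abs (g`_d)%ring) /\
  forall u v, ell abs (phi_act abs f g None) u v =
    abs (u * f`_d + v * g`_d)%ring / Rmax (abs (f`_d)%ring) (abs (g`_d)%ring).
Proof.
move=> g0 dE; rewrite /phi_act; case: (ltnP (size g) (size f)) => sfg.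
- rewrite (sfg : ltn (size g) (size f)).
  have -> : (g`_d = 0)%ring.
    by rewrite nth_default // dE (maxn_idPl (ltnW sfg)); case: (size f) sfg.
  have fd : (f`_d != 0)%ring.
    rewrite dE (maxn_idPl (ltnW sfg)) -/(lead_coef f) lead_coef_eq0 -size_poly_eq0.
    by case: (size f) sfg.
  have := abs_gt0 Habs fd => fd0; rewrite abs0 // Rmax_left; last lra.
  split=> //; split=> // u v /=.
  by rewrite mulr0 addr0 absM //; field; apply: Rgt_not_eq; exact: fd0.
- have -> : ltn (size g) (size f) = false by apply/negbTE; rewrite -leqNgt.
  have gd : (g`_d = lead_coef g)%ring by rewrite dE (maxn_idPr sfg).
  have gl : lead_coef g != 0%ring by rewrite lead_coef_eq0.
  have cE : value_at_infinity f g = (f`_d / g`_d)%ring.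
    rewrite /value_at_infinity gd; case: (ltnP (size f) (size g)) => s.
      rewrite (s : ltn (size f) (size g)) nth_default ?mul0r //.
      by rewrite dE (maxn_idPr sfg); case: (size g) s.
    have -> : ltn (size f) (size g) = false by apply/negbTE; rewrite -leqNgt.
    have es : size f = size g by apply/eqP; rewrite eqn_leq sfg s.
    by rewrite dE es maxnn -es.
  split; first exact: typeI_berk.
  have := abs_gt0 Habs gl; rewrite -gd => gd0.
  have pos : 0 < Rmax (abs (f`_d)%ring) (abs (g`_d)%ring).
    exact: Rlt_le_trans gd0 (Rmax_r _ _).
  split=> // u v; rewrite ell_typeI cE; apply: abs_homogenise.
  by rewrite gd.
Qed.

Lemma phi_act_berk f g P : g != 0%ring -> coprimep f g -> is_berk abs P ->
  is_berk abs (phi_act abs f g P).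
Proof.
move=> g0 cop; case: P => [x|] bP.
- by have [] := phi_act_Some bP (sn_coprime_gt0 Habs bP cop).
- by have [] := phi_act_None g0 (erefl (maxn (size f) (size g)).-1).
Qed.

(* The inversion [1/T]; it exchanges the two charts of the projective line. *)
Definition binv P : bpoint K := phi_act abs 1%ring 'X%ring P.

Lemma coprime1X : coprimep (1 : {poly K})%ring 'X%ring.
Proof. exact: coprime1p. Qed.

Lemma binv_berk P : is_berk abs P -> is_berk abs (binv P).
Proof. by apply: phi_act_berk; [rewrite polyX_eq0 | exact: coprime1X]. Qed.

Lemma ell_binv P : is_berk abs P -> ell abs (binv P) = swap (ell abs P).
Proof.
move=> bP; apply: functional_extensionality => u; apply: functional_extensionality => v.
rewrite /swap; case: P bP => [x|] bP.
- have [_ ->] := phi_act_Some bP (sn_coprime_gt0 Habs bP coprime1X).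
  by rewrite /hnorm /= (sn1 Habs bP) addrC -[(u *: 1)%ring]mul_polyC mulr1.
- have [||_ [_ ->]] := @phi_act_None 1%ring 'X%ring 1%N.
  + by rewrite polyX_eq0.
  + by rewrite size_poly1 size_polyX.
  rewrite coef1 coefX /= mulr0 mulr1 add0r abs0 // abs1 //.
  by rewrite Rmax_right; [field | lra].
Qed.

Lemma binvK P : is_berk abs P -> binv (binv P) = P.
Proof.
move=> bP; have b1 := binv_berk bP; have b2 := binv_berk b1.
by apply: (ell_inj Habs b2 bP); rewrite ell_binv // ell_binv.
Qed.

(** [T ^ d * h (1 / T)]. Padding [f] and [g] to the same degree [d] keeps their quotient equal to
    [phi (1 / T)]. *)
Definition rev_poly d h : {poly K} := hom_comp d 1%ring 'X%ring h.

Lemma sn_eval0 x : is_seminorm abs x -> x 'X%ring = 0 -> x = fun h => abs (h.[0])%ring.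
Proof.
move=> sx x0; apply: (sn_ext_linear Habs) => //; first exact: (sn_eval Habs 0%ring).
move=> c; rewrite hornerXsubC sub0r absN //.
have := abs_le_sn Habs sx c; have := sn_XsubC_leX Habs sx c; have := sn_ge0 sx ('X - c%:P)%ring.
rewrite x0; have := abs_ge0 Habs c.
by rmax_lra.
Qed.

Lemma rev_poly_horner0 d h : ((rev_poly d h).[0] = h`_d)%ring.
Proof.
rewrite /rev_poly /hom_comp horner_sum big_ord_recr big1 /=.
  by rewrite add0r hornerZ expr1n mul1r subnn expr0 hornerE mulr1.
move=> i _; rewrite hornerZ expr1n mul1r hornerXn expr0n subn_eq0 leqNgt ltn_ord /=.
by rewrite mulr0.
Qed.

Section Reverse.
Variables (f g : {poly K}) (d : nat).
Hypothesis g0 : g != 0%ring.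
Hypothesis cop : coprimep f g.
Hypothesis dE : d = (maxn (size f) (size g)).-1.

Lemma size_f_le : (size f <= d.+1)%N.
Proof. by rewrite dE (leq_trans (leq_maxl _ (size g))) // leqSpred. Qed.

Lemma size_g_le : (size g <= d.+1)%N.
Proof. by rewrite dE (leq_trans (leq_maxr (size f) _)) // leqSpred. Qed.

Lemma size_comb_le u v : (size (u *: f + v *: g)%ring <= d.+1)%N.
Proof.
apply: leq_trans (size_polyD _ _) _; rewrite geq_max.
by rewrite !(leq_trans (size_scale_leq _ _)) ?size_f_le ?size_g_le.
Qed.

(** Stands in for coprimality of the reversed pair: away from [0] it is coprimality of [f] and [g]
    at the inverted point, and at [0] it is the nonvanishing of a coefficient in degree [d]. *)
Lemma rev_poly_gt0 x : is_seminorm abs x -> 0 < Rmax (x (rev_poly d f)) (x (rev_poly d g)).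
Proof.
move=> sx; case: (Req_dec (x 'X%ring) 0) => x0.
  rewrite (sn_eval0 sx x0) !rev_poly_horner0.
  by have [_ []] := phi_act_None g0 dE.
have p0 : 0 < x 'X%ring ^ d by apply: pow_lt; have := sn_ge0 sx 'X%ring; lra.
have := sn_coprime_gt0 Habs (push_seminorm 1%ring sx x0) cop.
rewrite (pushE _ sx x0 size_f_le) (pushE _ sx x0 size_g_le).
have pi : 0 < / x 'X%ring ^ d by apply: Rinv_0_lt_compat.
rewrite /Rdiv !(Rmult_comm _ (/ x _ ^ d)) RmaxRmult; last lra.
by rewrite -!/(rev_poly d _) => h; apply: Rnot_le_lt => le; nra.
Qed.

Lemma phi_act_binv x : is_seminorm abs x ->
  phi_act abs f g (binv (Some x)) = phi_act abs (rev_poly d f) (rev_poly d g) (Some x).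
Proof.
move=> sx; have bI := @binv_berk (Some x) sx.
have [bR eR] := phi_act_Some sx (rev_poly_gt0 sx).
apply: (ell_inj Habs) => //; first exact: phi_act_berk.
rewrite eR; have rcomb u v : rev_poly d (u *: f + v *: g)%ring =
    (u *: rev_poly d f + v *: rev_poly d g)%ring.
  by rewrite /rev_poly hom_compD !hom_compZ.
apply: functional_extensionality => u; apply: functional_extensionality => v.
rewrite /hnorm -rcomb.
rewrite /binv {2}/phi_act; case: Req_EM_T => x0 /=.
- rewrite (sn_eval0 sx x0) !rev_poly_horner0.
  have [_ [_ e]] := phi_act_None g0 dE; have := e u v => /= ->.
  by rewrite coefD !coefZ.
- have sp := push_seminorm 1%ring sx x0.
  have [_ ->] := phi_act_Some sp (sn_coprime_gt0 Habs sp cop).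
  rewrite /hnorm (pushE _ sx x0 size_f_le) (pushE _ sx x0 size_g_le).
  rewrite (pushE _ sx x0 (size_comb_le u v)) -!/(rev_poly d _).
  have p0 : 0 < x 'X%ring ^ d by apply: pow_lt; have := sn_ge0 sx 'X%ring; lra.
  have pi : 0 < / x 'X%ring ^ d by apply: Rinv_0_lt_compat.
  rewrite /Rdiv !(Rmult_comm _ (/ x _ ^ d)) RmaxRmult; last lra.
  have := rev_poly_gt0 sx => ?.
  by field; lra.
Qed.

End Reverse.

Lemma size_rev_poly d h : (size (rev_poly d h) <= d.+1)%N.
Proof.
rewrite /rev_poly /hom_comp; apply: (big_ind (fun p : {poly K} => (size p <= d.+1)%N)).
- by rewrite size_poly0.
- by move=> p q sp sq; apply: leq_trans (size_polyD _ _) _; rewrite geq_max sp sq.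
- move=> i _; apply: leq_trans (size_scale_leq _ _) _.
  by rewrite expr1n mul1r size_polyXn ltnS leq_subr.
Qed.

End Push.
(** * Balls and the ball-mapping radius in the two charts *)

Section Balls.
Variables (K : closedFieldType) (abs : K -> R).
Hypothesis Habs : nonarch_complete_abs abs.
Implicit Types (x y : {poly K} -> R) (f g h k : {poly K}) (a b c u v z : K).
Implicit Types (P Q J M A X : bpoint K).

(** The meet of [P] and [Q] lies above [Q] on the way to the Gauss point. When its diameter is no
    larger than that of [Q], the two agree. *)
Lemma median_zetaG_absorb P Q : is_berk abs P -> is_berk abs Q ->
  ker abs (ell abs P) (ell abs Q) <= ker abs (ell abs Q) (ell abs Q) ->
  median abs P (zetaG abs) Q = Q.
Proof.
move=> bP bQ le; have [J [_ -> bJ leQ kJ]] := joinG_median_spec Habs bP bQ.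
apply/esym; apply: (ell_inj Habs) => //.
apply: (form_norm_eq_of_ker_le Habs) => //; try exact: ell_norm.
by rewrite kJ.
Qed.

(* [M] is the point of the path from [A] to the Gauss point with [diam_G M = r]. *)
Definition Q_at A (r : R) M : Prop :=
  is_berk abs M /\ ker abs (ell abs A) (ell abs M) = r /\ ker abs (ell abs M) (ell abs M) = r.

Lemma Qpt_Q_at A (r : R) : is_berk abs A -> (exists M, Q_at A r M) -> Q_at A r (Qpt abs A r).
Proof.
move=> bA [M0 [bM0 [k1 k2]]].
pose good M := is_berk abs M /\ on_path abs A (zetaG abs) M /\ diamG M = r.
have [bM [pM dM]] : good (Qpt abs A r).
  apply: (epsilon_spec (inhabits None) good); exists M0; split=> //.
  split; last by rewrite (diamG_ker Habs).
  by apply: median_zetaG_absorb; rewrite // k1 k2; lra.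
have [J [_ eJ _ _ kJ]] := joinG_median_spec Habs bA bM.
split=> //; split; last by rewrite -(diamG_ker Habs).
by rewrite -kJ -eJ pM -(diamG_ker Habs).
Qed.

Lemma ball_lt_of_ker A (r : R) X : is_berk abs A -> is_berk abs X -> (exists M, Q_at A r M) ->
  ker abs (ell abs X) (ell abs A) < r -> ball_lt abs A r X.
Proof.
move=> bA bX exM lt; have [bM [k1 k2]] := Qpt_Q_at bA exM.
have nA := ell_norm Habs bA; have nX := ell_norm Habs bX; have nM := ell_norm Habs bM.
split.
- apply: median_zetaG_absorb => //.
  have := ker_ultrametric Habs nX nA nM; rewrite k1 k2.
  by rmax_lra.
- by move=> e; move: lt; rewrite -e (kerC _ (ell abs _)) k1; lra.
Qed.

Lemma ballm_of_ker A (r : R) X : is_berk abs A -> is_berk abs X ->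
  (forall r', 0 < r' < 1 -> exists M, Q_at A r' M) -> 0 < r <= 1 ->
  ker abs (ell abs X) (ell abs A) < r -> ballm abs A r X.
Proof.
move=> bA bX exM r01 lt; case: (Rlt_dec r 1) => r1.
  by left; split=> //; apply: ball_lt_of_ker => //; apply: exM; lra.
right; split; first lra.
have k0 := ker_ge0 Habs (ell abs A) (ell_norm Habs bX).
(* A ball of radius [1] is the union of the smaller ones; any radius strictly between the kernel and
   [1] puts [X] into one of them. *)
exists ((ker abs (ell abs X) (ell abs A) + 1) / 2); split; first lra.
by apply: ball_lt_of_ker => //; [apply: exM; lra | lra].
Qed.

Lemma unit_form_shear b u v : abs b <= 1 -> unit_form abs u v ->
  unit_form abs u (u * b + v)%ring.
Proof.
move=> b1 uv; have [u1 v1] := unit_form_le uv.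
have u0 := abs_ge0 Habs u; have b0 := abs_ge0 Habs b.
have ub : abs (u * b)%ring <= abs u by rewrite absM //; nra.
have le : abs (u * b + v)%ring <= Rmax (abs (u * b)%ring) (abs v) := absD Habs _ _.
have ge : abs v <= Rmax (abs (u * b + v)%ring) (abs (u * b)%ring).
  by rewrite -{1}(addKr (u * b)%ring v) addrC; exact: absB.
by move: uv le ge; rewrite /unit_form; rmax_lra.
Qed.

Lemma Q_at_typeI b (r : R) : abs b <= 1 -> 0 < r < 1 ->
  Q_at (typeI abs b) r (Some (gauss_at abs b r)).
Proof.
move=> b1 r01.
have bM : is_berk abs (Some (gauss_at abs b r)) by apply: gauss_at_seminorm => //; lra.
have nM := ell_norm Habs bM; have nA := ell_norm Habs (typeI_berk Habs b).
have ellM u v : ell abs (Some (gauss_at abs b r)) u v = Rmax (abs u * r) (abs (u * b + v)%ring).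
  rewrite /ell gauss_at_lin ?gauss_at_X //; try lra.
  have -> : Rmax 1 (Rmax r (abs b)) = 1 by rmax_lra.
  by field.
split=> //.
have ge : r <= ker abs (ell abs (Some (gauss_at abs b r))) (ell abs (Some (gauss_at abs b r))).
  apply: ker_diag_ge => // u v uv; rewrite ellM.
  apply: Rmax_eq1_mul_le; last lra.
  exact: unit_form_shear.
have ub : unit_form abs 1%ring (- b)%ring by apply: unit_form1; rewrite ?absN.
have le : ker abs (ell abs (typeI abs b)) (ell abs (Some (gauss_at abs b r))) <= r.
  apply: Rle_trans (ker_le Habs _ nA ub) _.
  rewrite ellM ell_typeI mul1r subrr abs0 // abs1 //.
  by rewrite /Rdiv Rmult_0_l; rmax_lra.
have := ker_diag_le_ker Habs (ell abs (typeI abs b)) nM.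
by rewrite (kerC _ (ell abs (Some _))); lra.
Qed.

Lemma Q_at_binv A (r : R) M : is_berk abs A -> Q_at A r M -> Q_at (binv abs A) r (binv abs M).
Proof.
move=> bA [bM [k1 k2]]; split; first exact: binv_berk.
have nA := ell_norm Habs bA; have nM := ell_norm Habs bM.
by rewrite !(ell_binv Habs) // (ker_swap Habs _ nA) (ker_swap Habs _ nM).
Qed.

Lemma classical_binv b : classical_point abs (binv abs (typeI abs b)).
Proof.
have bt := typeI_berk Habs b.
have [b0|b0] := eqVneq b 0%ring.
  left; rewrite /binv /phi_act /=; case: Req_EM_T => //.
  by rewrite /Peval hornerX b0 abs0.
right; exists b^-1%ring; apply: (ell_inj Habs); first exact: binv_berk.
  exact: typeI_berk.
rewrite ell_binv //; apply: functional_extensionality => u.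
apply: functional_extensionality => v; rewrite /swap !ell_typeI.
have := @abs_homogenise K abs Habs 1%ring b u v b0.
by rewrite mul1r mulr1 abs1 // => ->; rewrite addrC.
Qed.

Lemma ker_typeI_le x b : is_seminorm abs x -> abs b <= 1 ->
  ker abs (ell abs (Some x)) (ell abs (typeI abs b)) <= x ('X - b%:P)%ring.
Proof.
move=> sx b1; have nx := @ell_norm K abs Habs (Some x) sx.
have ub : unit_form abs 1%ring (- b)%ring by apply: unit_form1; rewrite ?absN.
apply: Rle_trans (ker_le Habs _ nx ub) _.
rewrite ell_sub ell_typeI mul1r subrr abs0 // /Rdiv Rmult_0_l.
have x0 := sn_ge0 sx ('X - b%:P)%ring; have m1 := Rmax1_ge1 (x 'X%ring).
have mi : / Rmax 1 (x 'X%ring) <= 1 by rewrite -[X in _ <= X]Rinv_1; apply: Rinv_le_contravar; lra.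
have mi0 : 0 < / Rmax 1 (x 'X%ring) by apply: Rinv_0_lt_compat; lra.
by apply: Rmax_lub => //; nra.
Qed.

(** Non-surjectivity on a ball in the affine coordinate, a form that applies alike to the pair [f],
    [g] and to the reversed pair. *)
Definition misses f g (b : K) (r : R) : Prop :=
  exists Y, is_berk abs Y /\
    forall x, is_seminorm abs x -> x ('X - b%:P)%ring < r -> phi_act abs f g (Some x) <> Y.

Lemma B0set_misses f g (r : R) b : B0set abs f g r -> abs b <= 1 -> misses f g b r.
Proof.
move=> [r01 h] b1.
have [|Y [bY hY]] := h (typeI abs b); first by right; exists b.
exists Y; split=> // x sx xb; apply: hY => //; apply: ballm_of_ker => //.
- exact: typeI_berk.
- by move=> r' r'01; exists (Some (gauss_at abs b r')); exact: Q_at_typeI.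
- exact: Rle_lt_trans (ker_typeI_le sx b1) xb.
Qed.

Lemma B0set_misses_rev f g (d : nat) (r : R) b :
  g != 0%ring -> coprimep f g -> d = (maxn (size f) (size g)).-1 ->
  B0set abs f g r -> abs b <= 1 -> misses (rev_poly d f) (rev_poly d g) b r.
Proof.
move=> g0 cop dE [r01 h] b1; have bt := typeI_berk Habs b.
have [Y [bY hY]] := h (binv abs (typeI abs b)) (classical_binv b).
exists Y; split=> // x sx xb; rewrite -(phi_act_binv Habs g0 cop dE sx).
apply: hY; first exact: (@binv_berk K abs Habs (Some x)).
apply: ballm_of_ker => //.
- exact: binv_berk.
- exact: (@binv_berk K abs Habs (Some x)).
- move=> r' r'01; exists (binv abs (Some (gauss_at abs b r'))).
  by apply: Q_at_binv => //; exact: Q_at_typeI.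
- rewrite !(ell_binv Habs) // (ker_swap Habs _ (@ell_norm K abs Habs (Some x) sx)).
  exact: Rle_lt_trans (ker_typeI_le sx b1) xb.
Qed.

End Balls.
(** * A missed point gives a missed classical point *)

Section UltraLimit.
Variables (T : Type) (U : (T -> Prop) -> Prop).
Hypothesis ultraU : @filter.UltraFilter T U.

Let properU : filter.ProperFilter U := filter.ultra_proper.

Lemma ultra_and (A B C : T -> Prop) : U A -> U B -> (forall c, A c -> B c -> C c) -> U C.
Proof.
move=> uA uB ABC; have F := @filter.filter_filter _ _ properU.
apply: (@filter.filterS _ _ F _ C _ (@filter.filterI _ _ F _ _ uA uB)).
by move=> c [a b]; exact: ABC.
Qed.

Lemma ultra_sub (A C : T -> Prop) : U A -> (forall c, A c -> C c) -> U C.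
Proof. by move=> uA sAC; apply: (ultra_and uA uA) => c ? _; exact: sAC. Qed.

Lemma ultra_inhabited (A : T -> Prop) : U A -> exists c, A c.
Proof.
move=> uA; apply: NNPP => nex; apply: (@filter.filter_not_empty _ U properU).
by apply: (ultra_sub uA) => c Ac; case: nex; exists c.
Qed.

Definition ucvg (p : T -> R) (l : R) : Prop :=
  forall eps, 0 < eps -> U (fun c => Rabs (p c - l) < eps).

(** The limit is the supremum of the [q] that lie below [p] on a set of [U]. The ultrafilter
    property turns a failed lower bound into an upper bound valid on a set of [U]. *)
Lemma ucvg_exists (p : T -> R) (B : R) : (forall c, 0 <= p c <= B) -> exists l, ucvg p l.
Proof.
move=> pB; pose S (q : R) := U (fun c => q <= p c).
have [l [ubl lubl]] : {l | is_lub S l}.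
  apply: completeness.
    by exists B => q /ultra_inhabited [c qc]; have := pB c; lra.
  exists 0; apply: (@ultra_sub (fun _ => True)) => [|c _]; last by have := pB c; lra.
  exact: (@filter.filterT _ _ (@filter.filter_filter _ _ properU)).
exists l => eps e0.
have [q [uq lq]] : exists q, S q /\ l - eps < q.
  apply: NNPP => nex; have : l <= l - eps; last lra.
  by apply: lubl => q Sq; apply: Rnot_lt_le => lt; apply: nex; exists q.
case: (filter.in_ultra_setVsetC (fun c => l + eps / 2 <= p c) ultraU) => [uA|uA].
  by have := ubl _ uA; lra.
apply: (ultra_and uq uA) => c qc /= nle.
by apply: Rabs_def1; [apply: Rnot_le_lt => ?; apply: nle; lra | lra].
Qed.

(** The maximum is there for the ultrametric inequality; equal or constant [p] and [q] specialise it
    to the monotonicity that yields bounds and uniqueness. *)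
Lemma ucvg_le (p q s : T -> R) (l m n : R) : ucvg p l -> ucvg q m -> ucvg s n ->
  (forall c, s c <= Rmax (p c) (q c)) -> n <= Rmax l m.
Proof.
move=> cp cq cs le; apply: Rnot_lt_le => lt.
pose e := (n - Rmax l m) / 2.
have e0 : 0 < e by rewrite /e; lra.
have := ultra_and (cp e e0) (cq e e0) (C := fun c => Rabs (p c - l) < e /\ Rabs (q c - m) < e).
move=> /(_ (fun _ a b => conj a b)) upq.
have [c [[/Rabs_def2 h1 /Rabs_def2 h2] /Rabs_def2 h3]] := ultra_inhabited
  (ultra_and upq (cs e e0) (C := fun c => (Rabs (p c - l) < e /\ Rabs (q c - m) < e) /\
     Rabs (s c - n) < e) (fun _ a b => conj a b)).
have := le c; have := Rmax_l l m; have := Rmax_r l m.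
by move: h1 h2 h3 lt; rewrite /e; rmax_lra.
Qed.

Lemma ucvg_const (l : R) : ucvg (fun _ => l) l.
Proof.
move=> e e0; apply: (@ultra_sub (fun _ => True)) => [|c _]; last by rewrite Rminus_diag Rabs_R0.
exact: (@filter.filterT _ _ (@filter.filter_filter _ _ properU)).
Qed.

Lemma ucvg_unique (p : T -> R) (l m : R) : ucvg p l -> ucvg p m -> l = m.
Proof.
move=> cl cm; apply: Rle_antisym.
- by have := @ucvg_le p p p m m l cm cm cl (fun c => Rmax_l _ _); rewrite Rmax_left; lra.
- by have := @ucvg_le p p p l l m cl cl cm (fun c => Rmax_l _ _); rewrite Rmax_left; lra.
Qed.

Lemma ucvg_mul (p q : T -> R) (l m : R) : ucvg p l -> ucvg q m ->
  ucvg (fun c => p c * q c) (l * m).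
Proof.
move=> cp cq e e0.
have D0 : 0 < Rabs l + Rabs m + 2 by have := Rabs_pos l; have := Rabs_pos m; lra.
pose dl := Rmin 1 (e / (Rabs l + Rabs m + 2)).
have d0 : 0 < dl by apply: Rmin_pos; [lra | apply: Rdiv_lt_0_compat].
have d1 : dl <= 1 by exact: Rmin_l.
have d2 : dl * (Rabs l + Rabs m + 2) <= e.
  have ee : e / (Rabs l + Rabs m + 2) * (Rabs l + Rabs m + 2) = e by field; lra.
  rewrite -[X in _ <= X]ee.
  by apply: Rmult_le_compat_r; [lra | exact: Rmin_r].
apply: (ultra_and (cp dl d0) (cq dl d0)) => c hp hq.
have -> : p c * q c - l * m = (p c - l) * (q c - m) + (l * (q c - m) + m * (p c - l)) by ring.
apply: Rle_lt_trans (Rabs_triang _ _) _.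
have t2 := Rabs_triang (l * (q c - m)) (m * (p c - l)).
move: t2; rewrite !Rabs_mult.
have := Rabs_pos l; have := Rabs_pos m; have := Rabs_pos (p c - l); have := Rabs_pos (q c - m).
by move=> *; nra.
Qed.

Lemma ucvg_ext (p q : T -> R) (l : R) : (forall c, p c = q c) -> ucvg p l -> ucvg q l.
Proof. by move=> pq cp e e0; apply: (ultra_sub (cp e e0)) => c; rewrite pq. Qed.

End UltraLimit.

Section Missed.
Variables (K : closedFieldType) (abs : K -> R).
Hypothesis Habs : nonarch_complete_abs abs.
Implicit Types (x y : {poly K} -> R) (f g h k : {poly K}) (a b c u v z : K).

Lemma abs_gt1_exists : exists c, 1 < abs c.
Proof.
have [c [c0 c1]] := abs_nontrivial Habs.
case: (Rlt_dec 1 (abs c)) => lt; first by exists c.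
have cn : c != 0%ring by apply/eqP => e; apply: c0; rewrite e abs0.
exists c^-1%ring; rewrite absV // -[X in X < _]Rinv_1.
have := abs_gt0 Habs cn => ?.
by apply: Rinv_lt_contravar; lra.
Qed.

(** Roots of high order of an element of absolute value above [1]: algebraic closedness supplies the
    roots and nontriviality the element. *)
Lemma abs_near1_exists (q : R) : 1 < q -> exists c, 1 < abs c < q.
Proof.
move=> q1; have [c c1] := abs_gt1_exists.
have [|N hN] := Pow_x_infinity q _ (abs c + 1); first by rewrite Rabs_right; lra.
have {hN} := hN N.+1 (PeanoNat.Nat.le_succ_diag_r N).
have qp : 0 < q ^ N.+1 by apply: pow_lt; lra.
rewrite Rabs_right => [qN|]; last lra.
have /closed_rootP [z] : size ('X^(N.+1) - c%:P)%ring != 1%N by rewrite size_XnsubC.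
rewrite rootE hornerD hornerN hornerC hornerXn subr_eq0 => /eqP zc.
have az : abs z ^ N.+1 = abs c by rewrite -absX // zc.
exists z; split; apply: Rnot_le_lt => le.
- have : abs z ^ N.+1 <= 1 ^ N.+1 by apply: pow_incr; split=> //; exact: abs_ge0.
  by rewrite pow1 az; lra.
- have : q ^ N.+1 <= abs z ^ N.+1 by apply: pow_incr; lra.
  by rewrite az; lra.
Qed.

(** Powers of a [c] with [1 < abs c < (s + e) / s] cannot jump over the interval. Multiplying [s] by
    [abs c ^ m] makes it exceed [1], so the first exponent beyond it is a successor; division by
    [c ^+ m] undoes the shift. *)
Lemma abs_dense_pos (s e : R) : 0 < s -> 0 < e -> exists c, s < abs c < s + e.
Proof.
move=> s0 e0; have q1 : 1 < (s + e) / s.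
  by apply: (Rmult_lt_reg_r s) => //; rewrite /Rdiv Rmult_assoc Rinv_l; lra.
have [c [c1 cq]] := abs_near1_exists q1.
have csq : abs c * s < s + e.
  have -> : s + e = (s + e) / s * s by field; lra.
  exact: Rmult_lt_compat_r.
have cn : c != 0%ring by apply/eqP => z; move: c1; rewrite z abs0 //; lra.
have pinf (B : R) : exists n, B < abs c ^ n.
  have [|N hN] := Pow_x_infinity (abs c) _ (B + 1); first by rewrite Rabs_right; lra.
  exists N; have := hN N (le_n N).
  by rewrite Rabs_right; [lra | apply/Rle_ge/pow_le; lra].
have [m hm] := pinf (/ s).
have sm : 1 < s * abs c ^ m.
  have e1 : s * / s = 1 by field; lra.
  by rewrite -[X in X < _]e1; exact: Rmult_lt_compat_l.
pose Pk n := if Rlt_dec (s * abs c ^ m) (abs c ^ n) then true else false.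
have exk : exists n, Pk n.
  by have [n hn] := pinf (s * abs c ^ m); exists n; rewrite /Pk; case: Rlt_dec.
case: (ex_minnP exk) => -[|n] Pn minn.
  by move: Pn; rewrite /Pk; case: Rlt_dec => //= lt; lra.
have lt : s * abs c ^ m < abs c ^ n.+1 by move: Pn; rewrite /Pk; case: Rlt_dec.
have ge : abs c ^ n <= s * abs c ^ m.
  apply: Rnot_lt_le => lt'; have : Pk n by rewrite /Pk; case: Rlt_dec.
  by move/minn; rewrite ltnn.
have cm : 0 < abs c ^ m by apply: pow_lt; lra.
exists (c ^+ n.+1 / c ^+ m)%ring.
rewrite absM // absV ?expf_neq0 // !absX //.
split.
- apply: (Rmult_lt_reg_r (abs c ^ m)) => //.
  by rewrite Rmult_assoc Rinv_l; lra.
- apply: (Rmult_lt_reg_r (abs c ^ m)) => //.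
  rewrite Rmult_assoc Rinv_l ?Rmult_1_r; last lra.
  apply: Rle_lt_trans (Rmult_lt_compat_r _ _ _ cm csq).
  by rewrite Rmult_assoc /=; apply: Rmult_le_compat_l; lra.
Qed.

Lemma abs_dense (s e : R) : 0 <= s -> 0 < e -> exists c, s < abs c < s + e.
Proof.
move=> s0 e0; case: (Req_dec s 0) => [->|sn]; last by apply: abs_dense_pos; lra.
have [||c hc] := @abs_dense_pos (e / 2) (e / 2); try lra.
by exists c; lra.
Qed.

Lemma sn_list_min y (s : seq K) :
  exists k : K, forall c, c \in s -> y ('X - k%:P)%ring <= y ('X - c%:P)%ring.
Proof.
elim: s => [|c s [k hk]]; first by exists 0%ring.
case: (Rle_dec (y ('X - k%:P)%ring) (y ('X - c%:P)%ring)) => le.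
- by exists k => c'; rewrite inE => /orP[/eqP ->|/hk].
- exists c => c'; rewrite inE => /orP[/eqP ->|/hk]; first lra.
  by move=> h; apply: Rle_trans h; lra.
Qed.

Lemma gap_exists (s e : R) (l : seq K) (F : K -> R) : 0 < e ->
  exists eta, 0 < eta <= e /\ forall c, c \in l -> F c <= s \/ s + eta <= F c.
Proof.
move=> e0; elim: l => [|c l [eta [eta0 h]]]; first by exists e; split; [lra|].
case: (Rle_dec (F c) s) => le.
- by exists eta; split=> // c'; rewrite inE => /orP[/eqP ->|/h]; [left|].
- exists (Rmin eta (F c - s)); split.
    by split; [apply: Rmin_pos; lra | apply: Rle_trans (Rmin_l _ _) _; lra].
  move=> c'; rewrite inE => /orP[/eqP ->|/h[?|?]]; [right|by left|right].
  + by have := Rmin_r eta (F c - s); lra.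
  + by have := Rmin_l eta (F c - s); lra.
Qed.

(** Take [k] in the list with [y] at [T - k] minimal and move away from it by a [w] slightly larger
    than this value. The gap keeps [abs w] different from every [abs (k - z)], so the distance from
    [w + k] to [z] is the larger of the two. *)
Lemma classical_points_dense y (s : seq K) (e : R) : is_seminorm abs y -> 0 < e ->
  exists c, forall z, z \in s -> Rabs (abs (c - z)%ring - y ('X - z%:P)%ring) < e.
Proof.
move=> sy e0; have [k kmin] := sn_list_min y s.
have [eta [eta0 gap]] := @gap_exists (y ('X - k%:P)%ring) e s (fun z => abs (k - z)%ring) e0.
have y0 := sn_ge0 sy ('X - k%:P)%ring.
have [|w [w1 w2]] := @abs_dense (y ('X - k%:P)%ring) eta y0; first lra.
exists (w + k)%ring => z zs.
have kz := kmin z zs.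
have yz := sn_XsubC_le Habs sy z k; have kz2 := abs_sub_le_sn Habs sy k z.
have zk := absBC Habs k z.
have e1 : ((w + k) - z = w + (k - z))%ring by kring.
have e2 : ((w + k) - z = (k - z) + w)%ring by kring.
have w0 : w != 0%ring by apply/eqP => we; move: w1; rewrite we abs0 //; lra.
case: (gap z zs) => gz.
- have -> : abs ((w + k) - z)%ring = abs w by rewrite e1; apply: absD_eq => //; apply: Rle_lt_trans gz w1.
  by apply: Rabs_def1; move: yz kz2; rmax_lra.
- have -> : abs ((w + k) - z)%ring = abs (k - z)%ring.
    by rewrite e2; apply: absD_eq => //; apply: Rlt_le_trans w2 gz.
  by apply: Rabs_def1; move: yz kz2; rmax_lra.
Qed.

(** By density, the sets of classical points approximating [y] on finitely many linear polynomials
    generate a proper filter; an ultrafilter refining it converges to [y] on all of them. *)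
Lemma ultrafilter_at y : is_seminorm abs y ->
  exists U, @filter.UltraFilter K U /\
    forall z, ucvg U (fun c => abs (c - z)%ring) (y ('X - z%:P)%ring).
Proof.
move=> sy.
pose F (A : K -> Prop) := exists (s : seq K) (e : R), 0 < e /\ forall c : K,
  (forall z, z \in s -> Rabs (abs (c - z)%ring - y ('X - z%:P)%ring) < e) -> A c.
have FF : filter.ProperFilter F.
  split; first by move=> [s [e [e0 h]]]; have [c /h] := @classical_points_dense y s e sy e0.
  split.
  - by exists [::], 1; split; [lra|].
  - move=> A B [s [e [e0 hA]]] [s' [e' [e0' hB]]].
    exists (s ++ s'), (Rmin e e'); split; first exact: Rmin_pos.
    move=> c hc; split; [apply: hA | apply: hB] => z zs.
    + by apply: Rlt_le_trans (hc z _) (Rmin_l _ _); rewrite mem_cat zs.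
    + by apply: Rlt_le_trans (hc z _) (Rmin_r _ _); rewrite mem_cat zs orbT.
  - move=> A B AB [s [e [e0 hA]]]; exists s, e; split=> // c hc.
    exact/AB/hA.
have [U [uU FU]] := filter.ultraFilterLemma FF.
exists U; split=> // z e e0; apply: FU; exists [:: z], e; split=> // c.
by apply; rewrite inE.
Qed.

(* If all classical points were hit from the disc [|z - b| <= r'], an ultrafilter
   limit of the preimages of classical points tending to the missed point would be
   a preimage of the missed point. *)
Lemma missed_classical f g b (r r' : R) :
  (forall x, is_seminorm abs x -> 0 < Rmax (x f) (x g)) ->
  misses abs f g b r -> r' < r ->
  exists u v, unit_form abs u v /\
    forall z, abs (z - b)%ring <= r' -> ((u *: f + v *: g).[z] <> 0)%ring.
Proof.
move=> pos [Y [bY missY]] r'r; apply: NNPP => nex.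
have hit u v : unit_form abs u v ->
    exists z, abs (z - b)%ring <= r' /\ ((u *: f + v *: g).[z] = 0)%ring.
  move=> uv; apply: NNPP => nz; apply: nex; exists u, v; split=> // z zb e.
  by apply: nz; exists z.
case: Y bY missY => [y|] bY missY; last first.
  have [z [zb gz]] := hit _ _ (unit_form01 Habs).
  have sz := sn_eval Habs z.
  apply: (missY _ sz); first by rewrite hornerXsubC; exact: Rle_lt_trans zb r'r.
  rewrite /phi_act; case: Req_EM_T => //.
  by move: gz; rewrite scale0r add0r scale1r => ->; rewrite abs0.
have hitc c : exists z, abs (z - b)%ring <= r' /\ (f.[z] = c * g.[z])%ring.
  have [|e [e0 [_ uv]]] := @unit_form_scale K abs Habs 1%ring (- c)%ring.
    by rewrite oner_neq0.
  have [z [zb hz]] := hit _ _ uv; exists z; split=> //.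
  move: hz; rewrite !hornerE => /(congr1 (fun t => e * t)%ring).
  rewrite mulr0 => hz; apply/eqP; rewrite -subr_eq0 -hz; apply/eqP; kfield.
  exact: e0.
pose w c := epsilon (inhabits 0%ring)
  (fun z => abs (z - b)%ring <= r' /\ (f.[z] = c * g.[z])%ring).
have wP c : abs (w c - b)%ring <= r' /\ (f.[w c] = c * g.[w c])%ring.
  exact: (epsilon_spec (inhabits 0%ring) (fun z => abs (z - b)%ring <= r' /\
    (f.[z] = c * g.[z])%ring) (hitc c)).
have [U [uU cU]] := ultrafilter_at bY.
(* The limit of the chosen preimages [w c]. The limits exist because the Gauss norm of the disc of
   radius [r'] bounds the values. *)
pose X h := epsilon (inhabits 0) (ucvg U (fun c => abs (h.[w c])%ring)).
have XP h : ucvg U (fun c => abs (h.[w c])%ring) (X h).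
  apply: (epsilon_spec (inhabits 0)); apply: (ucvg_exists uU (B := gauss_at abs b r' h)) => c.
  split; first exact: abs_ge0.
  apply: (sn_le_gauss_at Habs h (sn_eval Habs (w c))).
  by rewrite hornerXsubC; case: (wP c).
have sX : is_seminorm abs X.
  split.
    move=> h; have := @ucvg_le K U uU _ _ _ _ _ _ (XP h) (XP h) (ucvg_const uU 0).
    rewrite Rmax_left; last lra; apply=> c.
    by apply: Rle_trans (Rmax_l _ _); exact: abs_ge0.
  split.
    move=> h k; apply: (ucvg_unique uU (XP _)).
    apply: (ucvg_ext uU) (ucvg_mul uU (XP h) (XP k)) => c.
    by rewrite /Pmul hornerM absM.
  split.
    move=> h k; apply: (ucvg_le uU (XP h) (XP k) (XP _)) => c.
    by rewrite /Padd hornerD; exact: absD.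
  move=> c; apply: (ucvg_unique uU (XP _)).
  by apply: (ucvg_ext uU) (ucvg_const uU (abs c)) => e; rewrite /Pconst hornerC.
(* Only a weak inequality survives the limit; the margin between [r'] and [r] makes it strict. *)
have Xb : X ('X - b%:P)%ring < r.
  apply: Rle_lt_trans r'r.
  have := @ucvg_le K U uU _ _ _ _ _ _ (ucvg_const uU r') (ucvg_const uU r') (XP ('X - b%:P)%ring).
  rewrite Rmax_left; last lra; apply=> c.
  by rewrite hornerXsubC; case: (wP c).
apply: (missY _ sX Xb).
(* At [w c] one has [f = c g], so the combination is [(u c + v) g] there, and [abs (u c + v)] tends
   to the value of [y]. *)
have lin u v : X (u *: f + v *: g)%ring = y (u *: 'X + v%:P)%ring * X g.
  apply: (ucvg_unique uU (XP _)).
  have cl : ucvg U (fun c => abs (u * c + v)%ring) (y (u *: 'X + v%:P)%ring).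
    have [->|u0] := eqVneq u 0%ring.
      rewrite lin0 (snC bY); apply: (ucvg_ext uU) (ucvg_const uU (abs v)) => c.
      by rewrite mul0r add0r.
    have [e ue] := lin_root v u0; rewrite (sn_lin bY ue).
    apply: (ucvg_ext uU) (ucvg_mul uU (ucvg_const uU (abs u)) (cU e)) => c.
    by rewrite -absM // mulrBr ue opprK.
  apply: (ucvg_ext uU) (ucvg_mul uU cl (XP g)) => c.
  by rewrite !hornerE -absM // (proj2 (wP c)) mulrDl mulrA.
have Xf : X f = y 'X%ring * X g.
  by have := lin 1%ring 0%ring; rewrite polyC0 addr0 !scale1r scale0r addr0.
have Xg : 0 < X g.
  have := pos _ sX; have := sn_ge0 sX g => g0 p.
  case: (Req_dec (X g) 0) => [e|]; last lra.
  by move: p; rewrite Xf e Rmult_0_r; rmax_lra.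
have [bp ep] := phi_act_Some Habs sX (pos _ sX).
apply: (ell_inj Habs) => //; rewrite ep.
apply: functional_extensionality => u; apply: functional_extensionality => v.
rewrite /hnorm lin Xf /=.
have -> : Rmax (y 'X%ring * X g) (X g) = X g * Rmax 1 (y 'X%ring).
  rewrite -RmaxRmult; last lra.
  by rewrite Rmax_comm Rmult_1_r (Rmult_comm (X g)).
have := Rmax1_ge1 (y 'X%ring) => ?.
by field; lra.
Qed.

End Missed.
(** * The Lipschitz bound along Gauss points *)

Lemma pow_lt_near (a b t : R) (m n : nat) : a * t ^ m < b * t ^ n ->
  exists eta, 0 < eta /\ forall s, Rabs (s - t) < eta -> a * s ^ m < b * s ^ n.
Proof.
move=> lt; pose F (s : R) := b * s ^ n - a * s ^ m.
have cF : continuity_pt F t by apply: derivable_continuous_pt; rewrite /F; reg.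
have Ft : 0 < F t by rewrite /F; lra.
have [eta [eta0 h]] := cF (F t) Ft.
exists eta; split=> // s hs.
case: (Req_dec s t) => [->|st]; first lra.
have : Rabs (F s - F t) < F t.
  by apply: (h s); split=> //; split=> //; exact: nesym.
by move=> /Rabs_def2 []; rewrite /F; lra.
Qed.

(** The threshold is the root [a] with [a ^ n = A]. For [t >= a] use [y <= 1]; for [t < a] the
    quotient [c * t ^ (n - 1)] is at most [c * A / a]. *)
Lemma div_le_root (A y c t : R) (n : nat) : 0 < A -> 0 < t -> leq 1 n -> 0 <= y <= 1 ->
  y = c * t ^ n -> c * A <= 1 -> y / t <= / Rpower A (/ INR n).
Proof.
move=> A0 t0 n1 y01 ye cA.
have a0 : 0 < Rpower A (/ INR n) by exact: exp_pos.
have an := pow_root A0 n1; move: (Rpower _ _) a0 an => a a0 an.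
case: (Rle_dec a t) => at_.
  apply: (Rle_trans _ (1 * / t)).
    by apply: Rmult_le_compat_r; [apply/Rlt_le/Rinv_0_lt_compat | lra].
  by rewrite Rmult_1_l; apply: Rinv_le_contravar; lra.
case: n n1 ye an => // n _ ye an.
have -> : y / t = c * t ^ n by rewrite ye /=; field; lra.
apply: (Rmult_le_reg_r a) => //; rewrite Rinv_l; last lra.
have an0 : 0 < a ^ n by apply: pow_lt.
have tn : t ^ n <= a ^ n by apply: pow_incr; lra.
have tn0 : 0 < t ^ n by apply: pow_lt.
have c0 : 0 <= c.
  apply: Rnot_lt_le => c0.
  by have : 0 < t ^ n.+1; [apply: pow_lt | nra].
have -> : c * t ^ n * a = c * a * t ^ n by ring.
apply: Rle_trans cA; rewrite -an /=.
have -> : c * (a * a ^ n) = c * a * a ^ n by ring.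
by apply: Rmult_le_compat_l => //; apply: Rmult_le_pos; lra.
Qed.

Section Monomials.
Variables (q P s t : R) (i n : nat).
Hypothesis st : 0 < s <= t.
Hypothesis q0 : 0 < q.
Hypothesis P0 : 0 <= P.

Lemma monomial_ratio_up (w : R) : 0 < w -> P * w ^ (i + n)%N / (q * w ^ i) = P / q * w ^ n.
Proof.
move=> w0; have : 0 < w ^ i by apply: pow_lt.
by rewrite pow_add => ?; field; lra.
Qed.

Lemma monomial_ratio_down (w : R) : 0 < w -> P * w ^ i / (q * w ^ (i + n)%N) = P / q * / w ^ n.
Proof.
move=> w0; have : 0 < w ^ i by apply: pow_lt.
have : 0 < w ^ n by apply: pow_lt.
by rewrite pow_add => ? ?; field; lra.
Qed.

Let Pq : 0 <= P / q.
Proof. by apply: Rmult_le_pos => //; apply/Rlt_le/Rinv_0_lt_compat. Qed.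

Lemma monomial_incr :
  P * s ^ (i + n)%N / (q * s ^ i) <= P * t ^ (i + n)%N / (q * t ^ i).
Proof.
rewrite !monomial_ratio_up; try lra.
by apply: Rmult_le_compat_l => //; apply: pow_incr; lra.
Qed.

Lemma monomial_decr :
  P * t ^ i / (q * t ^ (i + n)%N) <= P * s ^ i / (q * s ^ (i + n)%N).
Proof.
rewrite !monomial_ratio_down; try lra.
apply: Rmult_le_compat_l => //; apply: Rinv_le_contravar; first by apply: pow_lt; lra.
by apply: pow_incr; lra.
Qed.

(** The quotient is a constant times a pure power, which is convex, so its steepest slope is at an
    end point: at [t] here, at [s] for the negative exponent of [monomial_down]. *)
Lemma monomial_up :
  P * t ^ (i + n)%N / (q * t ^ i) - P * s ^ (i + n)%N / (q * s ^ i) <=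
  INR n * (P * t ^ (i + n)%N / (q * t ^ i) / t) * (t - s).
Proof.
rewrite !monomial_ratio_up; try lra.
have -> : INR n * (P / q * t ^ n / t) * (t - s) = P / q * (INR n * (t ^ n / t) * (t - s)).
  by rewrite /Rdiv; ring.
by rewrite -Rmult_minus_distr_l; apply: Rmult_le_compat_l => //; exact: pow_sub_le.
Qed.

Lemma monomial_down :
  P * s ^ i / (q * s ^ (i + n)%N) - P * t ^ i / (q * t ^ (i + n)%N) <=
  INR n * (P * s ^ i / (q * s ^ (i + n)%N) / s) * (t - s).
Proof.
rewrite !monomial_ratio_down; try lra.
have -> : INR n * (P / q * / s ^ n / s) * (t - s) = P / q * (INR n * (/ s ^ n / s) * (t - s)).
  by rewrite /Rdiv; ring.
by rewrite -Rmult_minus_distr_l; apply: Rmult_le_compat_l => //; exact: inv_pow_sub_le.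
Qed.

End Monomials.

(* [P], [Q], [H] are the absolute values of the coefficients of [p], [g] and of the
   zero-free combination [u p + v g]; [a = |u|] and [b = |v|]. *)
Lemma slope_bound (P Q H : nat -> R) (a b A M1 M L r t : R) (i j n d : nat) :
  (forall k, 0 <= P k) -> (forall k, 0 <= Q k) -> (forall k, 0 <= H k) ->
  0 <= a -> 0 <= b -> Rmax a b = 1 ->
  (forall k, H k <= Rmax (a * P k) (b * Q k)) ->
  (forall k, a * P k <= Rmax (H k) (b * Q k)) ->
  (forall k, b * Q k <= Rmax (H k) (a * P k)) ->
  P i = 0 ->
  (forall k, H k * r ^ k <= H O) ->
  0 < M -> Q i * t ^ i = M -> (forall k, Q k * t ^ k <= M) ->
  (forall k, P k * t ^ k <= P j * t ^ j) -> P j * t ^ j <= M ->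
  0 < A -> A * M1 <= H O -> P j <= M1 -> Q i <= M1 ->
  0 < t -> 0 < r -> leq 1 n -> leq n d -> i = (j + n)%N \/ j = (i + n)%N ->
  INR d / r <= L -> (forall k, leq 1 k -> leq k d -> INR k / Rpower A (/ INR k) <= L) ->
  INR n * (P j * t ^ j / M / t) <= L.
Proof.
move=> P0 Q0 H0 a0 b0 ab h1 h2 h3 Pi Hr M0 Qi Qk Pk Pj A0 AM PM QM t0 r0 n1 nd ij dr Lk.
set y := P j * t ^ j / M.
have y0 : 0 <= y.
  apply: Rmult_le_pos; last by apply/Rlt_le/Rinv_0_lt_compat.
  by apply: Rmult_le_pos => //; apply: pow_le; lra.
have y1 : y <= 1.
  apply: (Rmult_le_reg_r M) => //.
  by have -> : y * M = P j * t ^ j; [rewrite /y; field; lra | lra].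
have nn := pos_INR n; have ndR := le_nat_INR nd.
(* For [r <= t] the diameter [y] of the image is at most [1], so the slope is at most [d / r]. *)
case: (Rle_dec r t) => rt.
  apply: Rle_trans dr.
  apply: (Rle_trans _ (INR n * (1 / r))).
    apply: Rmult_le_compat_l => //; apply: Rmult_le_compat => //.
      by apply/Rlt_le/Rinv_0_lt_compat.
    by apply: Rinv_le_contravar.
  rewrite /Rdiv Rmult_1_l; apply: Rmult_le_compat_r => //.
  by apply/Rlt_le/Rinv_0_lt_compat.
apply: Rle_trans (Lk n n1 nd); apply: Rmult_le_compat_l => //.
have Qi0 : 0 < Q i.
  case: (Req_dec (Q i) 0) => [e|]; last by have := Q0 i; lra.
  by move: Qi; rewrite e Rmult_0_l; lra.
have M10 : 0 < M1 by lra.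
have HO : 0 < H O by apply: Rlt_le_trans AM; apply: Rmult_lt_0_compat.
have tk k : 0 < t ^ k by apply: pow_lt.
have rk k : 0 < r ^ k by apply: pow_lt.
have trk k : leq 1 k -> t ^ k < r ^ k.
  move=> k1; apply: Rnot_le_lt => le.
  by have := pow_le_inv (Rlt_le _ _ t0) k1 le; lra.
have Hlt k : leq 1 k -> H k * t ^ k < H O.
  move=> k1; have := Hr k; have := trk k k1; have := H0 k.
  case: (Req_dec (H k) 0) => [->|hk]; first by rewrite !Rmult_0_l.
  by move=> ? ? ?; nra.
have bQ k : b * (Q k * t ^ k) <= b * M by apply: Rmult_le_compat_l.
(* For [i = 0] the vanishing of [P 0] leaves [H 0 <= Q 0]. The lower bound on [H 0] thus becomes one
   on the dominant coefficient, and [P j / Q i * A <= 1]. *)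
case: (posnP i) => i0.
  have jn : j = n.
    case: ij => [e|->]; last by rewrite i0.
    by move: n1; rewrite -(leq_add2l j) addn1 -e i0.
  apply: (@div_le_root A y (P j / Q i)) => //.
  - by rewrite /y jn -Qi i0 /=; field; rewrite -i0; lra.
  - have HQ : H O <= Q i.
      have := h1 O; move: Pi; rewrite i0 => ->; rewrite Rmult_0_r.
      have := Q0 O; move: ab; rmax_lra; nra.
    apply: (Rmult_le_reg_r (Q i)) => //.
    have -> : P j / Q i * A * Q i = A * P j by field; lra.
    by nra.
(* For [i > 0], [P i = 0] gives [b * Q i <= H i], and inside the radius [r] every higher term of the
   zero-free combination is strictly below its constant term. *)
have bM : b * M < H O.
  have e : b * M = b * Q i * t ^ i by rewrite -Qi; ring.
  have := h3 i; rewrite Pi Rmult_0_r Rmax_left // => le.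
  rewrite e; apply: Rle_lt_trans (Hlt i i0).
  exact: Rmult_le_compat_r (Rlt_le _ _ (tk i)) le.
(* [b = 1] would give [M < H 0], although the constant terms of [p] and [g] are at most [M]. *)
have a1 : a = 1.
  have hO := h1 O; have qO := Qk O; have pO := Pk O; rewrite /= !Rmult_1_r in qO pO.
  have PO0 := P0 O.
  move: ab; rewrite {1}/Rmax; case: Rle_dec => // ab' b1; rewrite b1 !Rmult_1_l in hO bM.
  have aP : a * P O <= 1 * P O by apply: Rmult_le_compat_r => //; lra.
  by move: hO; rmax_lra.
have PO : P O = H O.
  have := h1 O; have := h2 O; have := h3 O; rewrite a1 !Rmult_1_l.
  have := bQ O; rewrite /= !Rmult_1_r.
  by move: bM; rmax_lra.
(* Since the terms of [b g] stay below [H 0], [p] inherits a strictly dominant constant term from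
   the zero-free combination. *)
have j0 : j = O.
  case: (posnP j) => // j1.
  have := Pk O; rewrite PO /= Rmult_1_r => le.
  have := h2 j; rewrite a1 Rmult_1_l => le2.
  have : P j * t ^ j <= Rmax (H j * t ^ j) (b * (Q j * t ^ j)).
    have -> : b * (Q j * t ^ j) = b * Q j * t ^ j by ring.
    rewrite !(Rmult_comm _ (t ^ j)) RmaxRmult; last exact: Rlt_le.
    by apply: Rmult_le_compat_l; [exact: Rlt_le | ].
  by have := bQ j; have := Hlt j j1; move: bM; rmax_lra.
have inn : i = n.
  case: ij => [->|e]; first by rewrite j0.
  by move: i0; rewrite -[i]add0n; move: e; rewrite j0; case: (i).
(* Here [y] decreases like [t ^ (- n)], so a lower bound on [t] is needed:
   [A * Q n <= A * M1 <= P 0 <= Q n * t ^ n]. It makes [c = y / t ^ n] admissible in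
   [div_le_root]. *)
have ge : A <= t ^ n.
  apply: (Rmult_le_reg_r (Q i)) => //.
  have : P j * t ^ j <= M by [].
  rewrite j0 PO /= Rmult_1_r -Qi inn => le.
  apply: (Rle_trans _ (H O)); last lra.
  by apply: Rle_trans AM; rewrite inn in QM; nra.
apply: (@div_le_root A y (y / t ^ n)) => //.
  by field; apply: Rgt_not_eq; exact: tk.
apply: (Rmult_le_reg_r (t ^ n)) => //.
have -> : y / t ^ n * A * t ^ n = y * A by field; apply: Rgt_not_eq; exact: tk.
by have := tk n; nra.
Qed.

Section Core.
Variables (K : closedFieldType) (abs : K -> R).
Hypothesis Habs : nonarch_complete_abs abs.
Implicit Types (x y : {poly K} -> R) (f g h p : {poly K}) (a b c u v z : K).

Lemma gauss_sn (t : R) : 0 <= t -> is_seminorm abs (gauss abs t).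
Proof.
move=> t0; split; first by move=> h; exact: gauss_ge0.
split; first by move=> h k; exact: gaussM.
split; first by move=> h k; exact: gaussD.
by move=> c; exact: gaussC.
Qed.

Lemma hnorm_norm f g x : is_seminorm abs x -> 0 < Rmax (x f) (x g) ->
  form_norm abs (hnorm f g x).
Proof.
move=> sx pos; rewrite /hnorm.
have im : 0 < / Rmax (x f) (x g) by apply: Rinv_0_lt_compat.
split; first by move=> u v; apply: Rmult_le_pos; [apply: (sn_ge0 sx) | lra].
split.
  by move=> c u v; rewrite -Rmult_assoc -(snZ sx) scalerDr !scalerA.
split.
  move=> u v u' v'.
  have -> : ((u + u') *: f + (v + v') *: g)%ring = ((u *: f + v *: g) + (u' *: f + v' *: g))%ring.
    by rewrite !scalerDl addrACA.
  rewrite /Rdiv !(Rmult_comm _ (/ Rmax _ _)) RmaxRmult; last lra.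
  by apply: Rmult_le_compat_l; [lra | apply: (snD sx)].
rewrite !scale1r !scale0r addr0 add0r.
rewrite /Rdiv !(Rmult_comm _ (/ Rmax _ _)) RmaxRmult; last lra.
by rewrite Rinv_l; lra.
Qed.

Lemma hnorm_swap f g x : hnorm g f x = swap (hnorm f g x).
Proof.
apply: functional_extensionality => u; apply: functional_extensionality => v.
by rewrite /hnorm /swap addrC Rmax_comm.
Qed.

(** All that one centre contributes to the slope bound. It is symmetric in [f] and [g], so that the
    pieces on which [f] dominates follow by exchanging the two. *)
Definition core_data f g (d : nat) (us vs : K) (G r L : R) : Prop :=
  [/\ (size f <= d.+1)%N /\ (size g <= d.+1)%N,
      (forall x, is_seminorm abs x -> 0 < Rmax (x f) (x g)),
      0 < G /\ (forall u v, unit_form abs u v ->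
        G * Rmax (gauss abs 1 f) (gauss abs 1 g) <= gauss abs 1 (u *: f + v *: g)%ring),
      0 < r <= 1 /\ unit_form abs us vs /\
        (forall j, abs ((us *: f + vs *: g)`_j)%ring * r ^ j <= abs ((us *: f + vs *: g)`_0)%ring) &
      INR d / r <= L /\ (forall n, leq 1 n -> leq n d ->
        INR n / Rpower (G * r ^ d) (/ INR n) <= L)].

Lemma core_data_swap f g d us vs (G r L : R) :
  core_data f g d us vs G r L -> core_data g f d vs us G r L.
Proof.
move=> [[sf sg] pos [G0 hG] [r01 [uv hs]] hL]; split=> //.
- by move=> x sx; rewrite Rmax_comm; exact: pos.
- split=> // u v uv'; rewrite Rmax_comm addrC; apply: hG; exact: unit_formC.
- split=> //; split; first exact: unit_formC.
  by move=> j; rewrite (addrC (vs *: g)%ring).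
Qed.

Section Dominant.
Variables (f g : {poly K}) (i : nat).
Hypothesis pos : forall x, is_seminorm abs x -> 0 < Rmax (x f) (x g).

Definition dominant (t : R) : Prop :=
  gauss abs t g = abs (g`_i)%ring * t ^ i /\ gauss abs t f <= gauss abs t g.

(** [c] and [p] depend on [i] but not on [t]: a single change of coordinate on the target serves the
    whole piece on which [i] is dominant. *)
Let c : K := (f`_i / g`_i)%ring.
Let p : {poly K} := (f - c *: g)%ring.
Let y (t : R) : R := gauss abs t p / (abs (g`_i)%ring * t ^ i).

Lemma dominant_gt0 t : 0 < t -> dominant t -> 0 < gauss abs t g /\ (g`_i != 0)%ring.
Proof.
move=> t0 [e le].
have g0 : 0 < gauss abs t g.
  by have := pos (gauss_sn (Rlt_le _ _ t0)); rewrite Rmax_right.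
split=> //; apply/eqP => gi; move: g0; rewrite e gi abs0 // Rmult_0_l; lra.
Qed.

Lemma dominant_c t : 0 < t -> dominant t -> abs c <= 1.
Proof.
move=> t0 dt; have [g0 gi] := dominant_gt0 t0 dt; have [e le] := dt.
have ti : 0 < t ^ i by apply: pow_lt.
have fi := gauss_ge Habs t f i.
have gi0 := abs_gt0 Habs gi.
rewrite /c absM // absV //; apply: (Rmult_le_reg_r (abs (g`_i)%ring)) => //.
rewrite Rmult_assoc Rinv_l ?Rmult_1_r ?Rmult_1_l; last by apply: Rgt_not_eq; exact: gi0.
apply: (Rmult_le_reg_r (t ^ i)) => //.
by apply: Rle_trans fi _; apply: Rle_trans le _; rewrite e; apply: Rle_refl.
Qed.

Lemma coef_p t : 0 < t -> dominant t -> (p`_i = 0)%ring.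
Proof.
move=> t0 dt; have [_ gi] := dominant_gt0 t0 dt.
by rewrite /p coefB coefZ /c divfK // subrr.
Qed.

Lemma comb_p u v : (u *: f + v *: g = u *: p + (u * c + v) *: g)%ring.
Proof. by rewrite /p scalerBr scalerA scalerDl addrA subrK. Qed.

Lemma gauss_p_le t : 0 < t -> dominant t -> gauss abs t p <= gauss abs t g.
Proof.
move=> t0 dt; have c1 := dominant_c t0 dt; have [_ le] := dt.
have sx := gauss_sn (Rlt_le _ _ t0).
have -> : p = (1 *: f + (- c) *: g)%ring by rewrite scale1r scaleNr.
apply: (sn_comb_le Habs sx) => //; last exact: Rle_refl.
- by rewrite abs1 //; exact: Rle_refl.
- by rewrite absN.
Qed.

(** As [p] has no coefficient of index [i], the dominant term of [v g] survives in the sum and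
    cannot be cancelled by [u p]. *)
Lemma gauss_comb t u v : 0 < t -> dominant t ->
  gauss abs t (u *: p + v *: g)%ring = Rmax (abs u * gauss abs t p) (abs v * gauss abs t g).
Proof.
move=> t0 dt; have sx := gauss_sn (Rlt_le _ _ t0); have [e _] := dt.
have pi := coef_p t0 dt.
have ge : abs v * gauss abs t g <= gauss abs t (u *: p + v *: g)%ring.
  have := gauss_ge Habs t (u *: p + v *: g)%ring i.
  by rewrite coefD !coefZ pi mulr0 add0r absM // Rmult_assoc -e.
have le : gauss abs t (u *: p + v *: g)%ring <=
    Rmax (abs u * gauss abs t p) (abs v * gauss abs t g).
  by apply: Rle_trans (snD sx _ _) _; rewrite !(snZ sx); exact: Rle_refl.
have le2 : abs u * gauss abs t p <=
    Rmax (gauss abs t (u *: p + v *: g)%ring) (abs v * gauss abs t g).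
  rewrite -!(snZ sx) -{1}(addrK (v *: g)%ring (u *: p)%ring).
  exact: (snB Habs sx).
by move: le le2; rmax_lra.
Qed.

Lemma dominant_mul_gt0 t : 0 < t -> dominant t -> 0 < abs (g`_i)%ring * t ^ i.
Proof. by move=> t0 dt; have [h _] := dominant_gt0 t0 dt; have [<- _] := dt. Qed.

Lemma y_bounds t : 0 < t -> dominant t -> 0 <= y t <= 1.
Proof.
move=> t0 dt; have m0 := dominant_mul_gt0 t0 dt; have le := gauss_p_le t0 dt.
have [e _] := dt; rewrite e in le; have p0 := gauss_ge0 abs t p.
split; first by apply: Rmult_le_pos => //; apply/Rlt_le/Rinv_0_lt_compat.
apply: (Rmult_le_reg_r (abs (g`_i)%ring * t ^ i)) => //.
by rewrite /y /Rdiv Rmult_assoc Rinv_l; lra.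
Qed.

(** The right side is the norm of [zeta_{c, y t}], a disc inside the unit disc. *)
Lemma hnorm_dominant t u v : 0 < t -> dominant t ->
  hnorm f g (gauss abs t) u v = Rmax (abs u * y t) (abs (u * c + v)%ring).
Proof.
move=> t0 dt; have m0 := dominant_mul_gt0 t0 dt; have [e le] := dt.
rewrite /hnorm comb_p gauss_comb // (Rmax_right _ _ le) e /y.
set m := abs _ * t ^ i in m0 *.
have mi : 0 <= / m by apply/Rlt_le/Rinv_0_lt_compat.
rewrite /Rdiv (Rmult_comm (Rmax _ _)) -RmaxRmult //; congr Rmax; first by ring.
by field; lra.
Qed.

Lemma ker_dominant_ge t : 0 < t -> dominant t ->
  y t <= ker abs (hnorm f g (gauss abs t)) (hnorm f g (gauss abs t)).
Proof.
move=> t0 dt; have sx := gauss_sn (Rlt_le _ _ t0).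
apply: (ker_diag_ge Habs) => [|u v uv]; first by apply: hnorm_norm => //; exact: pos.
rewrite hnorm_dominant //; apply: Rmax_eq1_mul_le; last exact: y_bounds.
exact: unit_form_shear (dominant_c t0 dt) uv.
Qed.

(** The images are concentric discs: the form [X - c Z] bounds the mixed kernel by the larger
    radius, and the diagonal kernels are at least the two radii. *)
Lemma form_dist_dominant s t : 0 < s -> 0 < t -> dominant s -> dominant t ->
  form_dist abs (hnorm f g (gauss abs s)) (hnorm f g (gauss abs t)) <= Rabs (y s - y t).
Proof.
move=> s0 t0 ds dt; have c1 := dominant_c s0 ds.
have ns : form_norm abs (hnorm f g (gauss abs s)).
  by apply: hnorm_norm; [apply: gauss_sn; lra | apply: pos; apply: gauss_sn; lra].
have nt : form_norm abs (hnorm f g (gauss abs t)).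
  by apply: hnorm_norm; [apply: gauss_sn; lra | apply: pos; apply: gauss_sn; lra].
have uc : unit_form abs 1%ring (- c)%ring by apply: unit_form1; rewrite ?absN.
have := ker_le Habs (hnorm f g (gauss abs t)) ns uc.
rewrite !hnorm_dominant // mul1r subrr abs0 // abs1 // !Rmult_1_l.
have [ys0 _] := y_bounds s0 ds; have [yt0 _] := y_bounds t0 dt.
rewrite !(Rmax_left _ 0) //.
have := ker_dominant_ge s0 ds; have := ker_dominant_ge t0 dt.
rewrite /form_dist /Rabs; case: Rcase_abs => ?; rmax_lra.
Qed.

Section Slope.
Variables (d : nat) (us vs : K) (G r L : R).
Hypothesis cd : core_data f g d us vs G r L.

Lemma y_slope t j n : 0 < t <= 1 -> dominant t -> gauss abs t p = abs (p`_j)%ring * t ^ j ->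
  leq 1 n -> leq i d -> leq j d -> i = (j + n)%N \/ j = (i + n)%N -> INR n * (y t / t) <= L.
Proof.
move=> [t0 t1] dt pj n1 id jd ij.
have [g0 gi] := dominant_gt0 t0 dt; have [e le] := dt; have c1 := dominant_c t0 dt.
case: cd => _ _ [G0 hG] [[r0 r1] [uvs hs]] [Ld Ln].
have m0 := dominant_mul_gt0 t0 dt.
(* The zero-free combination in terms of [p] and [g]; the form stays a unit form because
   [abs c <= 1]. *)
pose v' : K := (us * c + vs)%ring.
have uv' : unit_form abs us v' by exact: unit_form_shear.
have sx := gauss_sn (Rlt_le _ _ t0).
have s1 := gauss_sn (Rlt_le _ _ Rlt_0_1).
pose H k := abs ((us *: f + vs *: g)`_k)%ring.
have He k : ((us *: f + vs *: g)`_k = us * p`_k + v' * g`_k)%ring.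
  by rewrite comb_p coefD !coefZ.
pose M1 := Rmax (gauss abs 1 f) (gauss abs 1 g).
have rd : 0 < r ^ d by apply: pow_lt.
have A0 : 0 < G * r ^ d by apply: Rmult_lt_0_compat.
have M10 : 0 < M1 by exact: pos.
have gle k : abs (g`_k)%ring <= M1.
  apply: Rle_trans (Rmax_r _ _); have := gauss_ge Habs 1 g k.
  by rewrite pow1 Rmult_1_r.
have ple k : abs (p`_k)%ring <= M1.
  apply: (Rle_trans _ (gauss abs 1 p)).
    by have := gauss_ge Habs 1 p k; rewrite pow1 Rmult_1_r.
  have -> : p = (1 *: f + (- c) *: g)%ring by rewrite scale1r scaleNr.
  apply: (sn_comb_le Habs s1).
  - by rewrite abs1 //; exact: Rle_refl.
  - by rewrite absN.
  - exact: Rmax_l.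
  - exact: Rmax_r.
(* For [k <= d] and [r <= 1] the zero-free bound weakens to [H k * r ^ d <= H O], so the Gauss norm
   of the combination is at most [H O / r ^ d]. *)
have AM : G * r ^ d * M1 <= H O.
  have hsz : (size (us *: f + vs *: g)%ring <= d.+1)%N.
    case: cd => [[sf sg] _ _ _ _].
    apply: leq_trans (size_polyD _ _) _; rewrite geq_max.
    by rewrite !(leq_trans (size_scale_leq _ _)).
  have H0 : 0 <= H O by exact: abs_ge0.
  have hle : gauss abs 1 (us *: f + vs *: g)%ring <= H O / r ^ d.
    apply: gauss_le; first by apply: Rmult_le_pos => //; apply/Rlt_le/Rinv_0_lt_compat.
    move=> k; rewrite pow1 Rmult_1_r.
    case: (leqP k d) => kd; last first.
      rewrite nth_default; last exact: leq_trans hsz kd.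
      by rewrite abs0 //; apply: Rmult_le_pos => //; apply/Rlt_le/Rinv_0_lt_compat.
    apply: (Rmult_le_reg_r (r ^ d)) => //.
    have -> : H O / r ^ d * r ^ d = H O by field; lra.
    apply: Rle_trans (hs k); apply: Rmult_le_compat_l; first exact: abs_ge0.
    rewrite -(subnKC kd) pow_add -{2}[r ^ k]Rmult_1_r.
    apply: Rmult_le_compat_l; first by apply: pow_le; lra.
    by rewrite -(pow1 (d - k)%N); apply: pow_incr; lra.
  have := hG _ _ uvs; rewrite -/M1 => h1.
  have h2 : G * M1 <= H O / r ^ d by lra.
  have -> : G * r ^ d * M1 = G * M1 * r ^ d by ring.
  have e2 : H O / r ^ d * r ^ d = H O by field; lra.
  by rewrite -[X in _ <= X]e2; apply: Rmult_le_compat_r; lra.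
rewrite /y pj.
apply: (@slope_bound (fun k => abs (p`_k)%ring) (fun k => abs (g`_k)%ring) H
  (abs us) (abs v') (G * r ^ d) M1 (abs (g`_i)%ring * t ^ i) L r t i j n d) => //.
- by move=> k; exact: abs_ge0.
- by move=> k; exact: abs_ge0.
- by move=> k; exact: abs_ge0.
- exact: abs_ge0.
- exact: abs_ge0.
- by move=> k; rewrite /H He -!absM //; exact: absD.
- move=> k; rewrite /H He -!absM // -{1}(addrK (v' * g`_k)%ring (us * p`_k)%ring).
  exact: absB.
- move=> k; rewrite /H He -!absM // -{1}(addKr (us * p`_k)%ring (v' * g`_k)%ring) addrC.
  exact: absB.
- by rewrite (coef_p t0 dt) abs0.
- by move=> k; rewrite -e; exact: gauss_ge.
- by move=> k; rewrite -pj; exact: gauss_ge.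
- by rewrite -pj -e; exact: gauss_p_le.
- case: ij => ij; first by apply: leq_trans id; rewrite ij leq_addl.
  by apply: leq_trans jd; rewrite ij leq_addl.
Qed.

Lemma size_p : (size p <= d.+1)%N.
Proof.
case: cd => [[sf sg] _ _ _ _].
apply: leq_trans (size_polyD _ _) _; rewrite geq_max sf /= size_polyN.
exact: leq_trans (size_scale_leq _ _) sg.
Qed.

Lemma y_ge q k : 0 < q -> dominant q -> abs (p`_k)%ring * q ^ k / (abs (g`_i)%ring * q ^ i) <= y q.
Proof.
move=> q0 dq; apply: Rmult_le_compat_r; last exact: gauss_ge.
by apply/Rlt_le/Rinv_0_lt_compat; exact: dominant_mul_gt0.
Qed.

(** Follow the monomial that attains [y] at the end point with the larger value; at the other end it
    is still a lower bound for [y]. Either it is monotone in the harmless direction, or [y_slope]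
    bounds its slope at the end point where it attains [y], so the breakpoints of [y] need not be
    located. *)
Lemma y_lipschitz s t : 0 < s <= t -> t <= 1 -> dominant s -> dominant t -> leq i d ->
  Rabs (y s - y t) <= L * (t - s).
Proof.
move=> [s0 st] t1 ds dt id; have t0 : 0 < t by lra.
have L0 : 0 <= L.
  case: cd => _ _ _ [[r0 _] _] [Ld _]; apply: Rle_trans Ld.
  by apply: Rmult_le_pos; [exact: pos_INR | apply/Rlt_le/Rinv_0_lt_compat].
have gi0 : 0 < abs (g`_i)%ring by apply: abs_gt0 => //; have [] := dominant_gt0 s0 ds.
have LL : 0 <= L * (t - s) by apply: Rmult_le_pos; lra.
have sp k : 0 < s ^ k by apply: pow_lt.
have tp k : 0 < t ^ k by apply: pow_lt.
have pz q : 0 < q -> dominant q -> gauss abs q p = abs (p`_i)%ring * q ^ i -> y q = 0.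
  by move=> q0 dq; rewrite (coef_p q0 dq) abs0 // Rmult_0_l /y => ->; rewrite /Rdiv Rmult_0_l.
have y0s := proj1 (y_bounds s0 ds); have y0t := proj1 (y_bounds t0 dt).
have deg q : 0 <= q -> exists2 j, gauss abs q p = abs (p`_j)%ring * q ^ j & leq j d.
  move=> q0; have [j e js] := gauss_attained Habs p q0; exists j => //.
  by apply: leq_trans js _; rewrite -ltnS; have := size_p; case: (size p).
apply: Rabs_le; split.
- have [j ej jd] := deg t (Rlt_le _ _ t0).
  suff : y t - y s <= L * (t - s) by lra.
  have [ji|ij|ji] := ltngtP j i; last by rewrite (pz t) -?ji //; lra.
  + have ie : i = (j + (i - j))%N by rewrite subnKC // ltnW.
    suff : y t <= y s by lra.
    apply: Rle_trans (y_ge j s0 ds); rewrite /y ej.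
    have := @monomial_decr (abs (g`_i)%ring) (abs (p`_j)%ring) s t j (i - j) (conj s0 st) gi0
      (abs_ge0 Habs _).
    by rewrite -ie.
  + have je : j = (i + (j - i))%N by rewrite subnKC // ltnW.
    have sl : INR (j - i)%N * (y t / t) <= L.
      by apply: (@y_slope t j) => //; [rewrite subn_gt0 | right].
    apply: (Rle_trans _ (INR (j - i)%N * (y t / t) * (t - s))); last first.
      by apply: Rmult_le_compat_r; lra.
    apply: (Rle_trans _ (y t - abs (p`_j)%ring * s ^ j / (abs (g`_i)%ring * s ^ i))).
      by have := y_ge j s0 ds; lra.
    rewrite /y ej.
    have := @monomial_up (abs (g`_i)%ring) (abs (p`_j)%ring) s t i (j - i) (conj s0 st) gi0
      (abs_ge0 Habs _).
    by rewrite -je.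
- have [j ej jd] := deg s (Rlt_le _ _ s0).
  have [ji|ij|ji] := ltngtP j i; last by rewrite (pz s) -?ji //; lra.
  + have ie : i = (j + (i - j))%N by rewrite subnKC // ltnW.
    have sl : INR (i - j)%N * (y s / s) <= L.
      by apply: (@y_slope s j) => //; [lra | rewrite subn_gt0 | left].
    apply: (Rle_trans _ (INR (i - j)%N * (y s / s) * (t - s))); last first.
      by apply: Rmult_le_compat_r; lra.
    apply: (Rle_trans _ (y s - abs (p`_j)%ring * t ^ j / (abs (g`_i)%ring * t ^ i))).
      by have := y_ge j t0 dt; lra.
    rewrite /y ej.
    have := @monomial_down (abs (g`_i)%ring) (abs (p`_j)%ring) s t j (i - j) (conj s0 st) gi0
      (abs_ge0 Habs _).
    by rewrite -ie.
  + have je : j = (i + (j - i))%N by rewrite subnKC // ltnW.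
    suff : y s <= y t by lra.
    apply: Rle_trans (y_ge j t0 dt); rewrite /y ej.
    have := @monomial_incr (abs (g`_i)%ring) (abs (p`_j)%ring) s t i (j - i) (conj s0 st) gi0
      (abs_ge0 Habs _).
    by rewrite -je.
Qed.

Lemma form_dist_dominant_le s t : 0 < s <= t -> t <= 1 -> dominant s -> dominant t ->
  leq i d -> form_dist abs (hnorm f g (gauss abs s)) (hnorm f g (gauss abs t)) <= L * (t - s).
Proof.
move=> st t1 ds dt id; apply: Rle_trans (form_dist_dominant _ _ ds dt) _; try lra.
exact: y_lipschitz.
Qed.

End Slope.

Lemma ker_gauss1_gt0_dominant : f <> (c *: g)%ring -> dominant 1 ->
  0 < ker abs (hnorm f g (gauss abs 1)) (hnorm f g (gauss abs 1)).
Proof.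
move=> fc d1; have d0 := Rlt_0_1.
apply: Rlt_le_trans (ker_dominant_ge d0 d1); apply: Rdiv_lt_0_compat; last first.
  exact: dominant_mul_gt0.
have [k pk] : exists k : nat, (p`_k != 0)%ring.
  exists (size p).-1; rewrite -/(lead_coef p) lead_coef_eq0 subr_eq0.
  exact/eqP.
apply: Rlt_le_trans (gauss_ge Habs 1 p k); rewrite pow1 Rmult_1_r.
exact: abs_gt0.
Qed.

End Dominant.

Lemma dominant_of_coef f g (i : nat) (t : R) : 0 <= t ->
  (forall k : nat, abs (f`_k)%ring * t ^ k <= abs (g`_i)%ring * t ^ i) ->
  (forall k : nat, abs (g`_k)%ring * t ^ k <= abs (g`_i)%ring * t ^ i) -> dominant f g i t.
Proof.
move=> t0 hf hg.
have m0 : 0 <= abs (g`_i)%ring * t ^ i by apply: Rmult_le_pos; [exact: abs_ge0 | exact: pow_le].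
have e : gauss abs t g = abs (g`_i)%ring * t ^ i.
  by apply: Rle_antisym; [exact: gauss_le | exact: gauss_ge].
by split=> //; rewrite e; exact: gauss_le.
Qed.

Lemma dominant_cases f g (d : nat) (t : R) : 0 <= t ->
  (size f <= d.+1)%N -> (size g <= d.+1)%N ->
  exists2 i : nat, leq i d &
  ((forall k : nat, abs (f`_k)%ring * t ^ k <= abs (g`_i)%ring * t ^ i) /\
   (forall k : nat, abs (g`_k)%ring * t ^ k <= abs (g`_i)%ring * t ^ i)) \/
  ((forall k : nat, abs (f`_k)%ring * t ^ k <= abs (f`_i)%ring * t ^ i) /\
   (forall k : nat, abs (g`_k)%ring * t ^ k <= abs (f`_i)%ring * t ^ i)).
Proof.
move=> t0 sf sg.
have bd h (j : nat) : (size h <= d.+1)%N -> leq j (size h).-1 -> leq j d.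
  by move=> sh js; apply: leq_trans js _; rewrite -ltnS; case: (size h) sh.
case: (Rle_dec (gauss abs t f) (gauss abs t g)) => le.
- have [i e isz] := gauss_attained Habs g t0; exists i; first exact: bd isz.
  left; rewrite -e; split=> k; last exact: gauss_ge.
  by apply: Rle_trans (gauss_ge Habs t f k) le.
- have [i e isz] := gauss_attained Habs f t0; exists i; first exact: bd isz.
  right; rewrite -e; split=> k; first exact: gauss_ge.
  by apply: Rle_trans (gauss_ge Habs t g k) _; lra.
Qed.

Lemma form_dist_gauss_le f g d us vs (G r L s t : R) : core_data f g d us vs G r L ->
  0 < s <= t -> t <= 1 ->
  form_dist abs (hnorm f g (gauss abs s)) (hnorm f g (gauss abs t)) <= L * (t - s).
Proof.
move=> cd [s0 st] t1; have [[sf sg] pos _ _ _] := cd.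
(* One piece for each choice of the larger of [g] and [f] and of its maximal term. Stated
   coefficientwise, the conditions are inequalities between monomials, hence closed. *)
pose C (bi : bool * 'I_d.+1) (q : R) :=
  (forall k : nat, abs (f`_k)%ring * q ^ k <= abs ((if bi.1 then g else f)`_(bi.2))%ring * q ^ bi.2) /\
  (forall k : nat, abs (g`_k)%ring * q ^ k <= abs ((if bi.1 then g else f)`_(bi.2))%ring * q ^ bi.2).
(* The covering lemma asks for the triangle inequality on all of [R], while Gauss norms need a
   nonnegative radius; hence [Rabs]. *)
pose D (q q' : R) := form_dist abs (hnorm f g (gauss abs (Rabs q))) (hnorm f g (gauss abs (Rabs q'))).
have nq (q : R) : form_norm abs (hnorm f g (gauss abs (Rabs q))).
  have sq := gauss_sn (Rabs_pos q); apply: hnorm_norm => //; exact: pos.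
have -> : form_dist abs (hnorm f g (gauss abs s)) (hnorm f g (gauss abs t)) = D s t.
  by rewrite /D !Rabs_right //; lra.
apply: (@lipschitz_of_closed_cover _ C D L (index_enum _)) => //.
- move=> bi q nC.
  have cl (h : {poly K}) : ~ (forall k : nat, abs (h`_k)%ring * q ^ k <=
        abs ((if bi.1 then g else f)`_(bi.2))%ring * q ^ bi.2) ->
      exists eta, 0 < eta /\ forall s, Rabs (s - q) < eta ->
        ~ (forall k : nat, abs (h`_k)%ring * s ^ k <=
        abs ((if bi.1 then g else f)`_(bi.2))%ring * s ^ bi.2).
    move=> /not_all_ex_not [k /Rnot_le_lt /pow_lt_near [eta [eta0 near]]].
    exists eta; split=> // q' /near lt /(_ k).
    exact: Rlt_not_le.
  case: (not_and_or _ _ nC) => /cl [eta [eta0 near]]; exists eta; split=> // q' /near nq' [];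
    by move=> *; exact: nq'.
- by move=> q1 q2 q3; apply: form_dist_triangle.
- move=> [bb i] q1 q2 [/= hf1 hg1] [/= hf2 hg2] q12 q2t; rewrite /D !Rabs_right; try lra.
  have id : leq i d by rewrite -ltnS.
  case: bb hf1 hg1 hf2 hg2 => hf1 hg1 hf2 hg2.
  + by apply: (form_dist_dominant_le pos cd) id; try lra; apply: dominant_of_coef => //; lra.
  + have pos' x : is_seminorm abs x -> 0 < Rmax (x g) (x f) by rewrite Rmax_comm; exact: pos.
    have := @form_dist_dominant_le g f i pos' d vs us G r L (core_data_swap cd) q1 q2.
    rewrite !(hnorm_swap f g) form_dist_swap //; last first.
    * by have := nq q2; rewrite Rabs_right //; lra.
    * by have := nq q1; rewrite Rabs_right //; lra.
    by apply=> //; try lra; apply: dominant_of_coef => //; lra.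
- move=> q hq; have q0 : 0 <= q by lra.
  have [i id h] := dominant_cases q0 sf sg.
  have id' : (i < d.+1)%N by [].
  case: h => h; [exists (true, Ordinal id') | exists (false, Ordinal id')]; split=> //;
    exact: mem_index_enum.
Qed.

Lemma size_le1_of_scalar f g c : coprimep f g -> f = (c *: g)%ring ->
  (size f <= 1)%N /\ (size g <= 1)%N.
Proof.
move=> cop e; have g1 : (size g <= 1)%N.
  have gg : (g %| gcdp f g)%ring by rewrite dvdp_gcd dvdpp andbT e -mul_polyC dvdp_mull.
  move: cop; rewrite /coprimep => /eqP s1; rewrite -s1; apply: dvdp_leq => //.
  by rewrite -size_poly_eq0 s1.
by split=> //; rewrite e; exact: leq_trans (size_scale_leq _ _) g1.
Qed.

(** Coprime polynomials that are not both constant are not proportional, so [p] is nonzero and the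
    image of the Gauss point has positive diameter. *)
Lemma ker_gauss1_gt0 f g (d : nat) : coprimep f g -> d = (maxn (size f) (size g)).-1 ->
  leq 1 d -> 0 < ker abs (hnorm f g (gauss abs 1)) (hnorm f g (gauss abs 1)).
Proof.
move=> cop dE d1.
have pos x : is_seminorm abs x -> 0 < Rmax (x f) (x g) by move=> sx; exact: (sn_coprime_gt0 Habs sx cop).
have pos' x : is_seminorm abs x -> 0 < Rmax (x g) (x f) by rewrite Rmax_comm; exact: pos.
have big : ~ ((size f <= 1)%N /\ (size g <= 1)%N).
  by move=> [f1 g1]; move: d1; rewrite dE; case: (size f) f1 => [|[]] //; case: (size g) g1 => [|[]].
have nz (p q : {poly K}) (c : K) : (p = f /\ q = g) \/ (p = g /\ q = f) -> p <> (c *: q)%ring.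
  case=> -[-> ->] e; apply: big; first exact: size_le1_of_scalar e.
  by rewrite coprimep_sym in cop; have [] := size_le1_of_scalar cop e.
have [i id [[hf hg]|[hf hg]]] := @dominant_cases f g d 1 Rle_0_1 (size_f_le dE) (size_g_le dE).
- apply: (@ker_gauss1_gt0_dominant f g i) => //; first by apply: nz; left.
  by apply: dominant_of_coef => //; lra.
- have s1 := gauss_sn Rle_0_1.
  have n1 : form_norm abs (hnorm f g (gauss abs 1)) by apply: hnorm_norm => //; exact: pos.
  rewrite -(ker_swap Habs _ n1) -hnorm_swap.
  apply: (@ker_gauss1_gt0_dominant g f i) => //; first by apply: nz; right.
  by apply: dominant_of_coef => //; lra.
Qed.

End Core.
(** * From Gauss points to arbitrary points *)

Section Limit.
Variables (K : closedFieldType) (abs : K -> R).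
Hypothesis Habs : nonarch_complete_abs abs.
Implicit Types (x y : {poly K} -> R) (f g h p : {poly K}) (a b c u v z : K).

Lemma prod_shift_near (l : seq K) (F : K -> R) (dl : R) : 0 < dl ->
  exists eta, 0 < eta /\
    \big[Rmult/1]_(z <- l) (F z + eta) < \big[Rmult/1]_(z <- l) F z + dl.
Proof.
move=> d0; pose Phi (e : R) := \big[Rmult/1]_(z <- l) (F z + e).
have cPhi : continuity_pt Phi 0.
  rewrite /Phi; elim: l {Phi} => [|z l IH].
    have -> : (fun e : R => \big[Rmult/1]_(z <- [::]) (F z + e)) = (fun _ => 1).
      by apply: functional_extensionality => e; rewrite big_nil.
    by apply: continuity_pt_const.
  have -> : (fun e : R => \big[Rmult/1]_(z <- z :: l) (F z + e)) =
            mult_fct (fun e => F z + e) (fun e => \big[Rmult/1]_(z <- l) (F z + e)).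
    by apply: functional_extensionality => e; rewrite big_cons.
  apply: continuity_pt_mult => //; apply: derivable_continuous_pt; reg.
have P0 : Phi 0 = \big[Rmult/1]_(z <- l) F z by apply: eq_bigr => z _; rewrite Rplus_0_r.
have [eta [eta0 h]] := cPhi dl d0.
exists (eta / 2); split; first lra.
have : Rabs (Phi (eta / 2) - Phi 0) < dl.
  apply: (h (eta / 2)); split; first by split=> //; lra.
  by rewrite /= /Rdist Rminus_0_r Rabs_right; lra.
by rewrite P0 /Phi => /Rabs_def2 []; lra.
Qed.

(** On a linear factor, a disc norm of radius less than [radius x + eta] exceeds [x] by at most
    [eta]. So every seminorm, of type IV included, is a limit of Gauss norms above it. *)
Lemma gauss_at_near x h (dl : R) : is_seminorm abs x -> 0 < dl ->
  exists eta, 0 < eta /\ forall (s : R) c, radius x <= s < radius x + eta ->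
    x ('X - c%:P)%ring <= s -> gauss_at abs c s h < x h + dl.
Proof.
move=> sx d0; have [l e] := sn_factor Habs h.
set lc := abs (lead_coef h) in e; have lc0 : 0 <= lc by exact: abs_ge0.
have [|eta [eta0 near]] := @prod_shift_near l (fun z => x ('X - z%:P)%ring) (dl / (lc + 1)).
  by apply: Rdiv_lt_0_compat; lra.
exists eta; split=> // s c sr xc.
have s0 : 0 <= s by apply: Rle_trans xc; apply: (sn_ge0 sx).
have sg := gauss_at_seminorm Habs c s0.
rewrite (e _ sg) (e _ sx).
have le : \big[Rmult/1]_(z <- l) gauss_at abs c s ('X - z%:P)%ring <=
          \big[Rmult/1]_(z <- l) (x ('X - z%:P)%ring + eta).
  apply: (proj2 (@big_Rmult_le K l (fun z => gauss_at abs c s ('X - z%:P)%ring)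
    (fun z => x ('X - z%:P)%ring + eta) _)) => z.
  split; first by apply: (sn_ge0 sg).
  rewrite gauss_at_XsubC //.
  have := proj1 (radiusP sx) z; have := abs_sub_le_sn Habs sx c z.
  by rmax_lra.
have lt : lc * (dl / (lc + 1)) < dl.
  apply: (Rmult_lt_reg_r (lc + 1)); first lra.
  by have -> : lc * (dl / (lc + 1)) * (lc + 1) = lc * dl; [field; lra | nra].
apply: Rle_lt_trans (Rmult_le_compat_l _ _ _ lc0 le) _.
apply: Rle_lt_trans (Rmult_le_compat_l _ _ _ lc0 (Rlt_le _ _ near)) _.
by rewrite Rmult_plus_distr_l; lra.
Qed.

Lemma form_dist_gauss_near f g x (eps : R) : is_seminorm abs x ->
  (forall x, is_seminorm abs x -> 0 < Rmax (x f) (x g)) -> 0 < eps ->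
  exists eta, 0 < eta /\ forall (s : R) c, radius x <= s < radius x + eta ->
    x ('X - c%:P)%ring <= s ->
    form_dist abs (hnorm f g x) (hnorm f g (gauss_at abs c s)) <= eps.
Proof.
move=> sx pos e0; have m0 := pos _ sx.
have nx := hnorm_norm sx m0.
set m := Rmax _ _ in m0.
pose k0 := ker abs (hnorm f g x) (hnorm f g x).
have k01 : 0 <= k0 <= 1 by split; [exact: ker_ge0 | exact: ker_le1].
have [|u [v [uv [hw _]]]] := @ker_lt K abs Habs (hnorm f g x) (hnorm f g x) (k0 + eps / 4) nx.
  by rewrite -/k0; lra.
(* The near-minimal form costs [eps / 4] and the approximation [eps / 6] in the mixed kernel, which
   counts twice; the diagonal kernel loses [eps / 6]. In all
   [2 * (eps / 4 + eps / 6) + eps / 6 = eps]. *)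
pose dl := m * (eps / 6).
have d0 : 0 < dl by apply: Rmult_lt_0_compat; lra.
have [e1 [e10 n1]] := gauss_at_near f sx d0.
have [e2 [e20 n2]] := gauss_at_near g sx d0.
have [e3 [e30 n3]] := gauss_at_near (u *: f + v *: g)%ring sx d0.
exists (Rmin e1 (Rmin e2 e3)); split; first by do !apply: Rmin_pos.
move=> s c sr xc.
have l1 : s < radius x + e1 by have := Rmin_l e1 (Rmin e2 e3); lra.
have l2 : s < radius x + e2.
  by have := Rmin_r e1 (Rmin e2 e3); have := Rmin_l e2 e3; lra.
have l3 : s < radius x + e3.
  by have := Rmin_r e1 (Rmin e2 e3); have := Rmin_r e2 e3; lra.
have := n1 s c (conj (proj1 sr) l1) xc; have := n2 s c (conj (proj1 sr) l2) xc.
have := n3 s c (conj (proj1 sr) l3) xc.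
have s0 : 0 <= s by apply: Rle_trans xc; apply: (sn_ge0 sx).
have sN := gauss_at_seminorm Habs c s0; have mN0 := pos _ sN.
have nN := hnorm_norm sN mN0.
have xN h : x h <= gauss_at abs c s h by exact: sn_le_gauss_at.
set N := gauss_at abs c s in sN mN0 nN xN *.
set mN := Rmax (N f) (N g) in mN0 => h3 h2 h1.
have mle : m <= mN.
  by apply: Rmax_lub; [apply: Rle_trans (xN f) (Rmax_l _ _) | apply: Rle_trans (xN g) (Rmax_r _ _)].
have mlt : mN <= m + dl.
  by apply: Rmax_lub; rewrite /m; [have := Rmax_l (x f) (x g) | have := Rmax_r (x f) (x g)]; lra.
have im : 0 < / m by apply: Rinv_0_lt_compat.
have dm : dl / m = eps / 6 by rewrite /dl; field; lra.
have kx : ker abs (hnorm f g x) (hnorm f g N) <= k0 + eps / 4 + eps / 6.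
  apply: Rle_trans (ker_le Habs _ nx uv) _; apply: Rmax_lub; first lra.
  rewrite /hnorm -/mN; apply: (Rle_trans _ (N (u *: f + v *: g)%ring / m)).
    apply: Rmult_le_compat_l; first by apply: (sn_ge0 sN).
    exact: Rinv_le_contravar.
  apply: (Rle_trans _ ((x (u *: f + v *: g)%ring + dl) / m)).
    by apply: Rmult_le_compat_r; lra.
  have -> : (x (u *: f + v *: g)%ring + dl) / m = hnorm f g x u v + dl / m.
    by rewrite /hnorm -/m; field; lra.
  by lra.
have kN : k0 - eps / 6 <= ker abs (hnorm f g N) (hnorm f g N).
  apply: ker_diag_ge => // u' v' uv'.
  have hx := ker_diag_le Habs nx uv'; rewrite -/k0 /hnorm -/m in hx.
  rewrite /hnorm -/mN; apply: (Rmult_le_reg_r mN) => //.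
  have -> : N (u' *: f + v' *: g)%ring / mN * mN = N (u' *: f + v' *: g)%ring by field; lra.
  apply: Rle_trans (xN _).
  have hm : k0 * m <= x (u' *: f + v' *: g)%ring.
    have e : x (u' *: f + v' *: g)%ring / m * m = x (u' *: f + v' *: g)%ring by field; lra.
    by rewrite -e; apply: Rmult_le_compat_r; lra.
  apply: Rle_trans hm.
  have : k0 * mN <= k0 * m + dl by nra.
  have : dl <= eps / 6 * mN by rewrite /dl; nra.
  by lra.
by rewrite /form_dist -/k0; lra.
Qed.

Lemma hnorm_gauss_at f g b (t : R) :
  hnorm f g (gauss_at abs b t) =
  hnorm (f \Po ('X + b%:P))%ring (g \Po ('X + b%:P))%ring (gauss abs t).
Proof.
apply: functional_extensionality => u; apply: functional_extensionality => v.
by rewrite /hnorm /gauss_at comp_polyD !comp_polyZ.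
Qed.

Lemma sn_eq_gauss_at x b (t : R) : is_seminorm abs x -> x ('X - b%:P)%ring <= t ->
  t <= radius x -> x = gauss_at abs b t.
Proof.
move=> sx xb tr; have t0 : 0 <= t by apply: Rle_trans xb; apply: (sn_ge0 sx).
apply: (sn_ext_linear Habs) => //; first exact: gauss_at_seminorm.
move=> c; rewrite gauss_at_XsubC //.
have := proj1 (radiusP sx) c; have := sn_XsubC_le Habs sx c b.
have := abs_sub_le_sn Habs sx b c; have := absBC Habs b c.
by rmax_lra.
Qed.

Lemma abs_center_le1 x b c (t : R) : is_seminorm abs x -> abs b <= 1 -> t <= 1 ->
  x ('X - b%:P)%ring <= t -> x ('X - c%:P)%ring <= t -> abs c <= 1.
Proof.
move=> sx b1 t1 xb xc.
have := abs_sub_le_sn Habs sx b c; have := abs_sub_trans Habs c b 0%ring.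
have := absBC Habs b c; rewrite !subr0.
by rmax_lra.
Qed.

(** Replace [x] by a nearby Gauss point and go up the segment from there. The centre of that point
    depends on the precision, which is why [core_data] is required at every centre, with common
    constants. *)
Lemma form_dist_sn_gauss f g d (G r L : R) x b (t : R) :
  (forall x, is_seminorm abs x -> 0 < Rmax (x f) (x g)) ->
  (forall b, abs b <= 1 -> exists us vs,
     core_data abs (f \Po ('X + b%:P))%ring (g \Po ('X + b%:P))%ring d us vs G r L) ->
  is_seminorm abs x -> abs b <= 1 -> x ('X - b%:P)%ring <= t -> 0 < t <= 1 -> 0 <= L ->
  form_dist abs (hnorm f g x) (hnorm f g (gauss_at abs b t)) <= L * (t - radius x).
Proof.
move=> pos cd sx b1 xb [t0 t1] L0.
have radt : radius x <= t by apply: Rle_trans xb; exact: (proj1 (radiusP sx)).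
case: (Req_dec (radius x) t) => [e|ne].
  rewrite -(sn_eq_gauss_at sx xb) ?e; last lra.
  by rewrite /form_dist; lra.
apply: le_epsilon => eps e0.
have [eta [eta0 near]] := form_dist_gauss_near sx pos e0.
pose s := Rmin t (radius x + eta / 2).
have st : s <= t by exact: Rmin_l.
have se : s <= radius x + eta / 2 by exact: Rmin_r.
have rs : radius x < s by apply: Rmin_glb_lt; lra.
have rad0 := radius_ge0 sx.
have [c xc] : exists c, x ('X - c%:P)%ring <= s.
  apply: NNPP => nex; have : s <= radius x; last lra.
  apply: (proj2 (radiusP sx)) => c; apply: Rnot_lt_le => lt; apply: nex.
  by exists c; lra.
have xct : x ('X - c%:P)%ring <= t by lra.
have c1 := abs_center_le1 sx b1 t1 xb xct.
have [us [vs cdc]] := cd c c1.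
rewrite (gauss_at_eq Habs sx xb xct).
have nrm q : 0 <= q -> form_norm abs (hnorm f g (gauss_at abs c q)).
  move=> q0; have sq := gauss_at_seminorm Habs c q0; apply: hnorm_norm => //; exact: pos.
have nx : form_norm abs (hnorm f g x) by apply: hnorm_norm => //; exact: pos.
have := form_dist_triangle Habs nx (nrm s _) (nrm t _).
move=> /(_ (Rlt_le _ _ (Rle_lt_trans _ _ _ rad0 rs)) (Rlt_le _ _ t0)) tri.
have h1 : form_dist abs (hnorm f g x) (hnorm f g (gauss_at abs c s)) <= eps.
  by apply: near => //; lra.
have h2 : form_dist abs (hnorm f g (gauss_at abs c s)) (hnorm f g (gauss_at abs c t)) <= L * (t - s).
  by rewrite !hnorm_gauss_at; apply: (form_dist_gauss_le Habs cdc); lra.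
have : L * (t - s) <= L * (t - radius x) by apply: Rmult_le_compat_l; lra.
by lra.
Qed.

Lemma sn_translate x b : is_seminorm abs x ->
  is_seminorm abs (fun h => x (h \Po ('X + b%:P))%ring).
Proof.
move=> sx; split; first by move=> h; apply: (sn_ge0 sx).
split; first by move=> h k; rewrite /Pmul comp_polyM (snM sx).
split; first by move=> h k; rewrite /Padd comp_polyD; apply: (snD sx).
by move=> c; rewrite /Pconst comp_polyC (snC sx).
Qed.

(** Each factor [T - z] with [r <= abs z] has Gauss norm [abs z], which is also its absolute value
    at [0]. *)
Lemma gauss_of_zero_free h (r : R) : 0 <= r -> (forall z, root h z -> r <= abs z) ->
  gauss abs r h = abs (h`_0)%ring.
Proof.
move=> r0 zf; have [s e] := closed_field_poly_normal h.
have sg := gauss_sn Habs r0; have s0 := sn_eval Habs 0%ring.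
have rt z : z \in s -> r <= abs z.
  by move=> zs; apply: zf; rewrite e rootE hornerZ (eqP (_ : root _ z)) ?mulr0 // root_prod_XsubC.
pose E : {poly K} -> R := fun p => abs (p.[0])%ring; have sE : is_seminorm abs E := s0.
rewrite -horner_coef0 -/(E h) {1}e (snZ sg) (sn_prod Habs sg).
rewrite {2}e (snZ sE) (sn_prod Habs sE); congr (_ * _).
apply: eq_big_seq => z zs.
rewrite -lin1 gauss_lin // /E lin1 hornerXsubC sub0r absN // abs1 // Rmult_1_l.
by rewrite Rmax_right //; exact: rt.
Qed.

Lemma Rpower_le1 (G z : R) : 0 < G <= 1 -> 0 <= z -> Rpower G z <= 1.
Proof.
move=> G01 z0; rewrite /Rpower -exp_0.
have lG : ln G <= 0.
  case: (Req_dec G 1) => [->|ne]; first by rewrite ln_1; lra.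
  by rewrite -ln_1; apply/Rlt_le/ln_increasing; lra.
case: (Req_dec (z * ln G) 0) => [->|ne]; first lra.
by apply/Rlt_le/exp_increasing; nra.
Qed.

Definition lip_const (G r : R) (d : nat) : R :=
  Rmax (1 / (G * r ^ d)) (INR d / (Rpower G (1 / INR d) * r)).

Lemma lip_const_gt0 (G r : R) (d : nat) : 0 < G -> 0 < r -> 0 < lip_const G r d.
Proof.
move=> G0 r0; apply: Rlt_le_trans (Rmax_l _ _).
by apply: Rdiv_lt_0_compat; [lra | apply: Rmult_lt_0_compat => //; exact: pow_lt].
Qed.

Lemma lip_const_roots (G r : R) (d n : nat) : 0 < G <= 1 -> 0 < r <= 1 -> leq 1 n -> leq n d ->
  INR n / Rpower (G * r ^ d) (/ INR n) <= lip_const G r d.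
Proof.
move=> G01 r01 n1 nd; have d1 := leq_trans n1 nd; have dR := INR_ge1 d1.
have rd : 0 < r ^ d by apply: pow_lt; lra.
have rd1 : r ^ d <= 1 by rewrite -(pow1 d); apply: pow_incr; lra.
have A01 : 0 < G * r ^ d <= 1 by split; [apply: Rmult_lt_0_compat; lra | nra].
apply: Rle_trans (scaled_root_le A01 n1 nd) _; rewrite /lip_const; apply: Req_le.
(* The root of order [d] of [r ^ d] is [r], which gives the second term of [lip_const]. *)
congr (Rmax _ (_ / _)).
rewrite -Rpower_mult_distr; try lra.
rewrite -(Rpower_pow d); last lra.
rewrite Rpower_mult Rinv_r; last lra.
by rewrite Rpower_1; [rewrite /Rdiv Rmult_1_l | lra].
Qed.

Lemma lip_const_ge (G r : R) (d : nat) : 0 < G <= 1 -> 0 < r <= 1 -> leq 1 d ->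
  INR d / r <= lip_const G r d.
Proof.
move=> G01 r01 d1; have dR := INR_ge1 d1; apply: Rle_trans (Rmax_r _ _).
have p0 : 0 < Rpower G (1 / INR d) by exact: exp_pos.
have p1 : Rpower G (1 / INR d) <= 1.
  apply: Rpower_le1 => //; apply: Rmult_le_pos; first lra.
  by apply/Rlt_le/Rinv_0_lt_compat; lra.
apply: Rmult_le_compat_l; first lra.
apply: Rinv_le_contravar; first by apply: Rmult_lt_0_compat; lra.
by nra.
Qed.

Lemma core_data_of_misses f g d (G r r' : R) b :
  (size f <= d.+1)%N -> (size g <= d.+1)%N -> leq 1 d ->
  (forall x, is_seminorm abs x -> 0 < Rmax (x f) (x g)) ->
  0 < G -> G = ker abs (hnorm f g (gauss_norm abs)) (hnorm f g (gauss_norm abs)) ->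
  0 < r' <= 1 -> r' < r -> misses abs f g b r -> abs b <= 1 ->
  exists us vs, core_data abs (f \Po ('X + b%:P))%ring (g \Po ('X + b%:P))%ring d us vs G r'
    (lip_const G r' d).
Proof.
move=> sf sg d1 pos G0 GE r01 r'r mis b1.
have [us [vs [uvs zf]]] := missed_classical Habs pos mis r'r.
have s2 : size ('X + b%:P : {poly K})%ring = 2%N by exact: size_XaddC.
have sn1 := gauss_seminorm Habs; have m0 := pos _ sn1.
have n1 := hnorm_norm sn1 m0.
have G1 : G <= 1 by rewrite GE; exact: ker_le1.
(* Translation by [b] with [abs b <= 1] preserves the Gauss norm, so the same [G] works at every
   centre. *)
have g1 h : gauss abs 1 (h \Po ('X + b%:P))%ring = gauss_norm abs h.
  rewrite -/(gauss_at abs b 1 h) gauss_norm_eq //.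
  have s1 := gauss_at_seminorm Habs 0%ring Rle_0_1.
  rewrite (gauss_at_eq (x := gauss_at abs 0%ring 1) (b := 0%ring) Habs s1) // gauss_at_XsubC //;
    try exact: Rle_0_1.
  - by rewrite sub0r absN //; rmax_lra.
  - by rewrite subr0 abs0 //; rmax_lra.
have cmb u v : (u *: (f \Po ('X + b%:P)) + v *: (g \Po ('X + b%:P)) =
    (u *: f + v *: g) \Po ('X + b%:P))%ring.
  by rewrite comp_polyD !comp_polyZ.
exists us, vs; split.
- by rewrite !size_comp_poly2.
- by move=> x sx; exact: (pos _ (sn_translate b sx)).
- split=> // u v uv; rewrite cmb !g1.
  have := ker_diag_le Habs n1 uv; rewrite -GE /hnorm => le.
  have e : gauss_norm abs (u *: f + v *: g)%ring / Rmax (gauss_norm abs f) (gauss_norm abs g) *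
    Rmax (gauss_norm abs f) (gauss_norm abs g) = gauss_norm abs (u *: f + v *: g)%ring.
    by field; lra.
  by rewrite -[X in _ <= X]e; apply: Rmult_le_compat_r; lra.
- split=> //; split=> // j; rewrite cmb.
  rewrite -(@gauss_of_zero_free _ r'); first exact: gauss_ge.
  + lra.
  + move=> z; rewrite rootE horner_comp !hornerE => /eqP rz.
    apply: Rnot_lt_le => lt; apply: (zf (z + b)%ring); first by rewrite addrK; lra.
    by rewrite -rz !hornerE.
- split; first by apply: lip_const_ge.
  by move=> n n1' nd; apply: lip_const_roots.
Qed.

End Limit.
(** * The Lipschitz bound *)

Section Lipschitz.
Variables (K : closedFieldType) (abs : K -> R).
Hypothesis Habs : nonarch_complete_abs abs.
Implicit Types (x y : {poly K} -> R) (h : {poly K}) (a b c u v z : K) (X Y : bpoint K).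

Lemma gauss_norm_gauss1 : gauss_norm abs = gauss abs 1.
Proof.
rewrite gauss_norm_eq //; apply: functional_extensionality => h.
by rewrite /gauss_at polyC0 addr0 comp_polyXr.
Qed.

Lemma binv_zetaG : binv abs (zetaG abs) = zetaG abs.
Proof.
have bz := zetaG_berk Habs; apply: (ell_inj Habs) => //; first exact: binv_berk.
rewrite ell_binv //; apply: functional_extensionality => u; apply: functional_extensionality => v.
rewrite /swap /zetaG gauss_norm_eq // !ell_gauss0 //; try exact: Rle_refl.
by rewrite /Rdiv Rinv_1 !Rmult_1_r Rmax_comm.
Qed.

Lemma ker_radius x : is_seminorm abs x -> x 'X%ring <= 1 ->
  ker abs (ell abs (Some x)) (ell abs (Some x)) = radius x.
Proof.
move=> sx x1; rewrite -(@diamG_ker K abs Habs (Some x)) //= sn_X_of_Plin.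
by rewrite Rmax_left //; field.
Qed.

Lemma chart_point X b (t : R) : is_berk abs X -> abs b <= 1 -> t < 1 ->
  ell abs X 1%ring (- b)%ring <= t ->
  exists x, [/\ X = Some x, is_seminorm abs x, x ('X - b%:P)%ring <= t &
    ker abs (ell abs X) (ell abs X) = radius x].
Proof.
case: X => [x|] bX b1 t1; last by rewrite /= abs1 //; lra.
rewrite ell_sub => le; exists x.
have xX := Rmax_r 1 (x 'X%ring); have m1 := Rmax1_ge1 (x 'X%ring).
have lt : x ('X - b%:P)%ring < Rmax 1 (x 'X%ring).
  apply: (Rmult_lt_reg_r (/ Rmax 1 (x 'X%ring))); first by apply: Rinv_0_lt_compat; lra.
  by rewrite Rinv_r; lra.
have x1 : x 'X%ring <= 1.
  have := sn_X_le Habs bX b; move: lt; rmax_lra.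
split=> //; last exact: ker_radius.
by move: le; rewrite Rmax_left // /Rdiv Rinv_1 Rmult_1_r.
Qed.

Lemma berk_chart X : is_berk abs X -> exists x, [/\ is_seminorm abs x, x 'X%ring <= 1 &
  X = Some x \/ X = binv abs (Some x)].
Proof.
have shrink Z : is_berk abs Z -> ell abs Z 1%ring 0%ring < 1 ->
    exists x, [/\ is_seminorm abs x, x 'X%ring <= 1 & Z = Some x].
  case: Z => [x|] bZ; last by rewrite /= abs1 //; lra.
  have -> : ell abs (Some x) 1%ring 0%ring = x 'X%ring / Rmax 1 (x 'X%ring).
    by have := ell_sub abs x 0%ring; rewrite oppr0 subr0.
  move=> lt; exists x; split=> //.
  apply: Rnot_lt_le => gt; move: lt; rewrite Rmax_right; last lra.
  by rewrite /Rdiv Rinv_r; lra.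
move=> bX; have [|ge] := Rlt_dec (ell abs X 1%ring 0%ring) 1.
  by move=> /(shrink _ bX) [x [sx x1 ->]]; exists x; split=> //; left.
(* The value [1] still allows [x 'X = 1], where the charts overlap; the inversion is used only
   beyond. *)
case: (classic (exists x, X = Some x /\ x 'X%ring <= 1)) => [[x [e x1]]|nx].
  by exists x; split=> //; [move: bX; rewrite e | left].
have bI := binv_berk Habs bX.
have [|x [sx x1 e]] := shrink _ bI; last first.
  by exists x; split=> //; right; rewrite -e binvK.
rewrite ell_binv // /swap.
case: X bX ge nx {bI} => [x|] bX ge nx; last by rewrite /= abs0 //; lra.
rewrite ell01 // -[X in _ < X]Rinv_1.
have x1 : 1 < x 'X%ring by apply: Rnot_le_lt => le; apply: nx; exists x.
rewrite Rmax_right; last lra.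
by apply: Rinv_lt_contravar; lra.
Qed.

Section Map.
Variables (f g : {poly K}) (d : nat) (r r' : R).
Hypothesis g0 : g != 0%ring.
Hypothesis cop : coprimep f g.
Hypothesis dE : d = (maxn (size f) (size g)).-1.
Hypothesis d1 : leq 1 d.
Hypothesis Br : B0set abs f g r.
Hypothesis r'r : 0 < r' < r.

Let f' := rev_poly d f.
Let g' := rev_poly d g.
Let G := GIR abs f g.
Let L := lip_const G r' d.
Let psi X := ell abs (phi_act abs f g X).

Let pos x : is_seminorm abs x -> 0 < Rmax (x f) (x g).
Proof. by move=> sx; exact: (sn_coprime_gt0 Habs sx cop). Qed.

Let pos' x : is_seminorm abs x -> 0 < Rmax (x f') (x g').
Proof. by move=> sx; exact: (rev_poly_gt0 Habs g0 cop dE sx). Qed.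

Lemma psi_norm X : is_berk abs X -> form_norm abs (psi X).
Proof. by move=> bX; apply: ell_norm => //; exact: phi_act_berk. Qed.

Lemma psi_Some x : is_seminorm abs x -> psi (Some x) = hnorm f g x.
Proof. by move=> sx; have [] := phi_act_Some Habs sx (pos sx). Qed.

Lemma psi_binv x : is_seminorm abs x -> psi (binv abs (Some x)) = hnorm f' g' x.
Proof.
move=> sx; rewrite /psi (phi_act_binv Habs g0 cop dE sx).
by have [] := phi_act_Some Habs sx (pos' sx).
Qed.

Lemma GIR_ker : G = ker abs (psi (zetaG abs)) (psi (zetaG abs)).
Proof.
rewrite /G /GIR (diamG_ker Habs) //; apply: phi_act_berk => //; exact: zetaG_berk.
Qed.

Lemma GIR_gt0 : 0 < G.
Proof.
rewrite GIR_ker psi_Some; last exact: gauss_seminorm.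
rewrite gauss_norm_gauss1; exact: (ker_gauss1_gt0 Habs cop dE d1).
Qed.

Let r'1 : 0 < r' <= 1.
Proof. by have [r1 _] := Br; lra. Qed.

Lemma form_dist_chart x b (t : R) : is_seminorm abs x -> abs b <= 1 ->
  x ('X - b%:P)%ring <= t -> 0 < t <= 1 ->
  form_dist abs (hnorm f g x) (hnorm f g (gauss_at abs b t)) <= L * (t - radius x).
Proof.
move=> sx b1 xb t01; have L0 := lip_const_gt0 d GIR_gt0 (proj1 r'1).
apply: (form_dist_sn_gauss Habs pos _ sx b1 xb t01); last by rewrite /L; lra.
move=> b' b'1; apply: (core_data_of_misses Habs) => //.
- exact: (size_f_le dE).
- exact: (size_g_le dE).
- exact: GIR_gt0.
- by rewrite GIR_ker psi_Some //; exact: gauss_seminorm.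
- exact: (proj2 r'r).
- exact: B0set_misses.
Qed.

Lemma form_dist_chart_rev x b (t : R) : is_seminorm abs x -> abs b <= 1 ->
  x ('X - b%:P)%ring <= t -> 0 < t <= 1 ->
  form_dist abs (hnorm f' g' x) (hnorm f' g' (gauss_at abs b t)) <= L * (t - radius x).
Proof.
move=> sx b1 xb t01; have L0 := lip_const_gt0 d GIR_gt0 (proj1 r'1).
apply: (form_dist_sn_gauss Habs pos' _ sx b1 xb t01); last by rewrite /L; lra.
move=> b' b'1; apply: (core_data_of_misses Habs) => //.
- exact: size_rev_poly.
- exact: size_rev_poly.
- exact: GIR_gt0.
- by rewrite GIR_ker -{1 2}binv_zetaG psi_binv //; exact: gauss_seminorm.
- exact: (proj2 r'r).
- exact: B0set_misses_rev.
Qed.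

(** [J] is the image of [zeta_{b,t}], with [b] the root of the form in the chart where [abs b <= 1].
    It depends only on the form and on [t], so two points on which the form is small share it as a
    stop between their images. *)
Lemma psi_dist_common u v (t : R) : unit_form abs u v -> 0 < t < 1 ->
  exists J, form_norm abs J /\ forall X, is_berk abs X -> ell abs X u v <= t ->
    form_dist abs (psi X) J <= L * (t - ker abs (ell abs X) (ell abs X)).
Proof.
move=> uv [t0 t1]; have [u1 v1] := unit_form_le uv.
have scale X c e : is_berk abs X -> abs c = 1 ->
    ell abs X (c * e)%ring (c * 1)%ring = ell abs X e 1%ring /\
    ell abs X (c * 1)%ring (c * e)%ring = ell abs X 1%ring e.
  by move=> bX c1; have [_ [h _]] := ell_norm Habs bX; rewrite !h c1 !Rmult_1_l.
have sgt b : is_seminorm abs (gauss_at abs b t) by apply: gauss_at_seminorm => //; lra.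
move: (uv); rewrite /unit_form {1}/Rmax; case: Rle_dec => _ e1.
- have v0 : v != 0%ring by apply/eqP => e; move: e1; rewrite e abs0 //; lra.
  pose b : K := (- (u / v))%ring.
  have b1 : abs b <= 1 by rewrite absN // absM // absV // e1; lra.
  exists (hnorm f' g' (gauss_at abs b t)); split.
    by apply: hnorm_norm => //; exact: pos'.
  move=> X bX le; have bI := binv_berk Habs bX.
  have le' : ell abs (binv abs X) 1%ring (- b)%ring <= t.
    rewrite ell_binv // /swap /b opprK; have [<- _] := @scale X v (u / v)%ring bX e1.
    by rewrite mulr1 mulrC divfK.
  have [x [eX sx xb kx]] := chart_point bI b1 t1 le'.
  have -> : ker abs (ell abs X) (ell abs X) = radius x.
    by rewrite -kx ell_binv // (ker_swap Habs _ (ell_norm Habs bX)).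
  rewrite -(binvK Habs bX) eX psi_binv //.
  by apply: form_dist_chart_rev => //; lra.
- have u0 : u != 0%ring by apply/eqP => e; move: e1; rewrite e abs0 //; lra.
  pose b : K := (- (v / u))%ring.
  have b1 : abs b <= 1 by rewrite absN // absM // absV // e1; lra.
  exists (hnorm f g (gauss_at abs b t)); split.
    by apply: hnorm_norm => //; exact: pos.
  move=> X bX le.
  have le' : ell abs X 1%ring (- b)%ring <= t.
    rewrite /b opprK; have [_ <-] := @scale X u (v / u)%ring bX e1.
    by rewrite mulr1 mulrC divfK.
  have [x [eX sx xb kx]] := chart_point bX b1 t1 le'.
  rewrite kx eX psi_Some //.
  by apply: form_dist_chart => //; lra.
Qed.

Lemma psi_dist_zetaG X : is_berk abs X ->
  form_dist abs (psi X) (psi (zetaG abs)) <= L * (1 - ker abs (ell abs X) (ell abs X)).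
Proof.
move=> bX; have [x [sx x1 eX]] := berk_chart bX.
have b0 : abs 0%ring <= 1 by rewrite abs0 //; lra.
have x0 : x ('X - 0%:P)%ring <= 1 by rewrite subr0.
have sg := gauss_seminorm Habs.
case: eX => eX.
- rewrite eX ker_radius // !psi_Some // gauss_norm_eq //.
  by apply: form_dist_chart => //; lra.
- have -> : ker abs (ell abs X) (ell abs X) = radius x.
    rewrite -(ker_radius sx x1) eX ell_binv // (ker_swap Habs) //.
    exact: (@ell_norm K abs Habs (Some x)).
  rewrite eX psi_binv // -binv_zetaG psi_binv // gauss_norm_eq //.
  by apply: form_dist_chart_rev => //; lra.
Qed.

Lemma form_dist_psi_le X Y : is_berk abs X -> is_berk abs Y ->
  form_dist abs (psi X) (psi Y) <= L * form_dist abs (ell abs X) (ell abs Y).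
Proof.
move=> bX bY; have nX := ell_norm Habs bX; have nY := ell_norm Habs bY.
have pX := psi_norm bX; have pY := psi_norm bY.
have L0 : 0 < L := lip_const_gt0 d GIR_gt0 (proj1 r'1).
have k1 := ker_le1 Habs nX nY; have k0 := ker_ge0 Habs (ell abs Y) nX.
(* Kernel [1] means that [X] and [Y] meet at the Gauss point, and the path is cut there. *)
case: (Rlt_dec (ker abs (ell abs X) (ell abs Y)) 1) => lt; last first.
  have bz := zetaG_berk Habs; have pz := psi_norm bz.
  apply: Rle_trans (form_dist_triangle Habs pX pz pY) _.
  have := psi_dist_zetaG bX; have := psi_dist_zetaG bY.
  rewrite (form_distC _ (psi (zetaG abs))) [form_dist abs (ell abs X) _]/form_dist.
  have -> : ker abs (ell abs X) (ell abs Y) = 1 by lra.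
  by lra.
apply: le_epsilon => eps e0.
set k := ker _ _ _ in k1 k0 lt.
(* The first bound keeps [t] below [1], as the charts require; by the second, overshooting [k] costs
   at most [eps] over the two legs. *)
pose t := Rmin ((1 + k) / 2) (k + eps / (2 * L)).
have eL : 0 < eps / (2 * L) by apply: Rdiv_lt_0_compat; lra.
have kt : k < t by apply: Rmin_glb_lt; lra.
have t1 : t < 1 by apply: Rle_lt_trans (Rmin_l _ _) _; lra.
have te : t <= k + eps / (2 * L) by exact: Rmin_r.
have [u [v [uv [aX aY]]]] := ker_lt Habs nX kt.
have [|J [nJ hJ]] := psi_dist_common uv (t := t); first lra.
apply: Rle_trans (form_dist_triangle Habs pX nJ pY) _.
have := hJ X bX (Rlt_le _ _ aX); have := hJ Y bY (Rlt_le _ _ aY).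
rewrite (form_distC _ J) [form_dist abs (ell abs X) _]/form_dist -/k.
have : 2 * L * t <= 2 * L * k + eps.
  have -> : 2 * L * k + eps = 2 * L * (k + eps / (2 * L)) by field; lra.
  by apply: Rmult_le_compat_l; lra.
by lra.
Qed.

End Map.

(** The first term scales by [/ lam ^ d] and the second by [/ lam], which is no larger. *)
Lemma lip_const_scale (G B lam : R) (d : nat) : 0 < G -> 0 < B -> 0 < lam <= 1 -> leq 1 d ->
  lip_const G (lam * B) d <= / lam ^ d * lip_const G B d.
Proof.
move=> G0 B0 l01 d1.
have ld : 0 < lam ^ d by apply: pow_lt; lra.
have Bd : 0 < B ^ d by apply: pow_lt; lra.
have p0 : 0 < Rpower G (1 / INR d) by exact: exp_pos.
have i0 : 0 < / lam ^ d by apply: Rinv_0_lt_compat.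
rewrite /lip_const -RmaxRmult; last lra.
apply: Rmax_lub.
- apply: Rle_trans (Rmax_l _ _); rewrite Rpow_mult_distr; apply: Req_le.
  by field; lra.
- apply: Rle_trans (Rmax_r _ _).
  have -> : INR d / (Rpower G (1 / INR d) * (lam * B)) =
            / lam * (INR d / (Rpower G (1 / INR d) * B)) by field; lra.
  apply: Rmult_le_compat_r.
    apply: Rmult_le_pos; first exact: pos_INR.
    by apply/Rlt_le/Rinv_0_lt_compat/Rmult_lt_0_compat.
  apply: Rinv_le_contravar => //.
  case: d d1 {ld Bd p0 i0} => // n _ /=.
  have : lam ^ n <= 1 by rewrite -(pow1 n); apply: pow_incr; lra.
  by nra.
Qed.

End Lipschitz.

Theorem theorem2 (K : closedFieldType) (abs : K -> R)
  (Habs : nonarch_complete_abs abs)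
  (f g : {poly K}) (d : nat)
  (Hg : g != @GRing.zero _) (Hcop : coprimep f g)
  (Hd : d = (maxn (size f) (size g)).-1) (Hd1 : leq 1 d)
  (B0 : R) (HB0 : is_lub (B0set abs f g) B0) :
  forall X Y : bpoint K, is_berk abs X -> is_berk abs Y -> X <> Y ->
    berk_dist abs (phi_act abs f g X) (phi_act abs f g Y) <=
    Rmax (1 / (GIR abs f g * B0 ^ d))
         (INR d / (Rpower (GIR abs f g) (1 / INR d) * B0)) * berk_dist abs X Y.
Proof.
move=> X Y bX bY _.
have bpX := phi_act_berk Habs Hg Hcop bX; have bpY := phi_act_berk Habs Hg Hcop bY.
rewrite !berk_dist_form // -/(lip_const (GIR abs f g) B0 d).
have [ub lub] := HB0.
(* An empty set of reals has no least upper bound. *)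
have [r1 Br1] : exists r, B0set abs f g r.
  apply: NNPP => nex; have : B0 <= B0 - 1; last lra.
  by apply: lub => r Br; case: nex; exists r.
have B00 : 0 < B0 by have := ub _ Br1; have [? _] := Br1; lra.
have G0 := GIR_gt0 Habs Hg Hcop Hd Hd1.
set D1 := form_dist abs (ell abs (phi_act abs f g X)) _.
set D2 := form_dist abs (ell abs X) _.
have D20 : 0 <= D2 by apply: form_dist_ge0 => //; exact: ell_norm.
have D10 : 0 <= D1 by apply: form_dist_ge0 => //; exact: ell_norm.
(* The radius [lam * B0] lies strictly below some member of [B0set]. Letting [lam] tend to [1]
   afterwards removes the loss [lam ^ d]. *)
have key (lam : R) : 0 < lam < 1 -> lam ^ d * D1 <= lip_const (GIR abs f g) B0 d * D2.
  move=> l01; have ld : 0 < lam ^ d by apply: pow_lt; lra.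
  have [r [Br lr]] : exists r, B0set abs f g r /\ lam * B0 < r.
    apply: NNPP => nex; have : B0 <= lam * B0; last by nra.
    by apply: lub => r Br; apply: Rnot_lt_le => lt; apply: nex; exists r.
  have lB : 0 < lam * B0 < r by split=> //; apply: Rmult_lt_0_compat; lra.
  have := form_dist_psi_le Habs Hg Hcop Hd Hd1 Br lB bX bY; rewrite -/D1 -/D2 => le.
  have l01' : 0 < lam <= 1 by lra.
  have sc := lip_const_scale G0 B00 l01' Hd1.
  have le2 : D1 <= / lam ^ d * lip_const (GIR abs f g) B0 d * D2.
    by apply: Rle_trans le _; apply: Rmult_le_compat_r.
  have -> : lip_const (GIR abs f g) B0 d * D2 =
    lam ^ d * (/ lam ^ d * lip_const (GIR abs f g) B0 d * D2) by field; lra.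
  by apply: Rmult_le_compat_l; lra.
have cP : continuity_pt (fun lam => lam ^ d * D1) 1.
  by apply: derivable_continuous_pt; reg.
apply: le_epsilon => eps e0.
have [eta [eta0 near]] := cP eps e0.
pose lam := 1 - Rmin (1 / 2) (eta / 2).
have m0 : 0 < Rmin (1 / 2) (eta / 2) by apply: Rmin_pos; lra.
have m1 : Rmin (1 / 2) (eta / 2) <= 1 / 2 by exact: Rmin_l.
have m2 : Rmin (1 / 2) (eta / 2) <= eta / 2 by exact: Rmin_r.
have : Rabs (lam ^ d * D1 - 1 ^ d * D1) < eps.
  apply: (near lam); split; first by split=> //; rewrite /lam; lra.
  by rewrite /= /Rdist Rabs_left1 /lam; lra.
rewrite pow1 Rmult_1_l => /Rabs_def2 [_].
have : 0 < lam < 1 by rewrite /lam; lra.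
by move=> /key; lra.
Qed.
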